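(* Let $d\in\mathbb N$ and let $\mathcal Q\colon\mathbb R^d\to\mathbb R^d$ be a mapping. Then the following statements are equivalent: (i) $\mathcal Q$ is a convex $Q$-operator. (ii) $\mathcal Q$ is convex, satisfies the positive maximum principle, and $\mathcal Q\alpha=0$ for all $\alpha\in\mathbb R$. (iii) There exist a set $\mathcal P\subset\mathbb R^{d\times d}$ of $Q$-matrices and a family $f=(f_q)_{q\in\mathcal P}\subset\mathbb R^d$ with $\sup_{q\in\mathcal P}f_q=f_{q_0}=0$ for some $q_0\in\mathcal P$ such that $\mathcal Q u_0=\sup_{q\in\mathcal P}(qu_0+f_q)$ for all $u_0\in\mathbb R^d$ (suprema componentwise). (iv) There exists a uniformly continuous convex Markovian semigroup $\mathscr S=(\mathscr S(t))_{t\ge0}$ on $\mathbb R^d$ with $\mathcal Q u_0=\lim_{h\searrow0}\frac{\mathscr S(h)u_0-u_0}{h}$ for all $u_0\in\mathbb R^d$. (v) There exists a convex Markov chain $(\Omega,\mathcal F,\mathcal E,(X_t)_{t\ge0})$ such that $\mathcal Q u_0=\lim_{h\searrow0}\frac{\mathcal E(u_0(X_h))-u_0}{h}$ for all $u_0\in\mathbb R^d$. Moreover, in this case, for every convex Markov chain as in (v), every semigroup $\mathscr S$ as in (iv), every pair $(\mathcal P,f)$ as in (iii) and every $u_0\in\mathbb R^d$, the function $u\colon[0,\infty)\to\mathbb R^d$, $u(t):=\mathcal E(u_0(X_t))$, is the unique classical solution $u\in C^1([0,\infty);\mathbb R^d)$ of the initial value problem $u'(t)=\mathcal Q u(t)=\sup_{q\in\mathcal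 P}(qu(t)+f_q)$ for $t\ge0$, $u(0)=u_0$; furthermore $u(t)=\mathscr S(t)u_0$ for all $t\ge0$, and $\mathscr S$ is the semigroup envelope of $(\mathcal P,f)$.
   Context: Vectors $u\in\mathbb R^d$ are identified with functions $\{1,\dots,d\}\to\mathbb R$, $u_i=u(i)$; $\|u\|_\infty=\max_i|u_i|$; a real number $\alpha$ is identified with the constant vector $(\alpha,\dots,\alpha)^T$; $e_i$ is the $i$-th unit vector. Inequalities, suprema and maxima of vectors are componentwise. A map $F\colon\mathbb R^d\to\mathbb R^d$ is convex if each component $F_i$ is convex. A $Q$-matrix is a matrix $q\in\mathbb R^{d\times d}$ with $q_{ii}\le0$ for all $i$, $q_{ij}\ge0$ for $i\ne j$, and $\sum_{j}q_{ij}=0$ for all $i$. A map $\mathcal Q\colon\mathbb R^d\to\mathbb R^d$ is a $Q$-operator if (a) $(\mathcal Q(\lambda e_i))_i\le0$ for all $\lambda>0$ and all $i$; (b) $(\mathcal Q(-\lambda e_j))_i\le0$ for all $\lambda>0$ and all $i\neq j$; (c) $\mathcal Q\alpha=0$ for all $\alpha\in\mathbb R$. $\mathcal Q$ satisfies the positive maximum principle if for all $u\in\mathbb R^d$ and $i$: $(\mathcal Qu)_i\le0$ whenever $u_i\ge u_j$ for all $j$. A kernel is a map $\mathcal E\colon\mathbb R^d\to\mathbb R^d$ that is monotone ($u\le v\Rightarrow \mathcal E u\le\mathcal E v$) and preserves constants ($\mathcal E\alpha=\alpha$ for $\alpha\in\mathbb R$). A semigroup is a family $(\mathscr S(t))_{t\ge0}$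 of maps $\mathbb R^d\to\mathbb R^d$ with $\mathscr S(0)=I$ and $\mathscr S(s+t)=\mathscr S(s)\circ\mathscr S(t)$; it is uniformly continuous if $\mathscr S(h)\to I$ uniformly on compact sets as $h\searrow0$, Markovian if each $\mathscr S(t)$ is a kernel, convex if each $\mathscr S(t)$ is convex. For a set $\mathcal P$ of $Q$-matrices and $f=(f_q)_{q\in\mathcal P}$ with $\sup_q f_q=f_{q_0}=0$ for some $q_0\in\mathcal P$, put $S_q(t)u_0:=e^{tq}u_0+\int_0^te^{sq}f_q\,ds$ for $t\ge0$, $u_0\in\mathbb R^d$. The semigroup envelope of $(\mathcal P,f)$ is the semigroup $\mathscr S$ with $\mathscr S(t)u_0\ge S_q(t)u_0$ for all $t,u_0,q\in\mathcal P$, and such that $\mathscr S(t)u_0\le\mathscr T(t)u_0$ for all $t,u_0$ for every other semigroup $\mathscr T$ with this domination property. A convex expectation space is a triple $(\Omega,\mathcal F,\mathcal E)$ with $(\Omega,\mathcal F)$ measurable and $\mathcal E(X)=\sup_{\mathbb P\in\mathcal P}(\mathbb E_{\mathbb P}(X)-\alpha_{\mathbb P})$ for all bounded measurable $X$, for some set $\mathcal P$ of probability measures on $(\Omega,\mathcal F)$ and $(\alpha_{\mathbb P})\subset[0,\infty)$ with $\inf_{\mathbb P}\alpha_{\mathbb P}=0$. A convex Markov chain is a quadruple $(\Omega,\mathcal F,\mathcal E,(X_t)_{t\ge0})$ where $(\Omega,\mathcal F)$ is a measurable space, each $X_t\colon\Omega\to\{1,\dots,d\}$ is measurable, $\mathcal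 E=(\mathcal E_1,\dots,\mathcal E_d)^T$ with each $(\Omega,\mathcal F,\mathcal E_i)$ a convex expectation space, writing $\mathcal E(Y):=(\mathcal E_1(Y),\dots,\mathcal E_d(Y))^T$, such that $\mathcal E(u_0(X_0))=u_0$ for all $u_0\in\mathbb R^d$, and the Markov property holds: for all $s,t\ge0$, $n\in\mathbb N$, $0\le t_1<\dots<t_n\le s$ and all $v_0\colon\{1,\dots,d\}^{n+1}\to\mathbb R$, with $Y:=(X_{t_1},\dots,X_{t_n})$ and $\mathcal E_{i,t}(w):=\mathcal E_i(w(X_t))$ for $w\in\mathbb R^d$, one has $\mathcal E(v_0(Y,X_{s+t}))=\mathcal E\big[\omega\mapsto\mathcal E_{X_s(\omega),t}(v_0(Y(\omega),\cdot))\big]$. *)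

(* Defs.v *)
From Stdlib Require Import Reals Lra List Sorting.Sorted ClassicalEpsilon Factorial.
Open Scope R_scope.
Set Implicit Arguments.

Definition Idx (d : nat) : Type := {i : nat | Nat.ltb i d = true}.
Definition Vec (d : nat) : Type := Idx d -> R.
Definition Mat (d : nat) : Type := Idx d -> Idx d -> R.

Fixpoint nsum (n : nat) (h : nat -> R) : R :=
  match n with O => 0 | S n => nsum n h + h n end.

Definition vsum {d : nat} (g : Idx d -> R) : R :=
  nsum d (fun j => match Nat.ltb j d as b return (Nat.ltb j d = b -> R) with
                   | true => fun h => g (exist _ j h)
                   | false => fun _ => 0 end eq_refl).

Definition idx_eqb {d : nat} (i j : Idx d) : bool :=
  Nat.eqb (proj1_sig i) (proj1_sig j).

Definition cst {d : nat} (a : R) : Vec d := fun _ => a.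
Definition unitv {d : nat} (i : Idx d) : Vec d :=
  fun j => if idx_eqb j i then 1 else 0.
Definition vscale {d : nat} (a : R) (u : Vec d) : Vec d := fun j => a * u j.

Definition mv {d : nat} (q : Mat d) (u : Vec d) : Vec d :=
  fun i => vsum (fun j => q i j * u j).
Definition mmul {d : nat} (a b : Mat d) : Mat d :=
  fun i j => vsum (fun k => a i k * b k j).
Definition mid (d : nat) : Mat d := fun i j => if idx_eqb i j then 1 else 0.
Fixpoint mpow {d : nat} (q : Mat d) (k : nat) : Mat d :=
  match k with O => @mid d | S k => mmul q (mpow q k) end.

Definition mexp {d : nat} (q : Mat d) (t : R) : Mat d :=
  fun i j => epsilon (inhabits 0)
    (fun l => infinite_sum (fun k => t ^ k / INR (fact k) * mpow q k i j) l).

Definition Qmatrix {d : nat} (q : Mat d) : Prop :=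
  (forall i, q i i <= 0) /\
  (forall i j, i <> j -> 0 <= q i j) /\
  (forall i, vsum (fun j => q i j) = 0).

Definition convex_map {d : nat} (F : Vec d -> Vec d) : Prop :=
  forall (u v : Vec d) (l : R), 0 <= l <= 1 -> forall i,
    F (fun j => l * u j + (1 - l) * v j) i <= l * F u i + (1 - l) * F v i.

Definition Qoperator {d : nat} (Q : Vec d -> Vec d) : Prop :=
  (forall (l : R) (i : Idx d), 0 < l -> Q (vscale l (unitv i)) i <= 0) /\
  (forall (l : R) (i j : Idx d), 0 < l -> i <> j ->
      Q (vscale (- l) (unitv j)) i <= 0) /\
  (forall (a : R) i, Q (cst a) i = 0).

Definition pos_max_principle {d : nat} (Q : Vec d -> Vec d) : Prop :=
  forall (u : Vec d) (i : Idx d), (forall j, u j <= u i) -> Q u i <= 0.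

Definition sup_representation {d : nat} (Q : Vec d -> Vec d)
    (P : Mat d -> Prop) (f : Mat d -> Vec d) : Prop :=
  (forall q, P q -> Qmatrix q) /\
  (exists q0, P q0 /\ (forall i, f q0 i = 0) /\
              (forall q, P q -> forall i, f q i <= f q0 i)) /\
  (forall (u0 : Vec d) i,
      is_lub (fun y => exists q, P q /\ y = mv q u0 i + f q i) (Q u0 i)).

Definition is_semigroup {d : nat} (S : R -> Vec d -> Vec d) : Prop :=
  (forall u i, S 0 u i = u i) /\
  (forall s t, 0 <= s -> 0 <= t -> forall u i, S (s + t) u i = S s (S t u) i).

Definition kernel {d : nat} (E : Vec d -> Vec d) : Prop :=
  (forall u v : Vec d, (forall i, u i <= v i) -> forall i, E u i <= E v i) /\
  (forall (a : R) i, E (cst a) i = a).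

(** S(h) -> I uniformly on compact sets as h \searrow 0; every compact subset
    of R^d lies in a (compact) sup-norm ball, so we state it on balls. *)
Definition unif_continuous_sg {d : nat} (S : R -> Vec d -> Vec d) : Prop :=
  forall r eps, 0 < r -> 0 < eps -> exists delta, 0 < delta /\
    forall h, 0 < h < delta -> forall u : Vec d, (forall i, Rabs (u i) <= r) ->
      forall i, Rabs (S h u i - u i) <= eps.

Definition markovian_sg {d : nat} (S : R -> Vec d -> Vec d) : Prop :=
  forall t, 0 <= t -> kernel (S t).

Definition convex_sg {d : nat} (S : R -> Vec d -> Vec d) : Prop :=
  forall t, 0 <= t -> convex_map (S t).

Definition sg_generator {d : nat} (S : R -> Vec d -> Vec d) (Q : Vec d -> Vec d) :=
  forall (u0 : Vec d) i eps, 0 < eps -> exists delta, 0 < delta /\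
    forall h, 0 < h < delta -> Rabs ((S h u0 i - u0 i) / h - Q u0 i) < eps.

Definition Sq_value {d : nat} (q : Mat d) (fq : Vec d) (t : R) (u0 v : Vec d) : Prop :=
  forall i, exists pr : Riemann_integrable (fun s => mv (mexp q s) fq i) 0 t,
    v i = mv (mexp q t) u0 i + RiemannInt pr.

Definition dominates {d : nat} (P : Mat d -> Prop) (f : Mat d -> Vec d)
    (T : R -> Vec d -> Vec d) : Prop :=
  forall t (u0 : Vec d) q v, 0 <= t -> P q -> Sq_value q (f q) t u0 v ->
    forall i, v i <= T t u0 i.

Definition semigroup_envelope {d : nat} (P : Mat d -> Prop) (f : Mat d -> Vec d)
    (S : R -> Vec d -> Vec d) : Prop :=
  is_semigroup S /\ dominates P f S /\
  (forall T, is_semigroup T -> dominates P f T ->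
     forall t (u0 : Vec d) i, 0 <= t -> S t u0 i <= T t u0 i).

Definition sigma_algebra {Om : Type} (F : (Om -> Prop) -> Prop) : Prop :=
  F (fun _ => True) /\
  (forall A, F A -> F (fun w => ~ A w)) /\
  (forall A : nat -> Om -> Prop, (forall n, F (A n)) -> F (fun w => exists n, A n w)).

Definition prob_measure {Om : Type} (F : (Om -> Prop) -> Prop)
    (P : (Om -> Prop) -> R) : Prop :=
  (forall A, F A -> 0 <= P A) /\
  P (fun _ => True) = 1 /\
  (forall A : nat -> Om -> Prop, (forall n, F (A n)) ->
     (forall n m, n <> m -> forall w, A n w -> A m w -> False) ->
     infinite_sum (fun n => P (A n)) (P (fun w => exists n, A n w))).

Definition measurable {Om : Type} (F : (Om -> Prop) -> Prop) (X : Om -> R) : Prop :=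
  forall c, F (fun w => X w <= c).

Definition bounded_fun {Om : Type} (X : Om -> R) : Prop :=
  exists M, forall w, Rabs (X w) <= M.

Definition indic {Om : Type} (A : Om -> Prop) (w : Om) : R :=
  if excluded_middle_informative (A w) then 1 else 0.

Definition simple_val {Om : Type} (s : list (R * (Om -> Prop))) (w : Om) : R :=
  fold_right (fun p acc => fst p * indic (snd p) w + acc) 0 s.
Definition simple_int {Om : Type} (P : (Om -> Prop) -> R)
    (s : list (R * (Om -> Prop))) : R :=
  fold_right (fun p acc => fst p * P (snd p) + acc) 0 s.

(** E_P(X) = r (Lebesgue integral of a bounded measurable X, as the supremum
    of integrals of simple functions below X) *)
Definition is_expectation {Om : Type} (F : (Om -> Prop) -> Prop)
    (P : (Om -> Prop) -> R) (X : Om -> R) (r : R) : Prop :=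
  is_lub (fun y => exists s : list (R * (Om -> Prop)),
             (forall p, In p s -> F (snd p)) /\
             (forall w, simple_val s w <= X w) /\
             y = simple_int P s) r.

Definition convex_expectation {Om : Type} (F : (Om -> Prop) -> Prop)
    (E : (Om -> R) -> R) : Prop :=
  sigma_algebra F /\
  exists (I : Type) (P : I -> (Om -> Prop) -> R) (al : I -> R),
    (forall k, prob_measure F (P k)) /\
    (forall k, 0 <= al k) /\
    (forall eps, 0 < eps -> exists k, al k < eps) /\
    (forall X, measurable F X -> bounded_fun X ->
       is_lub (fun y => exists k r, is_expectation F (P k) X r /\ y = r - al k) (E X)).

Record ConvexMarkovChain (d : nat) := {
  cmc_Om : Type;
  cmc_F : (cmc_Om -> Prop) -> Prop;
  cmc_E : Idx d -> (cmc_Om -> R) -> R;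
  cmc_X : R -> cmc_Om -> Idx d;
  cmc_Xmeas : forall t i, 0 <= t -> cmc_F (fun w => cmc_X t w = i);
  cmc_cexp : forall i, convex_expectation cmc_F (cmc_E i);
  cmc_init : forall (u0 : Vec d) i, cmc_E i (fun w => u0 (cmc_X 0 w)) = u0 i;
  cmc_markov : forall s t, 0 <= s -> 0 <= t ->
    forall ts : list R, ts <> nil -> Sorted Rlt ts ->
    Forall (fun r => 0 <= r <= s) ts ->
    forall (v0 : list (Idx d) -> Idx d -> R) i,
      cmc_E i (fun w => v0 (map (fun r => cmc_X r w) ts) (cmc_X (s + t) w)) =
      cmc_E i (fun w => cmc_E (cmc_X s w)
                 (fun w' => v0 (map (fun r => cmc_X r w) ts) (cmc_X t w')))
}.

Definition chain_generator {d : nat} (M : ConvexMarkovChain d) (Q : Vec d -> Vec d) :=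
  forall (u0 : Vec d) i eps, 0 < eps -> exists delta, 0 < delta /\
    forall h, 0 < h < delta ->
      Rabs ((cmc_E M i (fun w => u0 (cmc_X M h w)) - u0 i) / h - Q u0 i) < eps.

Definition deriv_within_nonneg (g : R -> R) (t D : R) : Prop :=
  forall eps, 0 < eps -> exists delta, 0 < delta /\
    forall h, h <> 0 -> Rabs h < delta -> 0 <= t + h ->
      Rabs ((g (t + h) - g t) / h - D) < eps.

Definition cont_within_nonneg (g : R -> R) (t : R) : Prop :=
  forall eps, 0 < eps -> exists delta, 0 < delta /\
    forall s, 0 <= s -> Rabs (s - t) < delta -> Rabs (g s - g t) < eps.

Definition classical_solution {d : nat} (Q : Vec d -> Vec d) (u0 : Vec d)
    (u : R -> Vec d) : Prop :=
  (forall i, u 0 i = u0 i) /\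
  (forall t, 0 <= t -> forall i,
     deriv_within_nonneg (fun s => u s i) t (Q (u t) i) /\
     cont_within_nonneg (fun s => Q (u s) i) t).

Definition cond_i {d : nat} (Q : Vec d -> Vec d) := convex_map Q /\ Qoperator Q.
Definition cond_ii {d : nat} (Q : Vec d -> Vec d) :=
  convex_map Q /\ pos_max_principle Q /\ (forall (a : R) i, Q (cst a) i = 0).
Definition cond_iii {d : nat} (Q : Vec d -> Vec d) :=
  exists (P : Mat d -> Prop) (f : Mat d -> Vec d), sup_representation Q P f.
Definition cond_iv {d : nat} (Q : Vec d -> Vec d) :=
  exists S : R -> Vec d -> Vec d, is_semigroup S /\ unif_continuous_sg S /\
    convex_sg S /\ markovian_sg S /\ sg_generator S Q.
Definition cond_v {d : nat} (Q : Vec d -> Vec d) :=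
  exists M : ConvexMarkovChain d, chain_generator M Q.

(* Main.v *)
(** A convex Q-operator is a supremum of affine maps [u |-> q u + f_q] (one Hahn-Banach subgradient per
    point), hence dispersive: [(Q u)_i <= (Q v)_i] wherever [u - v] is maximal at [i]. Dispersivity gives a
    comparison principle for sub- and supersolutions of [u' = Q u], from which uniqueness, monotonicity and
    convexity of the flow, its identification with any semigroup generated by [Q], and the domination of all
    [S_q] follow. Minimality of the flow among the dominating semigroups [T] is a continuous induction in
    time, since to first order some [S_q] is as good as the flow.

    The chain lives on the space of all paths. Iterating the semigroup defines the expectation of cylinder
    functions; a subgradient of this convex functional is a normalised positive functional on cylinder
    functions, which, the path space being compact, is integration against a probability measure. *)
Require Import Defs.
From Stdlib Require Import Reals Lra Lia List Sorting.Sorted Eqdep_dec.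
From Stdlib Require Import Classical ClassicalEpsilon FunctionalExtensionality PropExtensionality.
From HB Require Import structures.
From mathcomp Require all_boot all_order all_algebra all_classical.
From mathcomp Require Rstruct topology normedtype sequences ereal measure.
From mathcomp Require boolp classical_sets filter.
From Coquelicot Require Coquelicot.
Open Scope R_scope.
Set Implicit Arguments.

(** * Finite sums and index sets *)

(** Condition (ii) is the hub of the equivalences. A generator controls only right difference
    quotients, so comparison is phrased with one-sided growth bounds instead of derivatives; a
    semigroup orbit can then be compared with the flow before it is known to be differentiable.
    Continuity of that orbit comes from sup-norm nonexpansiveness, which for a convex kernel follows
    from [E (u + c) <= E u + c]. The expectations of a chain at single times again form a convex
    Markovian semigroup, so the chain and the given semigroup are identified with the flow by the
    same lemma. In the construction of the chain no regularity of paths is required. The nonlinear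
    expectation of a bounded function is the supremum over all penalised probability measures lying
    below the iterated expectation on cylinder functions. Everything tested by the Markov property
    is a cylinder function, and there the supremum is attained. *)

Lemma idx_eq (d : nat) (i j : Idx d) : proj1_sig i = proj1_sig j -> i = j.
Proof.
  destruct i as [i Hi], j as [j Hj]; simpl; intros <-.
  f_equal; apply UIP_dec; decide equality.
Qed.

Lemma idx_eqb_spec (d : nat) (i j : Idx d) : idx_eqb i j = true <-> i = j.
Proof.
  unfold idx_eqb; rewrite PeanoNat.Nat.eqb_eq; split.
  - apply idx_eq.
  - intros ->; reflexivity.
Qed.

Lemma idx_eq_dec (d : nat) (i j : Idx d) : {i = j} + {i <> j}.
Proof.
  destruct (idx_eqb i j) eqn:E.
  - left; now apply idx_eqb_spec.
  - right; intros H; apply idx_eqb_spec in H; congruence.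
Qed.

Lemma unitv_same (d : nat) (i : Idx d) : unitv i i = 1.
Proof.
  unfold unitv. replace (idx_eqb i i) with true; [reflexivity|].
  symmetry; now apply idx_eqb_spec.
Qed.

Lemma unitv_other (d : nat) (i j : Idx d) : j <> i -> unitv i j = 0.
Proof.
  unfold unitv; intros H. destruct (idx_eqb j i) eqn:E; [|reflexivity].
  apply idx_eqb_spec in E; contradiction.
Qed.

Lemma nsum_ext n (g h : nat -> R) : (forall k, (k < n)%nat -> g k = h k) -> nsum n g = nsum n h.
Proof. induction n as [|n IH]; simpl; intros H; auto. rewrite IH, H by auto; auto. Qed.

Lemma nsum_lin n (a b : R) (g h : nat -> R) :
  nsum n (fun k => a * g k + b * h k) = a * nsum n g + b * nsum n h.
Proof. induction n as [|n IH]; simpl; [ring|]. rewrite IH; ring. Qed.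

Lemma nsum_le n (g h : nat -> R) : (forall k, (k < n)%nat -> g k <= h k) -> nsum n g <= nsum n h.
Proof.
  induction n as [|n IH]; simpl; intros H; [lra|].
  apply Rplus_le_compat; [apply IH; auto | apply H; auto].
Qed.

Lemma nsum_single n (g : nat -> R) k : (k < n)%nat ->
  (forall j, (j < n)%nat -> j <> k -> g j = 0) -> nsum n g = g k.
Proof.
  induction n as [|n IH]; simpl; intros Hk H; [lia|].
  destruct (PeanoNat.Nat.eq_dec k n) as [->|Hn].
  - rewrite (nsum_ext (n:=n) g (fun _ => 0 * 0 + 0 * 0)).
    + rewrite (nsum_lin n 0 0 (fun _ => 0) (fun _ => 0)); ring.
    + intros j Hj; rewrite H by lia; ring.
  - rewrite IH, (H n) by (intros; try apply H; lia); ring.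
Qed.

(** Extension by zero to all naturals, written exactly as the summand of [vsum] so that
    [vsum_ext_nat] holds by conversion. *)
Definition ext_nat (d : nat) (g : Idx d -> R) (k : nat) : R :=
  match Nat.ltb k d as b return (Nat.ltb k d = b -> R) with
  | true => fun h => g (exist _ k h)
  | false => fun _ => 0 end eq_refl.

Lemma ext_nat_idx (d : nat) (g : Idx d -> R) (k : nat) (H : Nat.ltb k d = true) :
  ext_nat g k = g (exist _ k H).
Proof.
  unfold ext_nat.
  generalize (eq_refl (Nat.ltb k d)).
  (* Generalising the scrutinee together with the right side of its equation lets the dependent
     match reduce. *)
  generalize (Nat.ltb k d) at 2 3; intros b; destruct b; intros e.
  - f_equal; now apply idx_eq.
  - congruence.
Qed.

Lemma vsum_ext_nat (d : nat) (g : Idx d -> R) : vsum g = nsum d (ext_nat g).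
Proof. reflexivity. Qed.

Lemma ltb_of_lt k d : (k < d)%nat -> Nat.ltb k d = true.
Proof. apply PeanoNat.Nat.ltb_lt. Qed.

Lemma vsum_ext (d : nat) (g h : Idx d -> R) : (forall j, g j = h j) -> vsum g = vsum h.
Proof. intros H; f_equal; now apply functional_extensionality. Qed.

Lemma vsum_lin (d : nat) (a b : R) (g h : Idx d -> R) :
  vsum (fun j => a * g j + b * h j) = a * vsum g + b * vsum h.
Proof.
  rewrite !vsum_ext_nat, <- nsum_lin; apply nsum_ext; intros k Hk.
  now rewrite !(ext_nat_idx _ _ (ltb_of_lt Hk)).
Qed.

Lemma vsum_le (d : nat) (g h : Idx d -> R) : (forall j, g j <= h j) -> vsum g <= vsum h.
Proof.
  intros H; rewrite !vsum_ext_nat; apply nsum_le; intros k Hk.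
  rewrite !(ext_nat_idx _ _ (ltb_of_lt Hk)); apply H.
Qed.

Lemma vsum_single (d : nat) (g : Idx d -> R) (i : Idx d) :
  (forall j, j <> i -> g j = 0) -> vsum g = g i.
Proof.
  intros H; rewrite vsum_ext_nat; destruct i as [i Hi].
  rewrite (@nsum_single d _ i).
  - now rewrite (ext_nat_idx _ _ Hi).
  - now apply PeanoNat.Nat.ltb_lt.
  - intros j Hj Hne; rewrite (ext_nat_idx _ _ (ltb_of_lt Hj)); apply H.
    intros E; apply Hne; now inversion E.
Qed.

Lemma vsum_plus (d : nat) (g h : Idx d -> R) :
  vsum (fun j => g j + h j) = vsum g + vsum h.
Proof.
  rewrite <- (Rmult_1_l (vsum g)), <- (Rmult_1_l (vsum h)), <- vsum_lin.
  apply vsum_ext; intros; ring.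
Qed.

Lemma vsum_scal (d : nat) (a : R) (g : Idx d -> R) : vsum (fun j => a * g j) = a * vsum g.
Proof.
  transitivity (a * vsum g + 0 * vsum g); [|ring].
  rewrite <- vsum_lin; apply vsum_ext; intros; ring.
Qed.

Lemma vsum_0 (d : nat) : vsum (fun _ : Idx d => 0) = 0.
Proof.
  rewrite (@vsum_ext d _ (fun j : Idx d => 0 * 0)) by (intros; ring).
  rewrite vsum_scal; ring.
Qed.

Lemma vsum_one (d : nat) : vsum (fun _ : Idx d => 1) = INR d.
Proof.
  rewrite vsum_ext_nat.
  rewrite (nsum_ext (n:=d) _ (fun _ => 1)).
  - induction d as [|d IH]; simpl nsum; [reflexivity|]. rewrite IH, S_INR; ring.
  - intros k Hk; now rewrite (ext_nat_idx _ _ (ltb_of_lt Hk)).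
Qed.

Lemma vsum_unitv (d : nat) (u : Vec d) (i : Idx d) : vsum (fun j => u j * unitv j i) = u i.
Proof.
  rewrite (@vsum_single d _ i).
  - rewrite unitv_same; ring.
  - intros j Hj; rewrite unitv_other by congruence; ring.
Qed.

Lemma nsum_abs n (g : nat -> R) : Rabs (nsum n g) <= nsum n (fun k => Rabs (g k)).
Proof.
  induction n as [|n IH]; simpl; [rewrite Rabs_R0; lra|].
  eapply Rle_trans; [apply Rabs_triang|lra].
Qed.

Lemma vsum_abs (d : nat) (g : Idx d -> R) : Rabs (vsum g) <= vsum (fun j => Rabs (g j)).
Proof.
  rewrite !vsum_ext_nat; eapply Rle_trans; [apply nsum_abs|].
  right; apply nsum_ext; intros k Hk; now rewrite !(ext_nat_idx _ _ (ltb_of_lt Hk)).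
Qed.

Lemma vsum_swap (d : nat) (g : Idx d -> Idx d -> R) :
  vsum (fun i => vsum (fun j => g i j)) = vsum (fun j => vsum (fun i => g i j)).
Proof.
  assert (K : forall n (h : nat -> Idx d -> R),
    nsum n (fun i => vsum (h i)) = vsum (fun j => nsum n (fun i => h i j))).
  { induction n as [|n IH]; simpl; intros h; [symmetry; apply vsum_0|].
    now rewrite IH, vsum_plus. }
  rewrite vsum_ext_nat.
  rewrite (nsum_ext (n:=d) _ (fun i => vsum (fun j => ext_nat (fun i => g i j) i))).
  - rewrite K; reflexivity.
  - intros k Hk; rewrite (ext_nat_idx _ _ (ltb_of_lt Hk)).
    apply vsum_ext; intros j; now rewrite (ext_nat_idx _ _ (ltb_of_lt Hk)).
Qed.

Lemma idx_list (d : nat) : exists l : list (Idx d), forall i, In i l.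
Proof.
  assert (K : forall n, exists l : list (Idx d), forall i, (proj1_sig i < n)%nat -> In i l).
  { induction n as [|n [l Hl]]; [exists nil; intros; lia|].
    destruct (Compare_dec.lt_dec n d) as [Hn|Hn].
    - exists (exist _ n (ltb_of_lt Hn) :: l); intros i Hi.
      destruct (PeanoNat.Nat.eq_dec (proj1_sig i) n) as [E|E].
      + left; now apply idx_eq.
      + right; apply Hl; lia.
    - exists l; intros i Hi; apply Hl. destruct i as [i H']; simpl in *.
      apply PeanoNat.Nat.ltb_lt in H'; lia. }
  destruct (K d) as [l Hl]; exists l; intros i; apply Hl.
  destruct i as [i H']; simpl; now apply PeanoNat.Nat.ltb_lt.
Qed.

(** Finitely many thresholds have a positive minimum. Common upper bounds come from the same lemma
    by writing a bound as [/ x], which decreases in [x]. *)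
Lemma idx_common_delta (d : nat) (Pr : R -> Idx d -> Prop) :
  (forall i x y, 0 < x <= y -> Pr y i -> Pr x i) ->
  (forall i, exists x, 0 < x /\ Pr x i) -> exists x, 0 < x /\ forall i, Pr x i.
Proof.
  intros Hm He; destruct (idx_list d) as [l Hl].
  assert (K : exists x, 0 < x /\ forall i, In i l -> Pr x i).
  { clear Hl; induction l as [|i l [x [Hx IH]]]; [exists 1; split; [lra|intros ? []]|].
    destruct (He i) as [y [Hy Hi]]. exists (Rmin x y); split; [now apply Rmin_pos|].
    assert (0 < Rmin x y) by now apply Rmin_pos.
    intros j [<-|Hj].
    - apply (Hm i _ y); [split; [auto|apply Rmin_r]|auto].
    - apply (Hm j _ x); [split; [auto|apply Rmin_l]|auto]. }
  destruct K as [x [Hx K]]; exists x; auto.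
Qed.

Lemma idx_bounded (d : nat) (u : Vec d) : exists r, 0 < r /\ forall i, Rabs (u i) <= r.
Proof.
  destruct (@idx_common_delta d (fun x i => Rabs (u i) <= / x)) as [x [Hx H]].
  - intros i x y Hxy H; eapply Rle_trans; [exact H|]; apply Rinv_le_contravar; lra.
  - intros i; exists (/ (Rabs (u i) + 1)).
    pose proof (Rabs_pos (u i)). split; [apply Rinv_0_lt_compat; lra|].
    rewrite Rinv_inv; lra.
  - exists (/ x); split; [now apply Rinv_0_lt_compat|auto].
Qed.

Lemma Rabs_le_inv x a : Rabs x <= a -> - a <= x <= a.
Proof. unfold Rabs; destruct (Rcase_abs x); lra. Qed.

(** * Subgradients of convex functions *)

Lemma glb_exists (E : R -> Prop) (b : R) : (exists x, E x) -> (forall x, E x -> b <= x) ->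
  exists m, (forall x, E x -> m <= x) /\ (forall c, (forall x, E x -> c <= x) -> c <= m).
Proof.
  intros [x0 H0] Hb.
  destruct (completeness (fun y => E (- y))) as [s [Hs1 Hs2]].
  - exists (- b); intros y Hy; specialize (Hb _ Hy); lra.
  - exists (- x0); now rewrite Ropp_involutive.
  - exists (- s); split.
    + intros x Hx; assert (- x <= s); [|lra].
      apply Hs1; now rewrite Ropp_involutive.
    + intros c Hc. assert (s <= - c); [|lra].
      apply Hs2; intros y Hy; specialize (Hc _ Hy); lra.
Qed.

Definition inf_of (E : R -> Prop) : R :=
  epsilon (inhabits 0) (fun m => (forall x, E x -> m <= x) /\
    (forall c, (forall x, E x -> c <= x) -> c <= m)).

Lemma inf_of_spec (E : R -> Prop) (b : R) : (exists x, E x) -> (forall x, E x -> b <= x) ->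
  (forall x, E x -> inf_of E <= x) /\ (forall c, (forall x, E x -> c <= x) -> c <= inf_of E).
Proof.
  intros H1 H2; unfold inf_of; apply epsilon_spec; now apply glb_exists with b.
Qed.

(** One operation covers the linear structure: [fcomb a x 0 x] is scaling and [fcomb 1 x 1 y] is
    addition, so a subspace needs a single closure condition. *)
Definition fcomb {A : Type} (a : R) (x : A -> R) (b : R) (y : A -> R) : A -> R :=
  fun w => a * x w + b * y w.

Definition subspace {A : Type} (D : (A -> R) -> Prop) : Prop :=
  (exists x, D x) /\ forall a b x y, D x -> D y -> D (fcomb a x b y).

Definition sublinear_on {A : Type} (D : (A -> R) -> Prop) (p : (A -> R) -> R) : Prop :=
  (forall x y, D x -> D y -> p (fcomb 1 x 1 y) <= p x + p y) /\
  (forall a x, 0 < a -> D x -> p (fcomb a x 0 x) = a * p x).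

Definition linear_on {A : Type} (D : (A -> R) -> Prop) (l : (A -> R) -> R) : Prop :=
  forall a b x y, D x -> D y -> l (fcomb a x b y) = a * l x + b * l y.

Definition convex_on {A : Type} (D : (A -> R) -> Prop) (g : (A -> R) -> R) : Prop :=
  forall x y l, D x -> D y -> 0 <= l <= 1 ->
    g (fcomb l x (1 - l) y) <= l * g x + (1 - l) * g y.

Ltac fcomb_eq := apply functional_extensionality; intros ?; unfold fcomb; try field; try lra.

(** * Hahn-Banach on subspaces of function spaces, by minimal sublinear functionals *)

Section HahnBanach.
Variables (A : Type) (D : (A -> R) -> Prop).
Hypothesis HD : subspace D.

Lemma subspace_comb a b x y : D x -> D y -> D (fcomb a x b y).
Proof. apply HD. Qed.

Lemma sublinear_zero p x : sublinear_on D p -> D x -> p (fcomb 0 x 0 x) = 0.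
Proof.
  intros [_ H] Hx.
  assert (Dz : D (fcomb 0 x 0 x)) by now apply subspace_comb.
  pose proof (H 2 _ ltac:(lra) Dz) as E.
  replace (fcomb 2 (fcomb 0 x 0 x) 0 (fcomb 0 x 0 x)) with (fcomb 0 x 0 x) in E by fcomb_eq.
  lra.
Qed.

Lemma sublinear_lower p x : sublinear_on D p -> D x -> - p (fcomb (-1) x 0 x) <= p x.
Proof.
  intros Hp Hx.
  pose proof (proj1 Hp (fcomb (-1) x 0 x) x (subspace_comb _ _ Hx Hx) Hx) as H.
  replace (fcomb 1 (fcomb (-1) x 0 x) 1 x) with (fcomb 0 x 0 x) in H by fcomb_eq.
  rewrite (sublinear_zero Hp Hx) in H; lra.
Qed.

(** Zorn's lemma for the reversed pointwise order, only a preorder because functionals may differ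
    off [D]. A nonempty chain is bounded by its pointwise infimum, finite by [sublinear_lower]. *)
Lemma minimal_sublinear p : sublinear_on D p ->
  exists m, sublinear_on D m /\ (forall x, D x -> m x <= p x) /\
    forall m', sublinear_on D m' -> (forall x, D x -> m' x <= m x) ->
      forall x, D x -> m x <= m' x.
Proof.
  intros Hp.
  pose (T := {m : (A -> R) -> R | sublinear_on D m /\ forall x, D x -> m x <= p x}).
  pose (le := fun m m' : T => boolp.asbool (forall x, D x -> proj1_sig m' x <= proj1_sig m x)).
  assert (leP : forall m m', le m m' = true <-> (forall x, D x -> proj1_sig m' x <= proj1_sig m x)).
  { intros m m'; unfold le; pose proof (boolp.asboolP (forall x, D x -> proj1_sig m' x <= proj1_sig m x)) as H.
    destruct H; split; intros; auto; congruence. }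
  destruct (@classical_sets.ZL_preorder T
    (exist _ p (conj Hp (fun x _ => Rle_refl (p x)))) le) as [[m [Hm1 Hm2]] Hmax].
  - intros m; apply leP; intros; lra.
  - intros m1 m2 m3 H1 H2; apply leP; intros x Hx.
    pose proof (proj1 (leP _ _) H1 x Hx); pose proof (proj1 (leP _ _) H2 x Hx); lra.
  - intros C HC.
    destruct (classic (exists m, C m)) as [[m0 Hm0]|HN].
    2:{ exists (exist _ p (conj Hp (fun x _ => Rle_refl (p x)))).
        intros s Hs; exfalso; apply HN; now exists s. }
    pose (E := fun x y => exists m, C m /\ y = proj1_sig m x).
    assert (HE : forall x, D x -> (forall y, E x y -> inf_of (E x) <= y) /\
      (forall c, (forall y, E x y -> c <= y) -> c <= inf_of (E x))).
    { intros x Hx; apply inf_of_spec with (- p (fcomb (-1) x 0 x)).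
      - exists (proj1_sig m0 x), m0; auto.
      - intros y [[m [Hm Hmp]] [_ ->]]; simpl.
        pose proof (sublinear_lower Hm Hx).
        pose proof (Hmp _ (subspace_comb (-1) 0 Hx Hx)); lra. }
    assert (Hq : sublinear_on D (fun x => inf_of (E x)) /\
                 forall x, D x -> inf_of (E x) <= p x).
    { split; [split|].
      - intros x y Hx Hy.
        assert (Hxy := subspace_comb 1 1 Hx Hy).
        assert (forall u v, E x u -> E y v -> inf_of (E (fcomb 1 x 1 y)) <= u + v) as K.
        { intros u v [m1 [C1 ->]] [m2 [C2 ->]].
          (* Two members of a chain are comparable, so the smaller one serves for [x] and [y] at
             once. *)
          assert (exists m, C m /\ proj1_sig m x <= proj1_sig m1 x /\ proj1_sig m y <= proj1_sig m2 y)
            as [m [Cm [K1 K2]]].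
          { destruct (HC m1 m2 C1 C2) as [H|H]; pose proof (proj1 (leP _ _) H) as H'.
            - exists m2; repeat split; auto; lra.
            - exists m1; repeat split; auto; lra. }
          apply Rle_trans with (proj1_sig m (fcomb 1 x 1 y)).
          - apply (HE _ Hxy); exists m; auto.
          - pose proof (proj1 (proj1 (proj2_sig m)) x y Hx Hy); lra. }
        assert (inf_of (E (fcomb 1 x 1 y)) - inf_of (E y) <= inf_of (E x)); [|lra].
        apply (HE _ Hx); intros u Hu.
        assert (inf_of (E (fcomb 1 x 1 y)) - u <= inf_of (E y)); [|lra].
        apply (HE _ Hy); intros v Hv. specialize (K u v Hu Hv); lra.
      - intros a x Ha Hx.
        assert (Hax := subspace_comb a 0 Hx Hx).
        assert (Ea : forall m, C m -> proj1_sig m (fcomb a x 0 x) = a * proj1_sig m x).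
        { intros m _; apply (proj2 (proj1 (proj2_sig m))); auto. }
        apply Rle_antisym.
        + assert (inf_of (E (fcomb a x 0 x)) / a <= inf_of (E x)) as K.
          { apply (HE _ Hx); intros u [m [Cm ->]].
            apply Rmult_le_reg_l with a; [auto|].
            replace (a * (inf_of (E (fcomb a x 0 x)) / a)) with (inf_of (E (fcomb a x 0 x))) by (field; lra).
            rewrite <- Ea by auto. apply (HE _ Hax); exists m; auto. }
          apply Rmult_le_compat_l with (r := a) in K; [|lra].
          replace (a * (inf_of (E (fcomb a x 0 x)) / a)) with (inf_of (E (fcomb a x 0 x))) in K by (field; lra).
          lra.
        + apply (HE _ Hax); intros u [m [Cm ->]]; rewrite Ea by auto.
          apply Rmult_le_compat_l; [lra|]. apply (HE _ Hx); exists m; auto.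
      - intros x Hx; apply Rle_trans with (proj1_sig m0 x).
        + apply (HE _ Hx); exists m0; auto.
        + apply (proj2 (proj2_sig m0)); auto. }
    exists (exist _ (fun x => inf_of (E x)) Hq).
    intros s Hs; apply leP; simpl; intros x Hx; apply (HE _ Hx); exists s; auto.
  - exists m; split; [auto|split; [auto|]]; intros m' Hm' Hle x Hx.
    assert (Hm'p : forall x, D x -> m' x <= p x).
    { intros y Hy; eapply Rle_trans; [apply Hle|apply Hm2]; auto. }
    specialize (Hmax (exist _ m' (conj Hm' Hm'p))).
    apply (proj1 (leP (exist _ m' (conj Hm' Hm'p)) (exist _ m (conj Hm1 Hm2)))); [|auto].
    apply Hmax, leP; simpl; auto.
Qed.

(** For fixed [y], [x |-> inf_(t >= 0) (m (x + t y) - t m y)] is sublinear and below [m], so a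
    minimal sublinear [m] equals it; taking [t = 1] shows that [m] is superadditive. *)
Lemma minimal_sublinear_superadditive m : sublinear_on D m ->
  (forall m', sublinear_on D m' -> (forall x, D x -> m' x <= m x) ->
      forall x, D x -> m x <= m' x) ->
  forall x y, D x -> D y -> m x + m y <= m (fcomb 1 x 1 y).
Proof.
  intros Hm Hmin x0 y Hx0 Hy.
  pose (E := fun x r => exists t, 0 <= t /\ r = m (fcomb 1 x t y) - t * m y).
  assert (Hmt : forall t, 0 <= t -> m (fcomb t y 0 y) = t * m y).
  { intros t [Ht|<-]; [now apply Hm|]. rewrite sublinear_zero; auto; ring. }
  assert (HE : forall x, D x -> (forall r, E x r -> inf_of (E x) <= r) /\
      (forall c, (forall r, E x r -> c <= r) -> c <= inf_of (E x))).
  (* The lower bound comes from [t m y = m (t y) <= m (x + t y) + m (- x)]. *)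
  { intros x Hx; apply inf_of_spec with (- m (fcomb (-1) x 0 x)).
    - exists (m (fcomb 1 x 0 y) - 0 * m y), 0; split; [lra|reflexivity].
    - intros r [t [Ht ->]].
      pose proof (proj1 Hm (fcomb 1 x t y) (fcomb (-1) x 0 x)
        (subspace_comb _ _ Hx Hy) (subspace_comb _ _ Hx Hx)) as H.
      replace (fcomb 1 (fcomb 1 x t y) 1 (fcomb (-1) x 0 x)) with (fcomb t y 0 y) in H by fcomb_eq.
      rewrite Hmt in H by auto. lra. }
  assert (Hsub : sublinear_on D (fun x => inf_of (E x))).
  { split.
    - intros x z Hx Hz.
      assert (Hxz := subspace_comb 1 1 Hx Hz).
      assert (inf_of (E (fcomb 1 x 1 z)) - inf_of (E z) <= inf_of (E x)); [|lra].
      apply (HE _ Hx); intros u [t [Ht ->]].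
      assert (inf_of (E (fcomb 1 x 1 z)) - (m (fcomb 1 x t y) - t * m y) <= inf_of (E z)); [|lra].
      apply (HE _ Hz); intros v [s [Hs ->]].
      assert (inf_of (E (fcomb 1 x 1 z)) <= m (fcomb 1 (fcomb 1 x 1 z) (t + s) y) - (t + s) * m y) as K.
      { apply (HE _ Hxz); exists (t + s); split; [lra|reflexivity]. }
      pose proof (proj1 Hm (fcomb 1 x t y) (fcomb 1 z s y)
        (subspace_comb _ _ Hx Hy) (subspace_comb _ _ Hz Hy)) as H.
      replace (fcomb 1 (fcomb 1 x t y) 1 (fcomb 1 z s y))
        with (fcomb 1 (fcomb 1 x 1 z) (t + s) y) in H by fcomb_eq.
      lra.
    - intros a x Ha Hx.
      assert (Hax := subspace_comb a 0 Hx Hx).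
      assert (Ea : forall t, m (fcomb 1 (fcomb a x 0 x) (a * t) y) = a * m (fcomb 1 x t y)).
      { intros t. rewrite <- (proj2 Hm a (fcomb 1 x t y)); [|auto|now apply subspace_comb].
        f_equal; fcomb_eq. }
      apply Rle_antisym.
      + assert (inf_of (E (fcomb a x 0 x)) / a <= inf_of (E x)) as K.
        { apply (HE _ Hx); intros u [t [Ht ->]].
          apply Rmult_le_reg_l with a; [auto|].
          replace (a * (inf_of (E (fcomb a x 0 x)) / a)) with (inf_of (E (fcomb a x 0 x))) by (field; lra).
          replace (a * (m (fcomb 1 x t y) - t * m y)) with
            (m (fcomb 1 (fcomb a x 0 x) (a * t) y) - (a * t) * m y) by (rewrite Ea; ring).
          apply (HE _ Hax); exists (a * t); split; [nra|reflexivity]. }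
        apply Rmult_le_compat_l with (r := a) in K; [|lra].
        replace (a * (inf_of (E (fcomb a x 0 x)) / a)) with (inf_of (E (fcomb a x 0 x))) in K by (field; lra).
        lra.
      + apply (HE _ Hax); intros u [t [Ht ->]].
        replace t with (a * (t / a)) by (field; lra). rewrite Ea.
        assert (inf_of (E x) <= m (fcomb 1 x (t / a) y) - (t / a) * m y) as K.
        { apply (HE _ Hx); exists (t / a); split; [|reflexivity].
          apply Rmult_le_pos; [auto|left; now apply Rinv_0_lt_compat]. }
        apply Rmult_le_compat_l with (r := a) in K; lra. }
  assert (K : m x0 <= inf_of (E x0)).
  { apply (Hmin (fun x => inf_of (E x)) Hsub); [|auto].
    intros x Hx; apply (HE _ Hx); exists 0; split; [lra|].
    replace (fcomb 1 x 0 y) with x by fcomb_eq; ring. }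
  assert (inf_of (E x0) <= m (fcomb 1 x0 1 y) - 1 * m y); [|lra].
  apply (HE _ Hx0); exists 1; split; [lra|reflexivity].
Qed.

(** A minimal sublinear functional below [p] is superadditive, hence additive; additivity makes it
    odd, and oddness extends positive homogeneity to all scalars. *)
Lemma hahn_banach p : sublinear_on D p ->
  exists l, linear_on D l /\ forall x, D x -> l x <= p x.
Proof.
  intros Hp; destruct (minimal_sublinear Hp) as [m [Hm [Hmp Hmin]]].
  exists m; split; [|auto].
  assert (Hadd : forall x y, D x -> D y -> m (fcomb 1 x 1 y) = m x + m y).
  { intros x y Hx Hy; apply Rle_antisym; [now apply Hm|].
    now apply minimal_sublinear_superadditive. }
  assert (Hneg : forall x, D x -> m (fcomb (-1) x 0 x) = - m x).
  { intros x Hx; pose proof (Hadd _ _ Hx (subspace_comb (-1) 0 Hx Hx)) as H.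
    replace (fcomb 1 x 1 (fcomb (-1) x 0 x)) with (fcomb 0 x 0 x) in H by fcomb_eq.
    rewrite (sublinear_zero Hm Hx) in H; lra. }
  assert (Hscal : forall a x, D x -> m (fcomb a x 0 x) = a * m x).
  { intros a x Hx; destruct (Rtotal_order a 0) as [Ha|[->|Ha]].
    - replace (fcomb a x 0 x) with (fcomb (-1) (fcomb (- a) x 0 x) 0 (fcomb (- a) x 0 x)) by fcomb_eq.
      rewrite Hneg by now apply subspace_comb. rewrite (proj2 Hm) by (auto; lra). ring.
    - rewrite sublinear_zero by auto; ring.
    - apply Hm; auto. }
  intros a b x y Hx Hy.
  rewrite <- (Hscal a x Hx), <- (Hscal b y Hy), <- Hadd by now apply subspace_comb.
  f_equal; fcomb_eq.
Qed.

(** Hahn-Banach applied to the directional derivative [inf_(t > 0) (g (x0 + t y) - g x0) / t]. *)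
Lemma convex_subgradient g x0 : convex_on D g -> D x0 ->
  exists l, linear_on D l /\ forall y, D y -> l y - l x0 <= g y - g x0.
Proof.
  intros Hg Hx0.
  pose (E := fun y r => exists t, 0 < t /\ r = (g (fcomb 1 x0 t y) - g x0) / t).
  assert (HE : forall x, D x -> (forall r, E x r -> inf_of (E x) <= r) /\
      (forall c, (forall r, E x r -> c <= r) -> c <= inf_of (E x))).
  { intros y Hy; apply inf_of_spec with (- (g (fcomb 1 x0 (-1) y) - g x0)).
    - exists ((g (fcomb 1 x0 1 y) - g x0) / 1), 1; split; [lra|reflexivity].
    - intros r [t [Ht ->]].
      (* [x0] is the combination of [x0 + t y] and [x0 - y] with weights [1 / (1 + t)] and
         [t / (1 + t)], so no forward quotient falls below the backward one. *)
      pose proof (Hg (fcomb 1 x0 t y) (fcomb 1 x0 (-1) y) (/ (1 + t))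
        (subspace_comb _ _ Hx0 Hy) (subspace_comb _ _ Hx0 Hy)) as H.
      replace (fcomb (/ (1 + t)) (fcomb 1 x0 t y) (1 - / (1 + t)) (fcomb 1 x0 (-1) y))
        with x0 in H by (fcomb_eq; lra).
      assert (0 < / (1 + t) <= 1) as Hinv.
      { split; [apply Rinv_0_lt_compat; lra|].
        rewrite <- Rinv_1; apply Rinv_le_contravar; lra. }
      specialize (H ltac:(lra)).
      apply Rmult_le_compat_l with (r := 1 + t) in H; [|lra].
      replace ((1 + t) * (/ (1 + t) * g (fcomb 1 x0 t y) + (1 - / (1 + t)) * g (fcomb 1 x0 (-1) y)))
        with (g (fcomb 1 x0 t y) + t * g (fcomb 1 x0 (-1) y)) in H by (field; lra).
      apply Rmult_le_reg_l with t; [auto|].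
      replace (t * ((g (fcomb 1 x0 t y) - g x0) / t)) with (g (fcomb 1 x0 t y) - g x0) by (field; lra).
      lra. }
  assert (Hsub : sublinear_on D (fun x => inf_of (E x))).
  { split.
    - intros x z Hx Hz.
      assert (Hxz := subspace_comb 1 1 Hx Hz).
      assert (inf_of (E (fcomb 1 x 1 z)) - inf_of (E z) <= inf_of (E x)); [|lra].
      apply (HE _ Hx); intros u [t [Ht ->]].
      assert (inf_of (E (fcomb 1 x 1 z)) - (g (fcomb 1 x0 t x) - g x0) / t <= inf_of (E z)); [|lra].
      apply (HE _ Hz); intros v [s [Hs ->]].
      assert (Hts : 0 < t * s) by nra.
      assert (Hi : 0 < / (t + s)) by (apply Rinv_0_lt_compat; lra).
      (* With step [t s / (t + s)] along [x + z] the point lies on the segment from [x0 + t x] to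
         [x0 + s z]; convexity there is subadditivity of the quotients. *)
      assert (inf_of (E (fcomb 1 x 1 z)) <=
        (g (fcomb 1 x0 (t * s / (t + s)) (fcomb 1 x 1 z)) - g x0) / (t * s / (t + s))) as K.
      { apply (HE _ Hxz); exists (t * s / (t + s)); split; [|reflexivity].
        apply Rmult_lt_0_compat; auto. }
      pose proof (Hg (fcomb 1 x0 t x) (fcomb 1 x0 s z) (s / (t + s))
        (subspace_comb _ _ Hx0 Hx) (subspace_comb _ _ Hx0 Hz)) as H.
      replace (fcomb (s / (t + s)) (fcomb 1 x0 t x) (1 - s / (t + s)) (fcomb 1 x0 s z))
        with (fcomb 1 x0 (t * s / (t + s)) (fcomb 1 x 1 z)) in H by (fcomb_eq; lra).
      assert (0 <= s / (t + s) <= 1) as Hl.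
      { split; [unfold Rdiv; nra|]. apply Rmult_le_reg_r with (t + s); [lra|].
        unfold Rdiv; rewrite Rmult_assoc, Rinv_l by lra; lra. }
      specialize (H Hl).
      assert ((g (fcomb 1 x0 (t * s / (t + s)) (fcomb 1 x 1 z)) - g x0) / (t * s / (t + s)) <=
        (g (fcomb 1 x0 t x) - g x0) / t + (g (fcomb 1 x0 s z) - g x0) / s); [|lra].
      apply Rmult_le_reg_l with (t * s / (t + s)); [apply Rmult_lt_0_compat; auto|].
      replace (t * s / (t + s) * ((g (fcomb 1 x0 (t * s / (t + s)) (fcomb 1 x 1 z)) - g x0) / (t * s / (t + s))))
        with (g (fcomb 1 x0 (t * s / (t + s)) (fcomb 1 x 1 z)) - g x0) by (field; lra).
      replace (t * s / (t + s) * ((g (fcomb 1 x0 t x) - g x0) / t + (g (fcomb 1 x0 s z) - g x0) / s))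
        with ((s / (t + s) * g (fcomb 1 x0 t x) + (1 - s / (t + s)) * g (fcomb 1 x0 s z)) - g x0)
        by (field; lra).
      lra.
    - intros a x Ha Hx.
      assert (Hax := subspace_comb a 0 Hx Hx).
      assert (Ea : forall t, fcomb 1 x0 t (fcomb a x 0 x) = fcomb 1 x0 (a * t) x).
      { intros t; fcomb_eq. }
      apply Rle_antisym.
      + assert (inf_of (E (fcomb a x 0 x)) / a <= inf_of (E x)) as K.
        { apply (HE _ Hx); intros u [t [Ht ->]].
          apply Rmult_le_reg_l with a; [auto|].
          replace (a * (inf_of (E (fcomb a x 0 x)) / a)) with (inf_of (E (fcomb a x 0 x))) by (field; lra).
          replace (a * ((g (fcomb 1 x0 t x) - g x0) / t)) with
            ((g (fcomb 1 x0 (t / a) (fcomb a x 0 x)) - g x0) / (t / a)).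
          - apply (HE _ Hax); exists (t / a); split; [|reflexivity].
            apply Rmult_lt_0_compat; [auto|now apply Rinv_0_lt_compat].
          - rewrite Ea. replace (a * (t / a)) with t by (field; lra). field; lra. }
        apply Rmult_le_compat_l with (r := a) in K; [|lra].
        replace (a * (inf_of (E (fcomb a x 0 x)) / a)) with (inf_of (E (fcomb a x 0 x))) in K by (field; lra).
        lra.
      + apply (HE _ Hax); intros u [t [Ht ->]]. rewrite Ea.
        assert (inf_of (E x) <= (g (fcomb 1 x0 (a * t) x) - g x0) / (a * t)) as K.
        { apply (HE _ Hx); exists (a * t); split; [nra|reflexivity]. }
        apply Rmult_le_compat_l with (r := a) in K; [|lra].
        replace (a * ((g (fcomb 1 x0 (a * t) x) - g x0) / (a * t))) with
          ((g (fcomb 1 x0 (a * t) x) - g x0) / t) in K by (field; lra).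
        lra. }
  destruct (hahn_banach Hsub) as [l [Hl Hlp]].
  exists l; split; [auto|]. intros y Hy.
  assert (Hyx := subspace_comb 1 (-1) Hy Hx0).
  pose proof (Hlp _ Hyx) as H. rewrite Hl in H by auto.
  assert (inf_of (E (fcomb 1 y (-1) x0)) <= (g (fcomb 1 x0 1 (fcomb 1 y (-1) x0)) - g x0) / 1) as K.
  { apply (HE _ Hyx); exists 1; split; [lra|reflexivity]. }
  replace (fcomb 1 x0 1 (fcomb 1 y (-1) x0)) with y in K by fcomb_eq.
  lra.
Qed.

End HahnBanach.

(** * Convex Q-operators *)

Definition dispersive {d : nat} (F : Vec d -> Vec d) : Prop :=
  forall (u v : Vec d) i, (forall j, u j - v j <= u i - v i) -> F u i <= F v i.

Definition in_ball {d : nat} (r : R) (u : Vec d) : Prop := forall i, Rabs (u i) <= r.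

Lemma mv_lin d (q : Mat d) a b (u v : Vec d) i :
  mv q (fun j => a * u j + b * v j) i = a * mv q u i + b * mv q v i.
Proof.
  unfold mv; rewrite <- vsum_lin; apply vsum_ext; intros; ring.
Qed.

Lemma mv_sub d (q : Mat d) (u v : Vec d) i :
  mv q (fun j => u j - v j) i = mv q u i - mv q v i.
Proof.
  transitivity (1 * mv q u i + (-1) * mv q v i); [|ring].
  rewrite <- mv_lin; apply vsum_ext; intros; ring.
Qed.

Lemma mv_const d (q : Mat d) a i : Qmatrix q -> mv q (fun _ => a) i = 0.
Proof.
  intros [_ [_ H]]; unfold mv.
  rewrite (@vsum_ext d _ (fun j => a * q i j)) by (intros; ring).
  rewrite vsum_scal, H; ring.
Qed.

Lemma Qmatrix_max_principle d (q : Mat d) (u : Vec d) i : Qmatrix q ->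
  (forall j, u j <= u i) -> mv q u i <= 0.
Proof.
  intros Hq Hu; rewrite <- (mv_const (u i) i Hq).
  apply vsum_le; intros j.
  destruct (idx_eq_dec j i) as [->|Hj]; [lra|].
  apply Rmult_le_compat_l; [apply Hq; congruence|auto].
Qed.

Lemma Qmatrix_affine_dispersive d (q : Mat d) (c : Vec d) : Qmatrix q ->
  dispersive (fun u i => mv q u i + c i).
Proof.
  intros Hq u v i H.
  pose proof (Qmatrix_max_principle (fun j => u j - v j) i Hq H) as K.
  rewrite mv_sub in K; lra.
Qed.

Lemma sup_representation_dispersive d (Q : Vec d -> Vec d) P f :
  sup_representation Q P f -> dispersive Q.
Proof.
  intros [HP [_ HQ]] u v i H.
  apply (HQ u i); intros y [q [Pq ->]].
  eapply Rle_trans; [apply (Qmatrix_affine_dispersive (f q) (HP q Pq)); exact H|].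
  apply (HQ v i); exists q; auto.
Qed.

Lemma sup_representation_cond_ii d (Q : Vec d -> Vec d) P f :
  sup_representation Q P f -> cond_ii Q.
Proof.
  intros [HP [[q0 [Pq0 [Hq0 Hf]]] HQ]].
  assert (Hf0 : forall q, P q -> forall i, f q i <= 0).
  { intros q Pq i; rewrite <- (Hq0 i); auto. }
  repeat split.
  - intros u v l Hl i. apply HQ; intros y [q [Pq ->]].
    rewrite mv_lin.
    assert (mv q u i + f q i <= Q u i) by (apply HQ; exists q; auto).
    assert (mv q v i + f q i <= Q v i) by (apply HQ; exists q; auto).
    nra.
  - intros u i Hu. apply HQ; intros y [q [Pq ->]].
    pose proof (Qmatrix_max_principle u i (HP q Pq) Hu).
    pose proof (Hf0 q Pq i); lra.
  - intros a i; apply Rle_antisym.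
    + apply HQ; intros y [q [Pq ->]]. unfold cst; rewrite mv_const by auto.
      pose proof (Hf0 q Pq i); lra.
    + apply HQ; exists q0; split; [auto|].
      unfold cst; rewrite mv_const by auto; rewrite Hq0; ring.
Qed.

(** Passes from the coordinate axes to all nonpositive vectors vanishing at [i]: [w] is the midpoint
    of [2 w_k e_k], covered by axiom (b), and of twice the rest of [w], which has smaller
    support. *)
Lemma Qoperator_negative_part d (Q : Vec d -> Vec d) i :
  convex_map Q -> Qoperator Q -> forall (l : list (Idx d)) (w : Vec d),
  (forall j, w j <= 0) -> w i = 0 -> (forall j, w j <> 0 -> In j l) -> Q w i <= 0.
Proof.
  intros HQ [_ [Hb Hc]]; induction l as [|k l IH]; intros w Hw Hi Hl.
  - replace w with (@cst d 0); [now rewrite Hc; lra|].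
    apply functional_extensionality; intros j; unfold cst.
    destruct (Req_dec (w j) 0) as [E|E]; [auto|]. destruct (Hl j E).
  - destruct (Req_dec (w k) 0) as [E|E].
    { apply IH; auto. intros j Hj; destruct (Hl j Hj) as [->|]; [contradiction|auto]. }
    pose (w1 := vscale (- (2 * - w k)) (unitv k) : Vec d).
    pose (w2 := fun j => if idx_eqb j k then 0 else 2 * w j).
    assert (Hwk : w k < 0) by (specialize (Hw k); lra).
    assert (Hki : i <> k) by congruence.
    replace w with (fun j => 1 / 2 * w1 j + (1 - 1 / 2) * w2 j).
    2:{ apply functional_extensionality; intros j; unfold w1, w2, vscale, unitv.
        destruct (idx_eqb j k) eqn:Ej; [|lra].
        apply idx_eqb_spec in Ej; subst; lra. }
    eapply Rle_trans; [apply HQ; lra|].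
    assert (Q w1 i <= 0) by (apply Hb; [lra|auto]).
    assert (Q w2 i <= 0).
    { apply IH; unfold w2.
      - intros j; destruct (idx_eqb j k); [lra|]. specialize (Hw j); lra.
      - destruct (idx_eqb i k); lra.
      - intros j; destruct (idx_eqb j k) eqn:Ej; [intros; lra|]. intros Hj.
        destruct (Hl j) as [->|]; [lra| |auto].
        rewrite (proj2 (idx_eqb_spec _ _) eq_refl) in Ej; discriminate. }
    lra.
Qed.

Lemma cond_i_iff_ii d (Q : Vec d -> Vec d) : cond_i Q <-> cond_ii Q.
Proof.
  split.
  - intros [HQ Hop]; split; [auto|split; [|apply Hop]].
    intros u i Hu.
    (* [u] is the midpoint of [w], which is nonpositive and zero at [i], and of the constant
       [2 u_i], where [Q] vanishes. *)
    pose (w := fun j => 2 * (u j - u i)).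
    replace u with (fun j => 1 / 2 * w j + (1 - 1 / 2) * @cst d (2 * u i) j).
    2:{ apply functional_extensionality; intros j; unfold w, cst; lra. }
    eapply Rle_trans; [apply HQ; lra|].
    rewrite (proj2 (proj2 Hop)).
    destruct (idx_list d) as [l Hl].
    assert (Q w i <= 0); [|lra].
    apply (@Qoperator_negative_part d Q i HQ Hop l); unfold w; [|lra|auto].
    intros j; specialize (Hu j); lra.
  - intros [HQ [Hpm Hc]]; split; [auto|split; [|split; [|auto]]].
    + intros l i Hl; apply Hpm; intros j; unfold vscale.
      rewrite unitv_same. destruct (idx_eq_dec j i) as [->|Hj].
      * rewrite unitv_same; lra.
      * rewrite unitv_other by auto; lra.
    + intros l i j Hl Hij; apply Hpm; intros k; unfold vscale.
      rewrite (unitv_other Hij).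
      destruct (idx_eq_dec k j) as [->|Hk].
      * rewrite unitv_same; lra.
      * rewrite unitv_other by auto; lra.
Qed.

Lemma convex_map_component d (Q : Vec d -> Vec d) i : convex_map Q ->
  convex_on (fun _ => True) (fun u => Q u i).
Proof. intros HQ u v l _ _ Hl; now apply HQ. Qed.

Lemma subspace_full (A : Type) : subspace (fun _ : A -> R => True).
Proof. split; [exists (fun _ => 0); auto|auto]. Qed.

Lemma linear_vsum d (l : Vec d -> R) : linear_on (fun _ => True) l ->
  forall u, l u = vsum (fun j => l (unitv j) * u j).
Proof.
  intros Hl.
  assert (Hadd : forall x y : Vec d, l (fun i => x i + y i) = l x + l y).
  { intros x y; transitivity (1 * l x + 1 * l y); [|ring].
    rewrite <- Hl by auto; f_equal; fcomb_eq. }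
  assert (Hscal : forall a (x : Vec d), l (fun i => a * x i) = a * l x).
  { intros a x; transitivity (a * l x + 0 * l x); [|ring].
    rewrite <- Hl by auto; f_equal; fcomb_eq. }
  assert (Hn : forall n (h : nat -> Vec d),
    l (fun i => nsum n (fun k => h k i)) = nsum n (fun k => l (h k))).
  { induction n as [|n IH]; simpl; intros h.
    - replace (fun _ : Idx d => 0) with (fun i : Idx d => 0 * @unitv d i i) by (apply functional_extensionality; intros; ring).
      rewrite (Hscal 0 (fun i => unitv i i)); ring.
    - rewrite (Hadd (fun i => nsum n (fun k => h k i)) (h n)), IH; reflexivity. }
  intros u; rewrite vsum_ext_nat.
  replace u with (fun i => nsum d (fun k => ext_nat (fun j => u j * unitv j i) k)) at 1.
  2:{ apply functional_extensionality; intros i; rewrite <- vsum_ext_nat; apply vsum_unitv. }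
  rewrite (Hn d (fun k i => ext_nat (fun j => u j * unitv j i) k)).
  apply nsum_ext; intros k Hk; rewrite (ext_nat_idx _ _ (ltb_of_lt Hk)).
  set (j := exist _ k (ltb_of_lt Hk) : Idx d).
  rewrite (Rmult_comm (l _)), <- Hscal; f_equal.
  apply functional_extensionality; intros i; now rewrite (ext_nat_idx _ _ (ltb_of_lt Hk)).
Qed.

Lemma unitv_sym d (i j : Idx d) : unitv i j = unitv j i.
Proof.
  destruct (idx_eq_dec i j) as [->|H]; [auto|].
  rewrite !unitv_other by congruence; auto.
Qed.

Lemma row_unitv d (g : Vec d) j : vsum (fun k => g k * unitv j k) = g j.
Proof.
  rewrite (@vsum_ext d _ (fun k => g k * unitv k j)); [apply vsum_unitv|].
  intros k; now rewrite unitv_sym.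
Qed.

(** An affine function bounded above on a line or ray cannot grow along it. The line of constants
    gives row sum zero, the rays [- l e_j] give nonnegative off-diagonal entries, and the sign of
    the diagonal follows from these two. *)
Lemma affine_minorant_Q_row d (Q : Vec d -> Vec d) i (g : Vec d) c :
  cond_ii Q -> (forall u, vsum (fun j => g j * u j) + c <= Q u i) ->
  g i <= 0 /\ (forall j, i <> j -> 0 <= g j) /\ vsum g = 0.
Proof.
  intros [_ [Hpm Hc]] Hg.
  assert (Hs : vsum g = 0).
  { assert (H : forall a, a * vsum g + c <= 0).
    { intros a; rewrite <- (Hc a i), <- vsum_scal.
      eapply Rle_trans; [|apply (Hg (cst a))]. apply Rplus_le_compat_r; right.
      apply vsum_ext; intros; unfold cst; ring. }
    pose proof (H 0) as H0.
    destruct (Req_dec (vsum g) 0) as [E|E]; [auto|exfalso].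
    (* This multiple of the constant vector makes the affine value equal to 1, against the upper
       bound 0. *)
    specialize (H ((1 - c) / vsum g)).
    replace ((1 - c) / vsum g * vsum g) with (1 - c) in H by (field; auto). lra. }
  assert (Hpos : forall j, i <> j -> 0 <= g j).
  { intros j Hij; destruct (Rle_dec 0 (g j)) as [|Hn]; [auto|exfalso].
    assert (H : forall l, 0 < l -> - l * g j + c <= 0).
    { intros l Hl. apply Rle_trans with (Q (vscale (- l) (unitv j)) i).
      - eapply Rle_trans; [|apply Hg]. apply Rplus_le_compat_r; right.
        rewrite <- (row_unitv g j), <- vsum_scal; apply vsum_ext; intros; unfold vscale; ring.
      - apply Hpm; intros k; unfold vscale; rewrite (unitv_other Hij).
        destruct (idx_eq_dec k j) as [->|Hk]; [rewrite unitv_same; lra|].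
        rewrite unitv_other by auto; lra. }
    assert (Hgj : 0 < - g j) by lra.
    assert (H0 : c <= 0).
    { specialize (Hg (cst 0)); rewrite Hc in Hg.
      rewrite (@vsum_ext d _ (fun j => 0)) in Hg by (intros; unfold cst; ring).
      rewrite vsum_0 in Hg; lra. }
    specialize (H ((1 - c) / - g j)).
    replace (- ((1 - c) / - g j) * g j) with (1 - c) in H by (field; lra).
    assert (0 < (1 - c) / - g j); [|specialize (H H1); lra].
    apply Rmult_lt_0_compat; [lra|now apply Rinv_0_lt_compat]. }
  repeat split; auto.
  assert (vsum (fun j => g i * unitv j i) <= vsum g).
  { apply vsum_le; intros j; destruct (idx_eq_dec j i) as [->|Hj].
    - rewrite unitv_same; lra.
    - rewrite unitv_other by congruence. rewrite Rmult_0_r; apply Hpos; congruence. }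
  rewrite (@vsum_single d _ i) in H.
  - rewrite unitv_same in H; lra.
  - intros j Hj; rewrite unitv_other by congruence; ring.
Qed.

(** Each component has its own subgradient at [u0]; these are the rows of the matrix, and being
    affine minorants they satisfy the sign and sum conditions. *)
Lemma subgradient_matrix d (Q : Vec d -> Vec d) (u0 : Vec d) : cond_ii Q ->
  exists q, Qmatrix q /\ forall u i, mv q u i - mv q u0 i <= Q u i - Q u0 i.
Proof.
  intros HQ.
  assert (H : forall i, exists g : Vec d, forall u,
    vsum (fun j => g j * u j) - vsum (fun j => g j * u0 j) <= Q u i - Q u0 i).
  { intros i.
    destruct (convex_subgradient (subspace_full (Idx d)) u0
      (convex_map_component i (proj1 HQ)) Logic.I) as [l [Hl Hle]].
    exists (fun j => l (unitv j)); intros u.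
    rewrite <- !linear_vsum by auto; auto. }
  pose (q := fun i => epsilon (inhabits (cst 0)) (fun g : Vec d => forall u,
    vsum (fun j => g j * u j) - vsum (fun j => g j * u0 j) <= Q u i - Q u0 i)).
  assert (Hq : forall i u, mv q u i - mv q u0 i <= Q u i - Q u0 i).
  { intros i; apply (epsilon_spec (inhabits (cst 0)) _ (H i)). }
  exists q; split; [|auto].
  assert (K : forall i, q i i <= 0 /\ (forall j, i <> j -> 0 <= q i j) /\ vsum (q i) = 0).
  { intros i; apply (@affine_minorant_Q_row d Q i (q i) (Q u0 i - mv q u0 i) HQ).
    intros u; specialize (Hq i u). unfold mv in *; lra. }
  split; [|split]; intros; apply K; auto.
Qed.

(** The canonical representation: all Q-matrices whose conjugate [sup_u ((q u)_i - (Q u)_i)] is finite,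
    with [f_q] its negative. *)
Lemma cond_ii_iii d (Q : Vec d -> Vec d) : cond_ii Q -> cond_iii Q.
Proof.
  intros HQ.
  pose (E := fun (q : Mat d) i y => exists u, y = Q u i - mv q u i).
  pose (P := fun q : Mat d => Qmatrix q /\ forall i, exists b, forall y, E q i y -> b <= y).
  pose (f := fun (q : Mat d) i => inf_of (E q i)).
  assert (HE : forall q i, P q -> (forall y, E q i y -> f q i <= y) /\
      (forall c, (forall y, E q i y -> c <= y) -> c <= f q i)).
  { intros q i [_ Hq]; destruct (Hq i) as [b Hb].
    apply inf_of_spec with b; [|auto]. exists (Q (cst 0) i - mv q (cst 0) i), (cst 0); auto. }
  assert (Hf0 : forall q i, P q -> f q i <= 0).
  { intros q i Pq; apply HE; [auto|]. exists (cst 0).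
    unfold cst at 2; rewrite mv_const by apply Pq.
    rewrite (proj2 (proj2 HQ)); ring. }
  (* The subgradient matrix at [u0] has a finite conjugate, attained at [u0], so its affine map
     touches [Q] there. *)
  assert (Hsub : forall u0, exists q, P q /\ forall i, Q u0 i <= mv q u0 i + f q i).
  { intros u0; destruct (subgradient_matrix u0 HQ) as [q [Hq Hle]].
    assert (Pq : P q).
    { split; [auto|]. intros i; exists (Q u0 i - mv q u0 i).
      intros y [u ->]; specialize (Hle u i); lra. }
    exists q; split; [auto|]. intros i.
    assert (Q u0 i - mv q u0 i <= f q i); [|lra].
    apply HE; [auto|]. intros y [u ->]; specialize (Hle u i); lra. }
  exists P, f; split; [intros q Hq; apply Hq|split].
  (* A subgradient at 0 has offset zero, because [Q] vanishes there. *)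
  - destruct (Hsub (cst 0)) as [q0 [Pq0 H0]]. exists q0.
    assert (Hz : forall i, f q0 i = 0).
    { intros i; apply Rle_antisym; [auto|].
      specialize (H0 i); unfold cst at 2 in H0; rewrite mv_const in H0 by apply Pq0.
      rewrite (proj2 (proj2 HQ)) in H0; lra. }
    split; [auto|split; [auto|]]. intros q Pq i; rewrite Hz; auto.
  - intros u0 i; split.
    + intros y [q [Pq ->]]. assert (f q i <= Q u0 i - mv q u0 i); [|lra].
      apply HE; [auto|]. exists u0; auto.
    + intros b Hb; destruct (Hsub u0) as [q [Pq Hle]].
      eapply Rle_trans; [apply Hle|]. apply Hb; exists q; auto.
Qed.

Lemma cond_ii_dispersive d (Q : Vec d -> Vec d) : cond_ii Q -> dispersive Q.
Proof.
  intros HQ; destruct (cond_ii_iii HQ) as [P [f Hr]].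
  eapply sup_representation_dispersive; exact Hr.
Qed.

(** * Local boundedness and Lipschitz continuity of convex functions *)

Section ConvexLipschitz.
Variables (d : nat) (g : Vec d -> R).
Hypothesis Hg : convex_on (fun _ => True) g.

(** Induction on the support: [u] is the midpoint of a vector on the [k]-th axis and one without
    [k]-th coordinate, both doubled, whence the radius [2 * r]. On the axis the endpoint values
    bound [g]. *)
Lemma convex_bounded_above_supported (l : list (Idx d)) : forall r, 0 < r -> exists M,
  forall u, in_ball r u -> (forall j, u j <> 0 -> In j l) -> g u <= M.
Proof.
  induction l as [|k l IH]; intros r Hr.
  - exists (g (cst 0)); intros u Hu Hl; right; f_equal.
    apply functional_extensionality; intros j; unfold cst.
    destruct (Req_dec (u j) 0) as [E|E]; [auto|destruct (Hl j E)].
  - destruct (IH (2 * r) ltac:(lra)) as [M HM].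
    pose (e := fun s => vscale s (unitv k) : Vec d).
    exists (1 / 2 * Rmax (g (e (2 * r))) (g (e (- (2 * r)))) + (1 - 1 / 2) * M).
    intros u Hu Hl.
    pose (w := fun j => if idx_eqb j k then 0 else 2 * u j).
    assert (Hw : g w <= M).
    { apply HM; unfold w.
      - intros j; destruct (idx_eqb j k); [rewrite Rabs_R0; lra|].
        rewrite Rabs_mult, (Rabs_right 2) by lra. specialize (Hu j); lra.
      - intros j; destruct (idx_eqb j k) eqn:Ej; [intros; lra|]. intros Hj.
        destruct (Hl j) as [->|]; [lra| |auto].
        rewrite (proj2 (idx_eqb_spec _ _) eq_refl) in Ej; discriminate. }
    assert (He : g (e (2 * u k)) <= Rmax (g (e (2 * r))) (g (e (- (2 * r))))).
    { pose (t := (u k + r) / (2 * r)).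
      assert (Ht : 0 <= t <= 1).
      { specialize (Hu k). apply Rabs_le_inv in Hu.
        unfold t; split.
        - apply Rmult_le_pos; [lra|left; apply Rinv_0_lt_compat; lra].
        - apply Rmult_le_reg_r with (2 * r); [lra|].
          unfold Rdiv; rewrite Rmult_assoc, Rinv_l by lra; lra. }
      replace (e (2 * u k)) with (fcomb t (e (2 * r)) (1 - t) (e (- (2 * r)))).
      2:{ apply functional_extensionality; intros j; unfold fcomb, e, vscale, t; field; lra. }
      eapply Rle_trans; [apply Hg; auto|].
      pose proof (Rmax_l (g (e (2 * r))) (g (e (- (2 * r))))).
      pose proof (Rmax_r (g (e (2 * r))) (g (e (- (2 * r))))).
      nra. }
    replace u with (fcomb (1 / 2) (e (2 * u k)) (1 - 1 / 2) w).
    2:{ apply functional_extensionality; intros j; unfold fcomb, e, vscale, w, unitv.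
        destruct (idx_eqb j k) eqn:Ej; [|lra]. apply idx_eqb_spec in Ej; subst; lra. }
    eapply Rle_trans; [apply Hg; auto; lra|].
    apply Rplus_le_compat; apply Rmult_le_compat_l; auto; lra.
Qed.

(** The upper bound yields the lower one, since 0 is the midpoint of [u] and [- u]. *)
Lemma convex_bounded_on_ball r : 0 < r -> exists M, 0 < M /\ forall u, in_ball r u -> Rabs (g u) <= M.
Proof.
  intros Hr; destruct (idx_list d) as [l Hl].
  destruct (convex_bounded_above_supported l Hr) as [M HM].
  assert (HM' : forall u, in_ball r u -> g u <= M) by (intros; apply HM; auto).
  exists (Rabs M + 2 * Rabs (g (cst 0)) + 1); split.
  { pose proof (Rabs_pos M); pose proof (Rabs_pos (g (cst 0))); lra. }
  intros u Hu.
  assert (Hu' : in_ball r (fun j => - u j)) by (intros j; rewrite Rabs_Ropp; auto).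
  pose proof (HM' _ Hu); pose proof (HM' _ Hu').
  pose proof (@Hg u (fun j => - u j) (1 / 2) Logic.I Logic.I ltac:(lra)) as H1.
  replace (fcomb (1 / 2) u (1 - 1 / 2) (fun j => - u j)) with (@cst d 0) in H1
    by (apply functional_extensionality; intros; unfold fcomb, cst; lra).
  pose proof (Rle_abs M); pose proof (Rle_abs (- g (cst 0))) as H4; rewrite Rabs_Ropp in H4.
  pose proof (Rabs_pos (g (cst 0))).
  apply Rabs_le; lra.
Qed.

(** Prolong the segment from [u] through [v] until it has moved by at most [r] more: the end [w]
    stays in the ball of radius [2 * r], where [g] is bounded by [M], and convexity bounds the
    increment by [2 M c / (r + c)]. *)
Lemma convex_locally_lipschitz r : 0 < r -> exists L, 0 < L /\
  forall u v c, in_ball r u -> in_ball r v -> 0 <= c -> (forall j, Rabs (u j - v j) <= c) ->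
  Rabs (g u - g v) <= L * c.
Proof.
  intros Hr; destruct (@convex_bounded_on_ball (2 * r)) as [M [HM0 HM]]; [lra|].
  exists (2 * M / r).
  assert (HL : 0 < 2 * M / r) by (apply Rmult_lt_0_compat; [lra|now apply Rinv_0_lt_compat]).
  split; [auto|].
  assert (K : forall u v c, in_ball r u -> in_ball r v -> 0 < c ->
    (forall j, Rabs (u j - v j) <= c) -> g v - g u <= 2 * M / r * c).
  { intros u v c Hu Hv Hc Huv.
    pose (t := r / c).
    assert (Ht : 0 < t) by (apply Rmult_lt_0_compat; [lra|now apply Rinv_0_lt_compat]).
    pose (w := fun j => v j + t * (v j - u j)).
    assert (Hw : in_ball (2 * r) w).
    { intros j; unfold w. eapply Rle_trans; [apply Rabs_triang|].
      rewrite Rabs_mult, (Rabs_right t) by lra. rewrite Rabs_minus_sym.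
      assert (t * Rabs (u j - v j) <= r); [|specialize (Hv j); lra].
      apply Rle_trans with (t * c); [apply Rmult_le_compat_l; [lra|auto]|].
      unfold t; right; field; lra. }
    assert (Hl : 0 < c / (r + c) <= 1).
    { split; [apply Rmult_lt_0_compat; [lra|apply Rinv_0_lt_compat; lra]|].
      apply Rmult_le_reg_r with (r + c); [lra|].
      unfold Rdiv; rewrite Rmult_assoc, Rinv_l by lra; lra. }
    pose proof (@Hg w u (c / (r + c)) Logic.I Logic.I ltac:(lra)) as H.
    replace (fcomb (c / (r + c)) w (1 - c / (r + c)) u) with v in H.
    2:{ apply functional_extensionality; intros j; unfold fcomb, w, t; field; lra. }
    assert (Hgw : Rabs (g w) <= M) by auto.
    assert (Hgu : Rabs (g u) <= M).
    { apply HM; intros j; specialize (Hu j); lra. }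
    apply Rabs_le_inv in Hgw; apply Rabs_le_inv in Hgu.
    apply Rle_trans with (c / (r + c) * (2 * M)); [nra|].
    replace (2 * M / r * c) with (c / r * (2 * M)) by (field; lra).
    apply Rmult_le_compat_r; [lra|]. apply Rmult_le_compat_l; [lra|].
    apply Rinv_le_contravar; lra. }
  intros u v c Hu Hv [Hc|<-] Huv.
  - apply Rabs_le; split.
    + pose proof (K u v c Hu Hv Hc Huv); lra.
    + apply K; auto. intros j; rewrite Rabs_minus_sym; auto.
  - replace v with u; [unfold Rminus; rewrite Rplus_opp_r, Rabs_R0; lra|].
    apply functional_extensionality; intros j; specialize (Huv j); apply Rabs_le_inv in Huv; lra.
Qed.

End ConvexLipschitz.

Lemma convex_map_bounded_on_ball d (Q : Vec d -> Vec d) r : convex_map Q -> 0 < r ->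
  exists M, 0 < M /\ forall u, in_ball r u -> forall i, Rabs (Q u i) <= M.
Proof.
  intros HQ Hr.
  destruct (@idx_common_delta d (fun x i => forall u, in_ball r u -> Rabs (Q u i) <= / x)) as [x [Hx H]].
  - intros i x y Hxy H u Hu; eapply Rle_trans; [now apply H|]; apply Rinv_le_contravar; lra.
  - intros i; destruct (convex_bounded_on_ball (convex_map_component i HQ) Hr) as [M [HM H]].
    exists (/ M); split; [now apply Rinv_0_lt_compat|]. now rewrite Rinv_inv.
  - exists (/ x); split; [now apply Rinv_0_lt_compat|auto].
Qed.

Lemma convex_map_locally_lipschitz d (Q : Vec d -> Vec d) r : convex_map Q -> 0 < r ->
  exists L, 0 < L /\ forall u v c, in_ball r u -> in_ball r v -> 0 <= c ->
    (forall j, Rabs (u j - v j) <= c) -> forall i, Rabs (Q u i - Q v i) <= L * c.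
Proof.
  intros HQ Hr.
  destruct (@idx_common_delta d (fun x i => forall u v c, in_ball r u -> in_ball r v -> 0 <= c ->
    (forall j, Rabs (u j - v j) <= c) -> Rabs (Q u i - Q v i) <= / x * c)) as [x [Hx H]].
  - intros i x y Hxy H u v c Hu Hv Hc Huv; eapply Rle_trans; [now apply (H u v c)|].
    apply Rmult_le_compat_r; [auto|]. apply Rinv_le_contravar; lra.
  - intros i; destruct (convex_locally_lipschitz (convex_map_component i HQ) Hr) as [L [HL H]].
    exists (/ L); split; [now apply Rinv_0_lt_compat|]. now rewrite Rinv_inv.
  - exists (/ x); split; [now apply Rinv_0_lt_compat|intros; now apply H].
Qed.

(** * The nonlinear differential equation *)

Section DifferentialEquation.
Import Coquelicot.Coquelicot.

(** Continuous induction: at the supremum of the times up to which [Pr] holds throughout, the limit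
    step gives [Pr] and the forward step passes beyond it. *)
Lemma real_induction (Pr : R -> Prop) : Pr 0 ->
  (forall s, 0 <= s -> Pr s -> exists delta, 0 < delta /\ forall h, 0 < h < delta -> Pr (s + h)) ->
  (forall s, 0 < s -> (forall r, 0 <= r < s -> Pr r) -> Pr s) ->
  forall t, 0 <= t -> Pr t.
Proof.
  intros H0 Hstep Hlim t Ht; apply NNPP; intros Hn.
  pose (A := fun s => 0 <= s /\ forall r, 0 <= r <= s -> Pr r).
  assert (Hb : forall s, A s -> s < t).
  { intros s [Hs1 Hs2]; destruct (Rlt_dec s t) as [|Hlt]; [auto|exfalso; apply Hn, Hs2; lra]. }
  destruct (completeness A) as [m [Hm1 Hm2]].
  - exists t; intros s Hs; specialize (Hb s Hs); lra.
  - exists 0; split; [lra|]. intros r Hr; replace r with 0 by lra; auto.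
  - assert (Hm0 : 0 <= m).
    { apply Hm1; split; [lra|]. intros r Hr; replace r with 0 by lra; auto. }
    assert (Hlt : forall r, 0 <= r < m -> Pr r).
    { intros r Hr; apply NNPP; intros Hnr.
      assert (m <= r); [|lra]. apply Hm2; intros s [Hs1 Hs2].
      destruct (Rle_dec s r) as [|Hsr]; [auto|exfalso; apply Hnr, Hs2; lra]. }
    assert (Hm : Pr m).
    { destruct Hm0 as [Hm0|<-]; [apply Hlim; auto|auto]. }
    destruct (Hstep m Hm0 Hm) as [delta [Hd1 Hd2]].
    assert (A (m + delta / 2)).
    { split; [lra|]. intros r Hr.
      destruct (Rlt_dec r m) as [|Hrm]; [apply Hlt; lra|].
      destruct (Req_dec r m) as [->|Hne]; [auto|].
      replace r with (m + (r - m)) by ring; apply Hd2; lra. }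
    specialize (Hm1 _ H); lra.
Qed.

(** The upper right Dini derivative is at most [D]. Together with the dual bound [right_growth_ge]
    this is what a generator says about an orbit. *)
Definition right_growth_le (g : R -> R) (t D : R) : Prop :=
  forall eps, 0 < eps -> exists delta, 0 < delta /\
    forall h, 0 < h < delta -> g (t + h) - g t <= (D + eps) * h.

Definition right_growth_ge (g : R -> R) (t D : R) : Prop :=
  forall eps, 0 < eps -> exists delta, 0 < delta /\
    forall h, 0 < h < delta -> (D - eps) * h <= g (t + h) - g t.

(** The difference can cross the level [eps (1 + t)] only at an index where it is maximal; there
    the hypothesis bounds its right derivative by [0 < eps]. *)
Lemma comparison_general d (u v Du Dv : R -> Vec d) :
  (forall t i, 0 <= t -> (forall j, u t j - v t j <= u t i - v t i) -> Du t i <= Dv t i) ->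
  (forall t i, 0 <= t -> cont_within_nonneg (fun s => u s i) t) ->
  (forall t i, 0 <= t -> cont_within_nonneg (fun s => v s i) t) ->
  (forall t i, 0 <= t -> right_growth_le (fun s => u s i) t (Du t i)) ->
  (forall t i, 0 <= t -> right_growth_ge (fun s => v s i) t (Dv t i)) ->
  (forall i, u 0 i <= v 0 i) ->
  forall t i, 0 <= t -> u t i <= v t i.
Proof.
  intros HF Cu Cv Gu Gv H0.
  assert (K : forall eps, 0 < eps -> forall t, 0 <= t -> forall i, u t i - v t i <= eps * (1 + t)).
  { intros eps Heps; apply (@real_induction (fun t => forall i, u t i - v t i <= eps * (1 + t))).
    - intros i; specialize (H0 i); lra.
    - intros s Hs Hle.
      destruct (@idx_common_delta d (fun x i => forall h, 0 < h < x ->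
        u (s + h) i - v (s + h) i <= eps * (1 + (s + h)))) as [x [Hx H]].
      + intros i x y Hxy H h Hh; apply H; lra.
      + intros i; destruct (Hle i) as [Hlt|Heq].
        * pose (e := eps * (1 + s) - (u s i - v s i)).
          destruct (Cu s i Hs (e / 2) ltac:(unfold e; lra)) as [d1 [Hd1 K1]].
          destruct (Cv s i Hs (e / 2) ltac:(unfold e; lra)) as [d2 [Hd2 K2]].
          exists (Rmin d1 d2); split; [now apply Rmin_pos|]. intros h Hh.
          pose proof (Rmin_l d1 d2); pose proof (Rmin_r d1 d2).
          specialize (K1 (s + h) ltac:(lra)); specialize (K2 (s + h) ltac:(lra)).
          replace (s + h - s) with h in K1, K2 by ring.
          rewrite (Rabs_right h) in K1, K2 by lra.
          specialize (K1 ltac:(lra)); specialize (K2 ltac:(lra)).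
          apply Rabs_def2 in K1; apply Rabs_def2 in K2. unfold e in *; nra.
        * assert (HFi : Du s i <= Dv s i).
          { apply HF; [auto|]; intros j; rewrite Heq; apply Hle. }
          destruct (Gu s i Hs (eps / 2) ltac:(lra)) as [d1 [Hd1 K1]].
          destruct (Gv s i Hs (eps / 2) ltac:(lra)) as [d2 [Hd2 K2]].
          exists (Rmin d1 d2); split; [now apply Rmin_pos|]. intros h Hh.
          pose proof (Rmin_l d1 d2); pose proof (Rmin_r d1 d2).
          specialize (K1 h ltac:(lra)); specialize (K2 h ltac:(lra)). nra.
      + exists x; split; [auto|]. intros h Hh i; apply H; auto.
    - intros s Hs Hlt i. apply Rnot_lt_le; intros Hgt.
      pose (e := (u s i - v s i) - eps * (1 + s)).
      destruct (Cu s i ltac:(lra) (e / 2) ltac:(unfold e; lra)) as [d1 [Hd1 K1]].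
      destruct (Cv s i ltac:(lra) (e / 2) ltac:(unfold e; lra)) as [d2 [Hd2 K2]].
      pose (h := Rmin s (Rmin d1 d2) / 2).
      assert (0 < Rmin s (Rmin d1 d2)) by (repeat apply Rmin_pos; auto).
      pose proof (Rmin_l s (Rmin d1 d2)); pose proof (Rmin_r s (Rmin d1 d2)).
      pose proof (Rmin_l d1 d2); pose proof (Rmin_r d1 d2).
      assert (Hh : Rabs (s - h - s) = h).
      { replace (s - h - s) with (- h) by ring. rewrite Rabs_Ropp; apply Rabs_right; unfold h; lra. }
      specialize (K1 (s - h)); specialize (K2 (s - h)); rewrite Hh in K1, K2.
      specialize (K1 ltac:(unfold h; lra) ltac:(unfold h; lra)).
      specialize (K2 ltac:(unfold h; lra) ltac:(unfold h; lra)).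
      specialize (Hlt (s - h) ltac:(unfold h; lra) i).
      apply Rabs_def2 in K1; apply Rabs_def2 in K2.
      assert (0 < h) by (unfold h; lra). unfold e in *; nra. }
  intros t i Ht; apply Rnot_lt_le; intros Hgt.
  (* This choice puts the barrier at time [t] at half the alleged gap. *)
  specialize (K ((u t i - v t i) / (2 * (1 + t)))).
  assert (0 < (u t i - v t i) / (2 * (1 + t))) as Hp.
  { apply Rmult_lt_0_compat; [lra|apply Rinv_0_lt_compat; lra]. }
  specialize (K Hp t Ht i).
  replace ((u t i - v t i) / (2 * (1 + t)) * (1 + t)) with ((u t i - v t i) / 2) in K by (field; lra).
  lra.
Qed.

Lemma comparison_principle d (F : Vec d -> Vec d) (u v : R -> Vec d) :
  dispersive F ->
  (forall t i, 0 <= t -> cont_within_nonneg (fun s => u s i) t) ->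
  (forall t i, 0 <= t -> cont_within_nonneg (fun s => v s i) t) ->
  (forall t i, 0 <= t -> right_growth_le (fun s => u s i) t (F (u t) i)) ->
  (forall t i, 0 <= t -> right_growth_ge (fun s => v s i) t (F (v t) i)) ->
  (forall i, u 0 i <= v 0 i) ->
  forall t i, 0 <= t -> u t i <= v t i.
Proof.
  intros HF; apply (@comparison_general d u v (fun t => F (u t)) (fun t => F (v t))).
  intros t i _; apply HF.
Qed.

(** The intervals around [a n] of radius [2 K / 2^n] are nested; [l] is the supremum of their left
    ends. *)
Lemma geometric_limit (a : nat -> R) (K : R) :
  (forall n, Rabs (a (S n) - a n) <= K * (1 / 2) ^ n) ->
  exists l, forall n, Rabs (a n - l) <= 2 * K * (1 / 2) ^ n.
Proof.
  intros H.
  assert (HK : 0 <= K).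
  { specialize (H O); simpl in H. pose proof (Rabs_pos (a 1%nat - a O)); lra. }
  assert (Hp : forall n, 0 < (1 / 2) ^ n) by (intros; apply pow_lt; lra).
  assert (Hup : forall n k, a n - 2 * K * (1 / 2) ^ n <= a (n + k)%nat - 2 * K * (1 / 2) ^ (n + k) /\
    a (n + k)%nat + 2 * K * (1 / 2) ^ (n + k) <= a n + 2 * K * (1 / 2) ^ n).
  { intros n; induction k as [|k IH]; [rewrite Nat.add_0_r; lra|].
    rewrite Nat.add_succ_r. specialize (H (n + k)%nat). apply Rabs_le_inv in H.
    simpl pow in *. specialize (Hp (n + k)%nat). nra. }
  assert (Hcross : forall n m, a n - 2 * K * (1 / 2) ^ n <= a m + 2 * K * (1 / 2) ^ m).
  { intros n m. destruct (Hup n m) as [H1 _]; destruct (Hup m n) as [_ H2].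
    rewrite (Nat.add_comm m n) in H2. specialize (Hp (n + m)%nat). nra. }
  destruct (completeness (fun y => exists n, y = a n - 2 * K * (1 / 2) ^ n)) as [l [Hl1 Hl2]].
  - exists (a O + 2 * K * (1 / 2) ^ 0); intros y [n ->]; apply Hcross.
  - exists (a O - 2 * K * (1 / 2) ^ 0), O; auto.
  - exists l; intros n; apply Rabs_le; split.
    + assert (l <= a n + 2 * K * (1 / 2) ^ n); [|lra]. apply Hl2; intros y [m ->]; auto.
    + assert (a n - 2 * K * (1 / 2) ^ n <= l); [|lra]. apply Hl1; exists n; auto.
Qed.

Lemma Rabs_eq_of_geometric x y K : (forall n : nat, Rabs (x - y) <= K * (1 / 2) ^ n) -> x = y.
Proof.
  intros H; apply cond_eq; intros eps Heps.
  assert (HK : 0 <= K).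
  { specialize (H O); simpl in H. pose proof (Rabs_pos (x - y)); lra. }
  destruct (pow_lt_1_zero (1 / 2) ltac:(rewrite Rabs_right; lra) (eps / (K + 1))) as [n Hn].
  { apply Rmult_lt_0_compat; [auto|apply Rinv_0_lt_compat; lra]. }
  specialize (Hn n (Nat.le_refl n)); specialize (H n).
  assert (0 < (1 / 2) ^ n) by (apply pow_lt; lra).
  rewrite Rabs_right in Hn by lra.
  apply Rmult_lt_compat_l with (r := K + 1) in Hn; [|lra].
  replace ((K + 1) * (eps / (K + 1))) with eps in Hn by (field; lra). nra.
Qed.

(** * Picard iteration for a bounded, globally Lipschitz vector field *)

Section Picard.
Variables (d : nat) (F : Vec d -> Vec d) (M L : R) (u0 : Vec d).
Hypothesis HM : 0 < M.
Hypothesis HL : 0 < L.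
Hypothesis Fbounded : forall u i, Rabs (F u i) <= M.
Hypothesis Flip : forall u v c, 0 <= c -> (forall j, Rabs (u j - v j) <= c) ->
  forall i, Rabs (F u i - F v i) <= L * c.

Definition path_lipschitz (u : R -> Vec d) : Prop :=
  forall i s t, 0 <= s -> 0 <= t -> Rabs (u t i - u s i) <= M * Rabs (t - s).

(** [Rmax 0 s] continues the integrand constantly to negative times, so the integral has a two-sided
    derivative at 0. *)
Definition picard_integrand (u : R -> Vec d) i (s : R) : R := F (u (Rmax 0 s)) i.

Definition picard_step (u : R -> Vec d) : R -> Vec d :=
  fun t i => u0 i + RInt (picard_integrand u i) 0 t.

Lemma Rmax0_lipschitz s t : Rabs (Rmax 0 t - Rmax 0 s) <= Rabs (t - s).
Proof.
  unfold Rmax; destruct (Rle_dec 0 t), (Rle_dec 0 s); unfold Rabs;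
    repeat destruct Rcase_abs; lra.
Qed.

Lemma picard_integrand_continuous u i : path_lipschitz u ->
  forall s, continuous (picard_integrand u i) s.
Proof.
  intros Hu s; apply continuity_pt_filterlim.
  intros eps Heps; exists (eps / (L * M)).
  assert (0 < L * M) by nra.
  split; [apply Rmult_lt_0_compat; [auto|now apply Rinv_0_lt_compat]|].
  intros t [_ Ht]; simpl in *; unfold R_dist in *.
  apply Rle_lt_trans with (L * (M * Rabs (t - s))).
  - apply Flip; [pose proof (Rabs_pos (t - s)); nra|].
    intros j; eapply Rle_trans; [apply Hu; apply Rmax_l|].
    apply Rmult_le_compat_l; [lra|apply Rmax0_lipschitz].
  - apply Rmult_lt_compat_l with (r := L * M) in Ht; [|auto].
    replace (L * M * (eps / (L * M))) with eps in Ht by (field; lra). lra.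
Qed.

Lemma picard_integrand_integrable u i a b : path_lipschitz u ->
  ex_RInt (picard_integrand u i) a b.
Proof.
  intros Hu; apply (@ex_RInt_continuous R_CompleteNormedModule).
  intros s _; now apply picard_integrand_continuous.
Qed.

Lemma picard_step_diff u i s t : path_lipschitz u ->
  picard_step u t i - picard_step u s i = RInt (picard_integrand u i) s t.
Proof.
  intros Hu; unfold picard_step.
  rewrite <- (RInt_Chasles (picard_integrand u i) 0 s t)
    by now apply picard_integrand_integrable.
  unfold plus; simpl; ring.
Qed.

Lemma picard_step_lipschitz u : path_lipschitz u -> path_lipschitz (picard_step u).
Proof.
  intros Hu.
  assert (K : forall i s t, s <= t -> Rabs (picard_step u t i - picard_step u s i) <= M * (t - s)).
  { intros i s t Hst; rewrite picard_step_diff, Rmult_comm by auto.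
    apply abs_RInt_le_const; [auto|now apply picard_integrand_integrable|].
    intros x _; apply Fbounded. }
  intros i s t _ _; destruct (Rle_dec s t) as [Hst|Hst].
  - rewrite (Rabs_right (t - s)) by lra; auto.
  - rewrite Rabs_minus_sym, (Rabs_minus_sym t s), (Rabs_right (s - t)) by lra; apply K; lra.
Qed.

(** In the norm weighted by [exp (- 2 L t)] the Picard map contracts with factor 1/2, as [L] times
    the integral of [exp (2 L s)] is at most [exp (2 L t) / 2]. The weight makes the solution global
    in one stroke. *)
Lemma picard_step_contraction u v K : path_lipschitz u -> path_lipschitz v -> 0 <= K ->
  (forall t i, 0 <= t -> Rabs (u t i - v t i) <= K * exp (2 * L * t)) ->
  forall t i, 0 <= t -> Rabs (picard_step u t i - picard_step v t i) <= K / 2 * exp (2 * L * t).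
Proof.
  intros Hu Hv HK H t i Ht; unfold picard_step.
  replace (u0 i + RInt (picard_integrand u i) 0 t - (u0 i + RInt (picard_integrand v i) 0 t)) with
    (minus (RInt (picard_integrand u i) 0 t) (RInt (picard_integrand v i) 0 t))
    by (unfold minus, plus, opp; simpl; lra).
  rewrite <- (RInt_minus (V := R_CompleteNormedModule)) by now apply picard_integrand_integrable.
  assert (HI : is_RInt (fun s => L * (K * exp (2 * L * s))) 0 t
    (minus (K / 2 * exp (2 * L * t)) (K / 2 * exp (2 * L * 0)))).
  { apply (is_RInt_derive (fun s => K / 2 * exp (2 * L * s))).
    - intros s _; auto_derive; [auto|field].
    - intros s _; apply (ex_derive_continuous (fun s => L * (K * exp (2 * L * s)))). auto_derive; auto. }
  apply Rle_trans with (minus (K / 2 * exp (2 * L * t)) (K / 2 * exp (2 * L * 0))).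
  - apply (norm_RInt_le (V := R_CompleteNormedModule)
      (fun s => minus (picard_integrand u i s) (picard_integrand v i s))
      (fun s => L * (K * exp (2 * L * s))) 0 t); auto.
    + intros s Hs. apply (Flip (u (Rmax 0 s)) (v (Rmax 0 s))).
      * pose proof (exp_pos (2 * L * s)); nra.
      * rewrite Rmax_right by lra. intros j; apply H; lra.
    + apply RInt_correct.
      apply (ex_RInt_minus (V := R_CompleteNormedModule)); now apply picard_integrand_integrable.
  - unfold minus, plus, opp; simpl. rewrite Rmult_0_r, exp_0. lra.
Qed.

Fixpoint picard_iter (n : nat) : R -> Vec d :=
  match n with O => fun _ => u0 | S n => picard_step (picard_iter n) end.

Lemma picard_iter_lipschitz n : path_lipschitz (picard_iter n).
Proof.
  induction n as [|n IH]; simpl; [|now apply picard_step_lipschitz].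
  intros i s t _ _; unfold Rminus at 1; rewrite Rplus_opp_r, Rabs_R0.
  pose proof (Rabs_pos (t - s)); nra.
Qed.

Lemma picard_iter_cauchy n : forall t i, 0 <= t ->
  Rabs (picard_iter (S n) t i - picard_iter n t i) <= M / (2 * L) * (1 / 2) ^ n * exp (2 * L * t).
Proof.
  assert (HC : 0 < M / (2 * L)) by (apply Rmult_lt_0_compat; [auto|apply Rinv_0_lt_compat; lra]).
  induction n as [|n IH]; intros t i Ht.
  - pose proof (picard_step_lipschitz (picard_iter_lipschitz 0) i (Rle_refl 0) Ht) as H.
    change (picard_iter 1 t i) with (picard_step (picard_iter 0) t i).
    change (picard_iter 0 t i) with (u0 i).
    replace (picard_step (picard_iter 0) 0 i) with (u0 i) in H
      by (unfold picard_step; rewrite RInt_point; unfold zero; simpl; ring).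
    eapply Rle_trans; [exact H|]. rewrite Rminus_0_r, Rabs_right by lra. simpl.
    (* The first increment is at most [M t]; absorbing it by [2 L t <= exp (2 L t)] fixes the
       constant [M / (2 * L)]. *)
    replace (M * t) with (M / (2 * L) * (2 * L * t)) by (field; lra).
    rewrite Rmult_1_r; apply Rmult_le_compat_l; [lra|].
    destruct (Req_dec t 0) as [->|Hne]; [rewrite Rmult_0_r, exp_0; lra|].
    pose proof (exp_ineq1 (2 * L * t) ltac:(nra)); lra.
  - simpl pow. replace (M / (2 * L) * (1 / 2 * (1 / 2) ^ n)) with (M / (2 * L) * (1 / 2) ^ n / 2) by (field; lra).
    apply (picard_step_contraction (picard_iter_lipschitz (S n)) (picard_iter_lipschitz n)); auto.
    assert (0 < (1 / 2) ^ n) by (apply pow_lt; lra). nra.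
Qed.

Lemma picard_solution : exists U : R -> Vec d,
  (forall i, U 0 i = u0 i) /\ path_lipschitz U /\
  (forall t i, 0 <= t -> is_derive (fun s => U s i) t (F (U t) i)).
Proof.
  set (C := M / (2 * L)).
  assert (HC : 0 < C) by (apply Rmult_lt_0_compat; [auto|apply Rinv_0_lt_compat; lra]).
  assert (Hp : forall n, 0 < (1 / 2) ^ n) by (intros; apply pow_lt; lra).
  assert (Hlim : forall t i, exists l, 0 <= t ->
    forall n, Rabs (picard_iter n t i - l) <= 2 * C * (1 / 2) ^ n * exp (2 * L * t)).
  { intros t i; destruct (Rle_dec 0 t) as [Ht|Ht]; [|exists 0; lra].
    destruct (@geometric_limit (fun n => picard_iter n t i) (C * exp (2 * L * t))) as [l Hl].
    - intros n; pose proof (picard_iter_cauchy n i Ht). unfold C; lra.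
    - exists l; intros _ n; specialize (Hl n); lra. }
  pose (V := fun t i => epsilon (inhabits 0) (fun l => 0 <= t ->
    forall n, Rabs (picard_iter n t i - l) <= 2 * C * (1 / 2) ^ n * exp (2 * L * t))).
  assert (HV : forall t i, 0 <= t ->
    forall n, Rabs (picard_iter n t i - V t i) <= 2 * C * (1 / 2) ^ n * exp (2 * L * t)).
  { intros t i; apply (epsilon_spec (inhabits 0) _ (Hlim t i)). }
  assert (LV : path_lipschitz V).
  { intros i s t Hs Ht; apply Rle_plus_epsilon; intros eps Heps.
    apply Rnot_lt_le; intros Hlt.
    pose (D := Rabs (V t i - V s i) - M * Rabs (t - s)).
    assert (HD : D = 0); [|unfold D in HD; lra].
    apply (@Rabs_eq_of_geometric D 0 (2 * C * exp (2 * L * t) + 2 * C * exp (2 * L * s))).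
    intros n; rewrite Rminus_0_r, Rabs_right by (unfold D; lra). unfold D.
    pose proof (HV t i Ht n) as H1; pose proof (HV s i Hs n) as H2.
    pose proof (picard_iter_lipschitz n i Hs Ht) as H3.
    replace (V t i - V s i) with ((picard_iter n t i - picard_iter n s i) +
      (picard_iter n s i - V s i) - (picard_iter n t i - V t i)) by ring.
    eapply Rle_trans; [apply Rplus_le_compat_r; unfold Rminus at 1;
      eapply Rle_trans; [apply Rabs_triang|]; rewrite Rabs_Ropp;
      apply Rplus_le_compat_r, Rabs_triang|].
    lra. }
  assert (Hfix : forall t i, 0 <= t -> picard_step V t i = V t i).
  { intros t i Ht.
    apply (@Rabs_eq_of_geometric _ _ (2 * C * exp (2 * L * t))); intros n.
    assert (HK : 0 <= 2 * C * (1 / 2) ^ n) by (specialize (Hp n); nra).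
    pose proof (picard_step_contraction (picard_iter_lipschitz n) LV HK
      (fun t i Ht => HV t i Ht n) i Ht) as H1.
    pose proof (HV t i Ht (S n)) as H2. simpl in H2.
    replace (picard_step V t i - V t i) with
      (- (picard_step (picard_iter n) t i - picard_step V t i) +
       (picard_step (picard_iter n) t i - V t i)) by ring.
    eapply Rle_trans; [apply Rabs_triang|]; rewrite Rabs_Ropp. lra. }
  (* The limit [V] is specified only at nonnegative times. Its Picard image agrees with it there and
     is an integral over the whole line, hence differentiable at 0 as well. *)
  exists (picard_step V); split; [|split; [now apply picard_step_lipschitz|]].
  - intros i; unfold picard_step; rewrite RInt_point; unfold zero; simpl; ring.
  - intros t i Ht.
    assert (Hd : is_derive (RInt (picard_integrand V i) 0) t (picard_integrand V i t)).
    { apply (is_derive_RInt (V := R_NormedModule) _ _ 0).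
      - exists (mkposreal 1 Rlt_0_1); intros s _; apply (RInt_correct (V := R_CompleteNormedModule)).
        now apply picard_integrand_integrable.
      - now apply picard_integrand_continuous. }
    replace (F (picard_step V t) i) with (plus (@zero R_NormedModule) (picard_integrand V i t)).
    + apply (is_derive_plus (fun _ => u0 i)); [apply (@is_derive_const R_AbsRing R_NormedModule)|auto].
    + rewrite plus_zero_l; unfold picard_integrand; rewrite Rmax_right by auto.
      f_equal; f_equal; apply functional_extensionality; intros j; now rewrite Hfix.
Qed.

End Picard.

(** * Regularity, comparison and uniqueness of classical solutions *)

Lemma deriv_within_growth g t D : 0 <= t -> deriv_within_nonneg g t D ->
  right_growth_le g t D /\ right_growth_ge g t D.
Proof.
  intros Ht H.
  assert (K : forall eps, 0 < eps -> exists delta, 0 < delta /\ forall h, 0 < h < delta ->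
    (D - eps) * h <= g (t + h) - g t <= (D + eps) * h).
  { intros eps Heps; destruct (H eps Heps) as [delta [Hd Hdd]].
    exists delta; split; [auto|]. intros h Hh.
    specialize (Hdd h ltac:(lra)). rewrite Rabs_right in Hdd by lra.
    specialize (Hdd ltac:(lra) ltac:(lra)). apply Rabs_def2 in Hdd.
    replace (g (t + h) - g t) with ((g (t + h) - g t) / h * h) by (field; lra).
    split; apply Rmult_le_compat_r; lra. }
  split; intros eps Heps; destruct (K eps Heps) as [delta [Hd Hdd]]; exists delta;
    split; auto; intros h Hh; apply Hdd; auto.
Qed.

Lemma deriv_within_continuous g t D : deriv_within_nonneg g t D -> cont_within_nonneg g t.
Proof.
  intros H eps Heps; destruct (H 1 Rlt_0_1) as [delta [Hd Hdd]].
  pose (K := Rabs D + 1).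
  assert (HK : 0 < K) by (unfold K; pose proof (Rabs_pos D); lra).
  exists (Rmin delta (eps / K)); split.
  { apply Rmin_pos; [auto|]. apply Rmult_lt_0_compat; [auto|now apply Rinv_0_lt_compat]. }
  intros s Hs Hst. pose proof (Rmin_l delta (eps / K)); pose proof (Rmin_r delta (eps / K)).
  destruct (Req_dec (s - t) 0) as [E|E].
  { replace s with t by lra. unfold Rminus; rewrite Rplus_opp_r, Rabs_R0; auto. }
  specialize (Hdd (s - t) E ltac:(lra) ltac:(lra)).
  replace (t + (s - t)) with s in Hdd by ring.
  assert (Rabs ((g s - g t) / (s - t)) <= K).
  { replace ((g s - g t) / (s - t)) with ((g s - g t) / (s - t) - D + D) by ring.
    eapply Rle_trans; [apply Rabs_triang|]. unfold K; lra. }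
  replace (g s - g t) with ((g s - g t) / (s - t) * (s - t)) by (field; auto).
  rewrite Rabs_mult. pose proof (Rabs_pos (s - t)).
  apply Rle_lt_trans with (K * Rabs (s - t)); [apply Rmult_le_compat_r; auto|].
  replace eps with (K * (eps / K)) by (field; lra). apply Rmult_lt_compat_l; lra.
Qed.

Lemma right_growth_ge_comb g1 g2 t D1 D2 l : 0 <= l <= 1 ->
  right_growth_ge g1 t D1 -> right_growth_ge g2 t D2 ->
  right_growth_ge (fun s => l * g1 s + (1 - l) * g2 s) t (l * D1 + (1 - l) * D2).
Proof.
  intros Hl H1 H2 eps Heps.
  destruct (H1 eps Heps) as [x [Hx Kx]], (H2 eps Heps) as [y [Hy Ky]].
  exists (Rmin x y); split; [now apply Rmin_pos|]. intros h Hh.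
  pose proof (Rmin_l x y); pose proof (Rmin_r x y).
  specialize (Kx h ltac:(lra)); specialize (Ky h ltac:(lra)). nra.
Qed.

Lemma cont_within_comb g1 g2 t l : 0 <= l <= 1 ->
  cont_within_nonneg g1 t -> cont_within_nonneg g2 t ->
  cont_within_nonneg (fun s => l * g1 s + (1 - l) * g2 s) t.
Proof.
  intros Hl H1 H2 eps Heps.
  destruct (H1 (eps / 2) ltac:(lra)) as [x [Hx Kx]], (H2 (eps / 2) ltac:(lra)) as [y [Hy Ky]].
  exists (Rmin x y); split; [now apply Rmin_pos|]. intros s Hs Hst.
  pose proof (Rmin_l x y); pose proof (Rmin_r x y).
  specialize (Kx s Hs ltac:(lra)); specialize (Ky s Hs ltac:(lra)).
  apply Rabs_def2 in Kx; apply Rabs_def2 in Ky. apply Rabs_def1; nra.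
Qed.

Lemma cont_within_const c t : cont_within_nonneg (fun _ => c) t.
Proof.
  intros eps Heps; exists 1; split; [lra|]. intros; unfold Rminus; now rewrite Rplus_opp_r, Rabs_R0.
Qed.

Lemma right_growth_const c t : right_growth_le (fun _ => c) t 0 /\ right_growth_ge (fun _ => c) t 0.
Proof. split; intros eps Heps; exists 1; split; try lra; intros; nra. Qed.

Lemma classical_solution_regular d (Q : Vec d -> Vec d) u0 u : classical_solution Q u0 u ->
  forall t i, 0 <= t -> cont_within_nonneg (fun s => u s i) t /\
    right_growth_le (fun s => u s i) t (Q (u t) i) /\
    right_growth_ge (fun s => u s i) t (Q (u t) i).
Proof.
  intros [_ H] t i Ht; destruct (H t Ht i) as [Hd _].
  split; [eapply deriv_within_continuous; eauto|]. now apply deriv_within_growth.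
Qed.

Lemma classical_solution_monotone d (Q : Vec d -> Vec d) u0 v0 u v : dispersive Q ->
  classical_solution Q u0 u -> classical_solution Q v0 v -> (forall i, u0 i <= v0 i) ->
  forall t i, 0 <= t -> u t i <= v t i.
Proof.
  intros HQ Hu Hv H0; apply (@comparison_principle d Q u v HQ).
  1,3: intros; eapply classical_solution_regular in Hu; eauto; apply Hu.
  1,2: intros; eapply classical_solution_regular in Hv; eauto; apply Hv.
  intros i; rewrite (proj1 Hu), (proj1 Hv); auto.
Qed.

Lemma classical_solution_unique d (Q : Vec d -> Vec d) u0 u v : dispersive Q ->
  classical_solution Q u0 u -> classical_solution Q u0 v ->
  forall t i, 0 <= t -> u t i = v t i.
Proof.
  intros HQ Hu Hv t i Ht; apply Rle_antisym;
    eapply classical_solution_monotone; eauto; intros; lra.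
Qed.

Lemma classical_solution_ext d (Q : Vec d -> Vec d) u0 u v :
  classical_solution Q u0 u -> (forall t i, 0 <= t -> v t i = u t i) -> classical_solution Q u0 v.
Proof.
  intros [H0 H] E; split.
  - intros i; rewrite E by lra; auto.
  - assert (EV : forall t, 0 <= t -> v t = u t) by (intros; apply functional_extensionality; auto).
    intros t Ht i; destruct (H t Ht i) as [Hd Hc]; split; intros eps Heps.
    + destruct (Hd eps Heps) as [x [Hx K]]; exists x; split; [auto|]. intros h Hh1 Hh2 Hh3.
      rewrite !EV by auto; auto.
    + destruct (Hc eps Heps) as [x [Hx K]]; exists x; split; [auto|]. intros s Hs1 Hs2.
      rewrite !EV by auto; auto.
Qed.

Lemma classical_solution_shift d (Q : Vec d -> Vec d) u0 u s : 0 <= s ->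
  classical_solution Q u0 u -> classical_solution Q (u s) (fun t => u (t + s)).
Proof.
  intros Hs [H0 H]; split.
  - intros i; now rewrite Rplus_0_l.
  - intros t Ht i; destruct (H (t + s) ltac:(lra) i) as [Hd Hc]; split; intros eps Heps.
    + destruct (Hd eps Heps) as [x [Hx K]]; exists x; split; [auto|]. intros h Hh1 Hh2 Hh3.
      replace (t + h + s) with (t + s + h) by ring. apply K; auto; lra.
    + destruct (Hc eps Heps) as [x [Hx K]]; exists x; split; [auto|]. intros r Hr1 Hr2.
      apply K; [lra|]. now replace (r + s - (t + s)) with (r - t) by ring.
Qed.

(** * Existence of global solutions by truncation *)

Definition clip (r x : R) : R := Rmax (- r) (Rmin r x).

Lemma clip_bounds r x : 0 < r -> Rabs (clip r x) <= r.
Proof.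
  intros Hr; apply Rabs_le; unfold clip, Rmax, Rmin; repeat destruct Rle_dec; lra.
Qed.

Lemma clip_lipschitz r x y c : Rabs (x - y) <= c -> Rabs (clip r x - clip r y) <= c.
Proof.
  intros H; eapply Rle_trans; [|exact H]; clear H.
  unfold clip, Rmax, Rmin; repeat destruct Rle_dec; unfold Rabs; repeat destruct Rcase_abs; lra.
Qed.

Lemma clip_monotone r x y : x <= y -> clip r x <= clip r y.
Proof. intros; unfold clip, Rmax, Rmin; repeat destruct Rle_dec; lra. Qed.

Lemma clip_id r x : Rabs x <= r -> clip r x = x.
Proof.
  intros H; apply Rabs_le_inv in H; unfold clip, Rmax, Rmin; repeat destruct Rle_dec; lra.
Qed.

Lemma is_derive_deriv_within (g : R -> R) t D : is_derive g t D -> deriv_within_nonneg g t D.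
Proof.
  intros H; apply is_derive_Reals in H; intros eps Heps.
  destruct (H eps Heps) as [delta K]; exists delta; split; [apply delta|]. intros; now apply K.
Qed.

(** [Q] is replaced by the bounded Lipschitz map [Q o clip]; by the maximum principle the solution
    never leaves the ball, where both maps agree. *)
Lemma classical_solution_exists d (Q : Vec d -> Vec d) r : cond_ii Q -> 0 < r ->
  exists M, 0 < M /\ forall u0, in_ball r u0 -> exists U, classical_solution Q u0 U /\
    forall s t i, 0 <= s -> 0 <= t -> Rabs (U t i - U s i) <= M * Rabs (t - s).
Proof.
  intros HQ Hr; pose proof (cond_ii_dispersive HQ) as HD.
  destruct (convex_map_bounded_on_ball (proj1 HQ) Hr) as [M [HM Hbd]].
  destruct (convex_map_locally_lipschitz (proj1 HQ) Hr) as [L [HL Hlip]].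
  exists M; split; [auto|]. intros u0 Hu0.
  pose (F := fun u : Vec d => Q (fun j => clip r (u j))).
  assert (Hclip : forall u : Vec d, in_ball r (fun j => clip r (u j))).
  { intros u j; now apply clip_bounds. }
  destruct (@picard_solution d F M L u0 HM HL) as [U [U0 [LU DU]]].
  - intros u i; apply Hbd, Hclip.
  - intros u v c Hc Huv i; apply Hlip; auto. intros j; now apply clip_lipschitz.
  - assert (CU : forall t i, 0 <= t -> cont_within_nonneg (fun s => U s i) t).
    { intros t i Ht; eapply deriv_within_continuous, is_derive_deriv_within, DU, Ht. }
    assert (GU : forall t i, 0 <= t -> right_growth_le (fun s => U s i) t (F (U t) i) /\
      right_growth_ge (fun s => U s i) t (F (U t) i)).
    { intros t i Ht; apply deriv_within_growth; [auto|]. apply is_derive_deriv_within, DU, Ht. }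
    assert (Hup : forall t i, 0 <= t -> U t i <= r).
    { apply (@comparison_general d U (fun _ _ => r) (fun t => F (U t)) (fun _ _ => 0)); auto.
      (* Clipping is monotone, so a maximal index stays maximal and the positive maximum principle
         applies to the clipped vector. *)
      - intros t i _ Hj; apply HQ; intros j; apply clip_monotone; specialize (Hj j); lra.
      - intros; apply cont_within_const.
      - intros; apply GU; auto.
      - intros; apply right_growth_const.
      - intros i; rewrite U0; specialize (Hu0 i); apply Rabs_le_inv in Hu0; lra. }
    assert (Hlo : forall t i, 0 <= t -> - r <= U t i).
    { apply (@comparison_general d (fun _ _ => - r) U (fun _ _ => 0) (fun t => F (U t))); auto.
      (* Here [U t] is minimal at [i]; writing 0 as the value of [Q] at the zero vector turns the
         claim into dispersivity. *)
      - intros t i _ Hj. rewrite <- (proj2 (proj2 HQ) 0 i). apply HD. unfold cst; intros j.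
        specialize (Hj j). assert (clip r (U t i) <= clip r (U t j)); [|lra].
        apply clip_monotone; lra.
      - intros; apply cont_within_const.
      - intros; apply right_growth_const.
      - intros; apply GU; auto.
      - intros i; rewrite U0; specialize (Hu0 i); apply Rabs_le_inv in Hu0; lra. }
    assert (HU : forall t, 0 <= t -> in_ball r (U t)).
    { intros t Ht i; apply Rabs_le; split; auto. }
    assert (HF : forall t, 0 <= t -> F (U t) = Q (U t)).
    { intros t Ht; unfold F; f_equal; apply functional_extensionality; intros j.
      apply clip_id, HU; auto. }
    exists U; split; [|intros; now apply LU].
    split; [auto|]. intros t Ht i; split.
    + rewrite <- HF by auto. apply is_derive_deriv_within; auto.
    + intros eps Heps; exists (eps / (L * M)).
      assert (0 < L * M) by nra.
      split; [apply Rmult_lt_0_compat; [auto|now apply Rinv_0_lt_compat]|].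
      intros s Hs Hst. pose proof (Rabs_pos (s - t)).
      apply Rle_lt_trans with (L * (M * Rabs (s - t))).
      * apply Hlip; auto. nra.
      * apply Rmult_lt_compat_l with (r := L * M) in Hst; [|auto].
        replace (L * M * (eps / (L * M))) with eps in Hst by (field; lra). lra.
Qed.

(** By uniqueness the solution chosen by [epsilon] does not matter at nonnegative times; the
    constant path is a default. *)
Definition flow d (Q : Vec d -> Vec d) (t : R) (u0 : Vec d) : Vec d :=
  epsilon (inhabits (fun _ : R => u0)) (fun u => classical_solution Q u0 u) t.

(** * The flow as a convex Markovian semigroup *)

Section Flow.
Variables (d : nat) (Q : Vec d -> Vec d).
Hypothesis HQ : cond_ii Q.

Lemma flow_solution u0 : classical_solution Q u0 (fun t => flow Q t u0).
Proof.
  unfold flow. apply (epsilon_spec (inhabits (fun _ : R => u0)) (fun u => classical_solution Q u0 u)).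
  destruct (idx_bounded u0) as [r [Hr Hu]].
  destruct (classical_solution_exists HQ Hr) as [M [_ H]].
  destruct (H u0 Hu) as [U [HU _]]; exists U; auto.
Qed.

Lemma flow_unique u0 u : classical_solution Q u0 u -> forall t i, 0 <= t -> u t i = flow Q t u0 i.
Proof.
  intros Hu; apply (classical_solution_unique (cond_ii_dispersive HQ) Hu (flow_solution u0)).
Qed.

Lemma flow_semigroup : is_semigroup (flow Q).
Proof.
  split.
  - intros u i; apply (proj1 (flow_solution u)).
  - intros s t Hs Ht u i.
    apply (flow_unique (classical_solution_shift Ht (flow_solution u))); auto.
Qed.

Lemma flow_markovian : markovian_sg (flow Q).
Proof.
  intros t Ht; split.
  - intros u v Huv i.
    eapply (classical_solution_monotone (cond_ii_dispersive HQ) (flow_solution u) (flow_solution v)); auto.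
  - intros a i; symmetry; apply (@flow_unique (cst a) (fun _ => cst a)); [|auto].
    split; [auto|]. intros s Hs j; split; [|apply cont_within_const].
    rewrite (proj2 (proj2 HQ)). intros eps Heps; exists 1; split; [lra|]. intros h Hh _ _.
    unfold Rminus; rewrite Rplus_opp_r, Ropp_0, Rplus_0_r. unfold Rdiv; rewrite Rmult_0_l, Rabs_R0; auto.
Qed.

(** By convexity of [Q], a convex combination of two solutions is a supersolution. *)
Lemma flow_convex : convex_sg (flow Q).
Proof.
  intros t Ht u v l Hl i; revert t i Ht.
  apply (@comparison_general d (fun t => flow Q t (fun j => l * u j + (1 - l) * v j))
    (fun t i => l * flow Q t u i + (1 - l) * flow Q t v i)
    (fun t => Q (flow Q t (fun j => l * u j + (1 - l) * v j)))
    (fun t i => l * Q (flow Q t u) i + (1 - l) * Q (flow Q t v) i)).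
  - intros t i Ht Hj. eapply Rle_trans; [apply (cond_ii_dispersive HQ); exact Hj|].
    apply (proj1 HQ); auto.
  - intros t i Ht; apply (classical_solution_regular (flow_solution _)); auto.
  - intros t i Ht; apply cont_within_comb; auto;
      apply (classical_solution_regular (flow_solution _)); auto.
  - intros t i Ht; apply (classical_solution_regular (flow_solution _)); auto.
  - intros t i Ht; apply right_growth_ge_comb; auto;
      apply (classical_solution_regular (flow_solution _)); auto.
  - intros i; rewrite !(proj1 flow_semigroup); lra.
Qed.

(** The Lipschitz constant in time depends only on the radius of the ball of initial values. *)
Lemma flow_unif_continuous : unif_continuous_sg (flow Q).
Proof.
  intros r eps Hr Heps; destruct (classical_solution_exists HQ Hr) as [M [HM H]].
  exists (eps / M); split; [apply Rmult_lt_0_compat; [auto|now apply Rinv_0_lt_compat]|].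
  intros h Hh u Hu i; destruct (H u Hu) as [U [HU HL]].
  rewrite <- (flow_unique HU) by lra. rewrite <- (proj1 HU i).
  eapply Rle_trans; [apply HL; lra|]. rewrite Rminus_0_r, Rabs_right by lra.
  replace eps with (M * (eps / M)) by (field; lra). apply Rmult_le_compat_l; lra.
Qed.

Lemma flow_generator : sg_generator (flow Q) Q.
Proof.
  intros u i eps Heps; destruct (flow_solution u) as [H0 H].
  destruct (H 0 (Rle_refl 0) i) as [Hd _]; destruct (Hd eps Heps) as [x [Hx K]].
  exists x; split; [auto|]. intros h Hh.
  specialize (K h ltac:(lra)). rewrite Rabs_right in K by lra.
  specialize (K ltac:(lra) ltac:(lra)). rewrite Rplus_0_l, H0 in K.
  replace (flow Q 0 u) with u in K by (apply functional_extensionality; intros; auto).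
  auto.
Qed.

End Flow.

Lemma cond_ii_iv d (Q : Vec d -> Vec d) : cond_ii Q -> cond_iv Q.
Proof.
  intros HQ; exists (flow Q).
  split; [|split; [|split; [|split]]].
  - now apply flow_semigroup.
  - now apply flow_unif_continuous.
  - now apply flow_convex.
  - now apply flow_markovian.
  - now apply flow_generator.
Qed.

(** * Convex Markovian semigroups and their generators *)

Lemma convex_kernel_translation d (E : Vec d -> Vec d) : kernel E -> convex_map E ->
  forall u c i, E (fun j => u j + c) i <= E u i + c.
Proof.
  intros [_ Hc] HE u c i.
  destruct (convex_subgradient (subspace_full (Idx d)) (fun j => u j + c)
    (convex_map_component i HE) Logic.I) as [l [Hl Hle]].
  set (e := @cst d 1).
  (* Along constants [E] is the identity, and an affine minorant of the identity of the line has
     slope 1. With this the subgradient inequality at [u + c], evaluated at [u], is the claim. *)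
  assert (H1 : l e = 1).
  { assert (H : forall a, a * l e - l (fun j => u j + c) <= a - E (fun j => u j + c) i).
    { intros a; pose proof (Hle (fcomb a e 0 e) Logic.I) as H.
      rewrite Hl in H by auto. rewrite Rmult_0_l, Rplus_0_r in H.
      replace (fcomb a e 0 e) with (@cst d a) in H by (fcomb_eq; unfold e, cst; ring).
      rewrite Hc in H; auto. }
    pose (K := Rabs (l (fun j => u j + c) - E (fun j => u j + c) i) + 1).
    pose proof (Rle_abs (l (fun j => u j + c) - E (fun j => u j + c) i)).
    destruct (Req_dec (l e) 1) as [|Hn]; [auto|exfalso].
    specialize (H (K / (l e - 1))).
    replace (K / (l e - 1) * l e) with (K + K / (l e - 1)) in H by (field; lra).
    unfold K in *; lra. }
  pose proof (Hle u Logic.I) as H.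
  replace (fun j => u j + c) with (fcomb 1 u c e) in H at 1 by (fcomb_eq; unfold e, cst; ring).
  rewrite Hl, H1 in H by auto. lra.
Qed.

Lemma convex_kernel_nonexpansive d (E : Vec d -> Vec d) : kernel E -> convex_map E ->
  forall u v c, (forall j, Rabs (u j - v j) <= c) -> forall i, Rabs (E u i - E v i) <= c.
Proof.
  intros HK HE.
  assert (K : forall u v c, (forall j, Rabs (u j - v j) <= c) -> forall i, E u i - E v i <= c).
  { intros u v c H i. pose proof (convex_kernel_translation HK HE v c i).
    assert (E u i <= E (fun j => v j + c) i); [|lra].
    apply HK; intros j; specialize (H j); apply Rabs_le_inv in H; lra. }
  intros u v c H i; apply Rabs_le; split; [|now apply K].
  specialize (K v u c); cut (E v i - E u i <= c); [lra|].
  apply K; intros j; rewrite Rabs_minus_sym; auto.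
Qed.

Section ConvexMarkovianSemigroup.
Variables (d : nat) (Q : Vec d -> Vec d) (S : R -> Vec d -> Vec d).
Hypothesis HS : is_semigroup S.
Hypothesis HC : convex_sg S.
Hypothesis HM : markovian_sg S.
Hypothesis HG : sg_generator S Q.

Lemma generator_cond_ii : cond_ii Q.
Proof.
  (* Each property holds for difference quotients and passes to the limit; convexity involves three
     vectors, which need a common step [h]. *)
  assert (Happrox : forall (u v w : Vec d) i eps, 0 < eps -> exists h, 0 < h /\
    Rabs ((S h u i - u i) / h - Q u i) < eps /\ Rabs ((S h v i - v i) / h - Q v i) < eps /\
    Rabs ((S h w i - w i) / h - Q w i) < eps).
  { intros u v w i eps Heps.
    destruct (HG u i Heps) as [x [Hx Kx]], (HG v i Heps) as [y [Hy Ky]], (HG w i Heps) as [z [Hz Kz]].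
    exists (Rmin x (Rmin y z) / 2).
    assert (0 < Rmin x (Rmin y z)) by (repeat apply Rmin_pos; auto).
    pose proof (Rmin_l x (Rmin y z)); pose proof (Rmin_r x (Rmin y z)).
    pose proof (Rmin_l y z); pose proof (Rmin_r y z).
    repeat split; [lra|apply Kx|apply Ky|apply Kz]; lra. }
  split; [|split].
  - intros u v l Hl i; apply Rle_plus_epsilon; intros eps Heps.
    set (w := fun j => l * u j + (1 - l) * v j).
    destruct (Happrox u v w i (eps / 2) ltac:(lra)) as [h [Hh [H1 [H2 H3]]]].
    apply Rabs_def2 in H1; apply Rabs_def2 in H2; apply Rabs_def2 in H3.
    assert ((S h w i - w i) / h <= l * ((S h u i - u i) / h) + (1 - l) * ((S h v i - v i) / h)).
    { pose proof (HC (Rlt_le _ _ Hh) u v Hl i) as H. fold w in H.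
      replace (l * ((S h u i - u i) / h) + (1 - l) * ((S h v i - v i) / h)) with
        ((l * S h u i + (1 - l) * S h v i - w i) / h) by (unfold w; field; lra).
      apply Rmult_le_compat_r; [left; now apply Rinv_0_lt_compat|lra]. }
    nra.
  - intros u i Hu; apply Rle_plus_epsilon; intros eps Heps.
    destruct (Happrox u u u i eps Heps) as [h [Hh [H1 _]]]. apply Rabs_def2 in H1.
    assert (S h u i <= u i).
    { destruct (HM (Rlt_le _ _ Hh)) as [Hm Hc]. rewrite <- (Hc (u i) i); apply Hm; auto. }
    assert ((S h u i - u i) / h <= 0); [|lra].
    pose proof (Rinv_0_lt_compat h Hh). unfold Rdiv; nra.
  - intros a i; apply cond_eq; intros eps Heps.
    destruct (Happrox (cst a) (cst a) (cst a) i eps Heps) as [h [Hh [H1 _]]].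
    rewrite (proj2 (HM (Rlt_le _ _ Hh))) in H1. unfold cst at 1 in H1.
    rewrite Rminus_0_r. unfold Rminus at 2 in H1. rewrite Rplus_opp_r in H1.
    unfold Rdiv in H1. rewrite Rmult_0_l, Rminus_0_l, Rabs_Ropp in H1; auto.
Qed.

Lemma semigroup_small_time (u : Vec d) eps : 0 < eps ->
  exists delta, 0 < delta /\ forall h, 0 <= h < delta -> forall i, Rabs (S h u i - u i) <= eps.
Proof.
  intros Heps.
  destruct (@idx_common_delta d (fun x i => forall h, 0 <= h < x -> Rabs (S h u i - u i) <= eps))
    as [x [Hx K]].
  - intros i x y Hxy H h Hh; apply H; lra.
  - intros i; destruct (HG u i Rlt_0_1) as [x [Hx K]].
    pose (B := Rabs (Q u i) + 1).
    assert (HB : 0 < B) by (unfold B; pose proof (Rabs_pos (Q u i)); lra).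
    exists (Rmin x (eps / B)).
    split; [apply Rmin_pos; [auto|apply Rmult_lt_0_compat; [auto|now apply Rinv_0_lt_compat]]|].
    intros h [[Hh|<-] Hh'].
    2:{ rewrite (proj1 HS). unfold Rminus; rewrite Rplus_opp_r, Rabs_R0; lra. }
    pose proof (Rmin_l x (eps / B)); pose proof (Rmin_r x (eps / B)).
    specialize (K h ltac:(lra)).
    assert (Rabs ((S h u i - u i) / h) <= B).
    { replace ((S h u i - u i) / h) with ((S h u i - u i) / h - Q u i + Q u i) by ring.
      eapply Rle_trans; [apply Rabs_triang|]. unfold B; lra. }
    replace (S h u i - u i) with ((S h u i - u i) / h * h) by (field; lra).
    rewrite Rabs_mult, (Rabs_right h) by lra.
    replace eps with (B * (eps / B)) by (field; lra).
    apply Rmult_le_compat; auto using Rabs_pos; lra.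
  - exists x; split; auto.
Qed.

(** Since [S (s + h) u = S s (S h u)], nonexpansiveness of [S s] transports the modulus at time 0 to
    every [s]; its uniformity in [s] also gives left continuity. *)
Lemma semigroup_orbit_continuous (u : Vec d) t i : 0 <= t ->
  cont_within_nonneg (fun s => S s u i) t.
Proof.
  intros Ht eps Heps.
  destruct (semigroup_small_time u (eps := eps / 2) ltac:(lra)) as [delta [Hd K]].
  assert (H : forall s h, 0 <= s -> 0 <= h < delta -> Rabs (S (s + h) u i - S s u i) <= eps / 2).
  { intros s h Hs Hh. rewrite (proj2 HS) by lra.
    apply (convex_kernel_nonexpansive (HM Hs) (HC Hs)). apply K; auto. }
  exists delta; split; [auto|]. intros s Hs Hst. apply Rabs_def2 in Hst.
  apply Rle_lt_trans with (eps / 2); [|lra].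
  destruct (Rle_dec t s) as [Hts|Hts].
  - replace s with (t + (s - t)) by ring. apply H; lra.
  - rewrite Rabs_minus_sym. replace t with (s + (t - s)) at 1 by ring. apply H; lra.
Qed.

(** Here the step splits in the other order, [S h (S t u)], so that the generator acts at the point
    [S t u]. *)
Lemma semigroup_orbit_growth (u : Vec d) t i : 0 <= t ->
  right_growth_le (fun s => S s u i) t (Q (S t u) i) /\
  right_growth_ge (fun s => S s u i) t (Q (S t u) i).
Proof.
  intros Ht.
  assert (K : forall eps, 0 < eps -> exists delta, 0 < delta /\ forall h, 0 < h < delta ->
    (Q (S t u) i - eps) * h <= S (t + h) u i - S t u i <= (Q (S t u) i + eps) * h).
  { intros eps Heps; destruct (HG (S t u) i Heps) as [x [Hx K]].
    exists x; split; [auto|]. intros h Hh; specialize (K h Hh).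
    rewrite Rplus_comm, (proj2 HS) by lra. apply Rabs_def2 in K.
    replace (S h (S t u) i - S t u i) with ((S h (S t u) i - S t u i) / h * h) by (field; lra).
    split; apply Rmult_le_compat_r; lra. }
  split; intros eps Heps; destruct (K eps Heps) as [delta [Hd Hdd]]; exists delta;
    split; auto; intros h Hh; apply Hdd; auto.
Qed.

Lemma semigroup_eq_flow (u : Vec d) t i : 0 <= t -> S t u i = flow Q t u i.
Proof.
  pose proof generator_cond_ii as HQ. revert t i.
  pose proof (classical_solution_regular (flow_solution HQ u)) as Hreg.
  assert (H0 : forall i, S 0 u i = flow Q 0 u i).
  { intros i; rewrite (proj1 HS), (proj1 (flow_semigroup HQ)); auto. }
  assert (H1 : forall t i, 0 <= t -> S t u i <= flow Q t u i).
  { apply (@comparison_principle d Q (fun t => S t u) (fun t => flow Q t u) (cond_ii_dispersive HQ)).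
    - intros; now apply semigroup_orbit_continuous.
    - intros; now apply Hreg.
    - intros; now apply semigroup_orbit_growth.
    - intros; now apply Hreg.
    - intros; rewrite H0; lra. }
  assert (H2 : forall t i, 0 <= t -> flow Q t u i <= S t u i).
  { apply (@comparison_principle d Q (fun t => flow Q t u) (fun t => S t u) (cond_ii_dispersive HQ)).
    - intros; now apply Hreg.
    - intros; now apply semigroup_orbit_continuous.
    - intros; now apply Hreg.
    - intros; now apply semigroup_orbit_growth.
    - intros; rewrite H0; lra. }
  intros t i Ht; apply Rle_antisym; auto.
Qed.

End ConvexMarkovianSemigroup.

(** * The semigroup envelope *)

Lemma mpow_bound d (q : Mat d) : exists B, 0 < B /\ forall k i j, Rabs (mpow q k i j) <= B ^ k.
Proof.
  assert (Hb : exists b, 0 < b /\ forall i j, Rabs (q i j) <= b).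
  { destruct (@idx_common_delta d (fun x i => forall j, Rabs (q i j) <= / x)) as [x [Hx H]].
    - intros i x y Hxy H j; eapply Rle_trans; [apply H|]; apply Rinv_le_contravar; lra.
    - intros i; destruct (idx_bounded (q i)) as [r [Hr H]].
      exists (/ r); split; [now apply Rinv_0_lt_compat|]. now rewrite Rinv_inv.
    - exists (/ x); split; [now apply Rinv_0_lt_compat|auto]. }
  destruct Hb as [b [Hb Hqb]].
  pose proof (pos_INR d).
  exists (b * INR d + 1); split; [nra|].
  induction k as [|k IH]; intros i j.
  - unfold mpow, mid; simpl. destruct (idx_eqb i j); [rewrite Rabs_R1|rewrite Rabs_R0]; lra.
  - change (mpow q (S k) i j) with (vsum (fun l => q i l * mpow q k l j)).
    eapply Rle_trans; [apply vsum_abs|].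
    apply Rle_trans with (vsum (fun _ : Idx d => (b * (b * INR d + 1) ^ k) * 1)).
    + apply vsum_le; intros l; rewrite Rabs_mult, Rmult_1_r.
      apply Rmult_le_compat; auto using Rabs_pos.
    + rewrite vsum_scal, vsum_one. simpl.
      assert (0 < (b * INR d + 1) ^ k) by (apply pow_lt; nra). nra.
Qed.

Definition mexp_coef d (q : Mat d) i j (k : nat) : R := mpow q k i j / INR (Factorial.fact k).

Lemma pow_div_fact_le_exp y n : 0 <= y -> y ^ n / INR (Factorial.fact n) <= exp y.
Proof.
  intros Hy; eapply Rle_trans; [|apply (exp_ge_taylor y n Hy)].
  destruct n as [|n]; [simpl; lra|].
  rewrite tech5. assert (0 <= sum_f_R0 (fun k => y ^ k / INR (Factorial.fact k)) n); [|lra].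
  apply cond_pos_sum; intros k. apply Rmult_le_pos; [now apply pow_le|].
  left; apply Rinv_0_lt_compat, INR_fact_lt_0.
Qed.

(** The powers of [q] grow geometrically, so the terms at radius [|x| + 1] are bounded by a value of
    [exp]. *)
Lemma mexp_coef_radius d (q : Mat d) i j x : Rbar_lt (Rabs x) (CV_radius (mexp_coef q i j)).
Proof.
  destruct (mpow_bound q) as [B [HB Hq]].
  apply Rbar_lt_le_trans with (Rabs x + 1); [simpl; lra|].
  apply (CV_radius_bounded (mexp_coef q i j)).
  exists (exp (B * (Rabs x + 1))); intros n.
  pose proof (Rabs_pos x).
  eapply Rle_trans; [|apply (@pow_div_fact_le_exp _ n); nra].
  unfold mexp_coef. rewrite Rabs_mult. rewrite Rpow_mult_distr.
  rewrite (Rabs_right ((Rabs x + 1) ^ n)) by (apply Rle_ge, pow_le; lra).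
  unfold Rdiv; rewrite Rabs_mult, (Rabs_right (/ _)).
  2:{ apply Rle_ge; left; apply Rinv_0_lt_compat, INR_fact_lt_0. }
  rewrite Rmult_assoc, (Rmult_comm (/ _)), <- Rmult_assoc.
  apply Rmult_le_compat_r; [left; apply Rinv_0_lt_compat, INR_fact_lt_0|].
  apply Rmult_le_compat_r; [apply pow_le; lra|auto].
Qed.

(** Turns the limit chosen by [epsilon] into a power series, which can be differentiated
    termwise. *)
Lemma mexp_PSeries d (q : Mat d) t i j : mexp q t i j = PSeries (mexp_coef q i j) t.
Proof.
  assert (H : infinite_sum (fun k => t ^ k / INR (Factorial.fact k) * mpow q k i j)
    (PSeries (mexp_coef q i j) t)).
  { apply is_series_Reals. apply is_series_ext with (fun k => scal (pow_n t k) (mexp_coef q i j k)).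
    - intros k; rewrite pow_n_pow; unfold scal; simpl; unfold mult, mexp_coef; simpl. field.
      apply INR_fact_neq_0.
    - apply (PSeries_correct (mexp_coef q i j) t). apply CV_radius_inside, mexp_coef_radius. }
  unfold mexp. eapply uniqueness_sum; [|exact H].
  apply (epsilon_spec (inhabits 0) (fun l => infinite_sum _ l)). eexists; exact H.
Qed.

Lemma mexp_0 d (q : Mat d) i j : mexp q 0 i j = mid i j.
Proof. rewrite mexp_PSeries, PSeries_0; unfold mexp_coef; simpl. field. Qed.

Lemma is_derive_nsum n (h dh : nat -> R -> R) t : (forall k, is_derive (h k) t (dh k t)) ->
  is_derive (fun s => nsum n (fun k => h k s)) t (nsum n (fun k => dh k t)).
Proof.
  intros H; induction n as [|n IH]; simpl.
  - apply (@is_derive_const R_AbsRing R_NormedModule).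
  - apply (@is_derive_plus R_AbsRing R_NormedModule); auto.
Qed.

Lemma is_derive_vsum d (h : Idx d -> R -> R) (dh : Vec d) t :
  (forall j, is_derive (h j) t (dh j)) ->
  is_derive (fun s => vsum (fun j => h j s)) t (vsum dh).
Proof.
  intros H; rewrite vsum_ext_nat.
  apply (is_derive_nsum d (fun k s => ext_nat (fun j => h j s) k) (fun k _ => ext_nat dh k)).
  intros k; destruct (Nat.ltb k d) eqn:E.
  - apply is_derive_ext with (h (exist _ k E)).
    + intros s; now rewrite (ext_nat_idx _ _ E).
    + rewrite (ext_nat_idx _ _ E); auto.
  - assert (Z : forall g : Idx d -> R, ext_nat g k = 0).
    { intros g; unfold ext_nat. generalize (eq_refl (Nat.ltb k d)).
      generalize (Nat.ltb k d) at 2 3. intros b; destruct b; [intros; congruence|auto]. }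
    rewrite Z. apply is_derive_ext with (fun _ => 0); [intros; now rewrite Z|].
    apply (@is_derive_const R_AbsRing R_NormedModule).
Qed.

Lemma is_pseries_nsum n (a : nat -> nat -> R) (c : nat -> R) x :
  (forall k, ex_pseries (a k) x) ->
  is_pseries (fun m => nsum n (fun k => c k * a k m)) x (nsum n (fun k => c k * PSeries (a k) x)).
Proof.
  intros H; induction n as [|n IH]; simpl.
  - unfold is_pseries. apply is_series_ext with (fun _ => 0).
    + intros k; symmetry; apply (@scal_zero_r R_AbsRing R_NormedModule).
    + apply is_series_Reals. intros eps Heps; exists O; intros m _.
      rewrite sum_eq_R0 by auto. unfold R_dist; rewrite Rminus_0_r, Rabs_R0; auto.
  - apply (is_pseries_plus (V := R_NormedModule)); [exact IH|].
    apply (is_pseries_scal (V := R_NormedModule) (c n)).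
    + apply Rmult_comm.
    + apply PSeries_correct; auto.
Qed.

Lemma is_derive_mexp d (q : Mat d) t i j :
  is_derive (fun s => mexp q s i j) t (vsum (fun l => q i l * mexp q t l j)).
Proof.
  apply is_derive_ext with (PSeries (mexp_coef q i j)); [intros; symmetry; apply mexp_PSeries|].
  replace (vsum (fun l => q i l * mexp q t l j)) with (PSeries (PS_derive (mexp_coef q i j)) t);
    [apply is_derive_PSeries, mexp_coef_radius|].
  apply is_pseries_unique.
  rewrite vsum_ext_nat.
  pose (c := ext_nat (q i)).
  pose (a := fun k m => ext_nat (fun l => mexp_coef q l j m) k).
  assert (Ha : forall k x, ex_pseries (a k) x).
  { intros k x; destruct (Nat.ltb k d) eqn:E.
    - apply ex_series_ext with (fun m => scal (pow_n x m) (mexp_coef q (exist _ k E) j m)).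
      + intros m; unfold a; now rewrite (ext_nat_idx _ _ E).
      + apply CV_radius_inside, mexp_coef_radius.
    - exists 0. apply is_series_ext with (fun _ => 0).
      + intros m; unfold a, ext_nat. generalize (eq_refl (Nat.ltb k d)).
        generalize (Nat.ltb k d) at 2 3; intros b; destruct b; [intros; congruence|].
        intros _; symmetry; apply (@scal_zero_r R_AbsRing R_NormedModule).
      + apply is_series_Reals. intros eps Heps; exists O; intros m _.
        rewrite sum_eq_R0 by auto. unfold R_dist; rewrite Rminus_0_r, Rabs_R0; auto. }
  pose proof (@is_pseries_nsum d a c t (fun k => Ha k t)) as H.
  replace (nsum d (ext_nat (fun l => q i l * mexp q t l j))) with
    (nsum d (fun k => c k * PSeries (a k) t)).
  - apply is_series_ext with (2 := H).
    intros m; f_equal. unfold PS_derive, mexp_coef.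
    change (mpow q (S m) i j) with (vsum (fun l => q i l * mpow q m l j)).
    transitivity (vsum (fun l => q i l * mexp_coef q l j m)).
    + rewrite vsum_ext_nat; apply nsum_ext; intros k Hk; unfold c, a.
      now rewrite !(ext_nat_idx _ _ (ltb_of_lt Hk)).
    + rewrite fact_simpl, mult_INR. unfold mexp_coef.
      rewrite (@vsum_ext d _ (fun l => / INR (Factorial.fact m) * (q i l * mpow q m l j))).
      * rewrite vsum_scal. field. split; [apply INR_fact_neq_0|apply not_0_INR; auto].
      * intros l; unfold Rdiv; ring.
  - apply nsum_ext; intros k Hk; unfold c. rewrite !(ext_nat_idx _ _ (ltb_of_lt Hk)).
    rewrite mexp_PSeries; f_equal. apply PSeries_ext; intros m; unfold a.
    now rewrite (ext_nat_idx _ _ (ltb_of_lt Hk)).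
Qed.

Lemma is_derive_mexp_vec d (q : Mat d) (w : Vec d) t i :
  is_derive (fun s => mv (mexp q s) w i) t (mv q (mv (mexp q t) w) i).
Proof.
  replace (mv q (mv (mexp q t) w) i) with
    (vsum (fun j => vsum (fun l => q i l * mexp q t l j) * w j)).
  - unfold mv. apply is_derive_vsum; intros j.
    apply is_derive_ext with (fun s => w j * mexp q s i j).
    + intros s; apply Rmult_comm.
    + rewrite Rmult_comm. apply (is_derive_scal (fun s => mexp q s i j) t (w j)).
      apply is_derive_mexp.
  - unfold mv. transitivity (vsum (fun j => vsum (fun l => w j * (q i l * mexp q t l j)))).
    + apply vsum_ext; intros j; rewrite vsum_scal; ring.
    + rewrite vsum_swap; apply vsum_ext; intros l. rewrite <- vsum_scal.
      apply vsum_ext; intros j; ring.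
Qed.

(** * The affine semigroups [S_q] as solutions of [u' = q u + f_q] *)

Definition Sq_path d (q : Mat d) (fq u0 : Vec d) (t : R) : Vec d :=
  fun i => mv (mexp q t) u0 i + RInt (fun s => mv (mexp q s) fq i) 0 t.

Section AffineFlow.
Variables (d : nat) (q : Mat d) (fq : Vec d).
Hypothesis Hq : Qmatrix q.

Lemma mexp_vec_continuous (w : Vec d) i s : continuous (fun s => mv (mexp q s) w i) s.
Proof.
  apply (@ex_derive_continuous R_AbsRing R_NormedModule). eexists; apply is_derive_mexp_vec.
Qed.

Lemma mexp_vec_integrable (w : Vec d) i a b : ex_RInt (fun s => mv (mexp q s) w i) a b.
Proof.
  apply (@ex_RInt_continuous R_CompleteNormedModule). intros; apply mexp_vec_continuous.
Qed.

Lemma Sq_path_value u0 t : Sq_value q fq t u0 (Sq_path q fq u0 t).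
Proof.
  intros i. exists (ex_RInt_Reals_0 _ _ _ (mexp_vec_integrable fq i 0 t)).
  now rewrite <- RInt_Reals.
Qed.

Lemma Sq_value_path u0 t v : Sq_value q fq t u0 v -> forall i, v i = Sq_path q fq u0 t i.
Proof. intros H i; destruct (H i) as [pr ->]; unfold Sq_path; now rewrite RInt_Reals with (pr := pr). Qed.

Lemma Sq_path_0 u0 i : Sq_path q fq u0 0 i = u0 i.
Proof.
  unfold Sq_path; rewrite RInt_point. unfold zero; simpl; rewrite Rplus_0_r. unfold mv.
  rewrite (@vsum_ext d _ (fun j => u0 j * unitv j i)); [apply vsum_unitv|].
  intros j; rewrite mexp_0; unfold mid, unitv. ring.
Qed.

Lemma is_derive_RInt_mexp i t :
  is_derive (fun t => RInt (fun s => mv (mexp q s) fq i) 0 t) t (mv (mexp q t) fq i).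
Proof.
  apply (is_derive_RInt (V := R_NormedModule) (fun s => mv (mexp q s) fq i) _ 0).
  - exists (mkposreal 1 Rlt_0_1); intros s _; apply (RInt_correct (V := R_CompleteNormedModule)).
    apply mexp_vec_integrable.
  - apply mexp_vec_continuous.
Qed.

(** Both sides have the same derivative, and they agree at 0. This identity is what makes the
    explicit formula for [S_q] solve the affine equation. *)
Lemma mexp_RInt t i :
  mv (mexp q t) fq i = mv q (fun j => RInt (fun s => mv (mexp q s) fq j) 0 t) i + fq i.
Proof.
  pose (D := fun t => mv (mexp q t) fq i - mv q (fun j => RInt (fun s => mv (mexp q s) fq j) 0 t) i).
  assert (HD : forall s, is_derive D s 0).
  { intros s. replace 0 with (mv q (mv (mexp q s) fq) i - mv q (mv (mexp q s) fq) i) by ring.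
    unfold D.
    apply (@is_derive_minus R_AbsRing R_NormedModule); [apply is_derive_mexp_vec|].
    unfold mv at 1. apply (is_derive_vsum (fun j t => q i j * RInt (fun s => mv (mexp q s) fq j) 0 t)).
    intros j. apply (is_derive_scal (fun t => RInt (fun s => mv (mexp q s) fq j) 0 t) s (q i j)).
    apply is_derive_RInt_mexp. }
  assert (H0 : D 0 = fq i).
  { pose proof (Sq_path_0 fq i) as H. unfold Sq_path in H. rewrite RInt_point in H.
    unfold zero in H; simpl in H. unfold D.
    replace (mv q (fun j => RInt (fun s => mv (mexp q s) fq j) 0 0) i) with 0; [lra|].
    unfold mv. rewrite (@vsum_ext d _ (fun _ => 0)); [now rewrite vsum_0|].
    intros j; rewrite RInt_point; unfold zero; simpl; ring. }
  assert (Heq : D t = D 0).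
  { destruct (MVT_gen D 0 t (fun _ => 0)) as [c [_ Hc]].
    - intros x _; apply HD.
    - intros x _; apply continuity_pt_filterlim. apply (@ex_derive_continuous R_AbsRing R_NormedModule).
      eexists; apply HD.
    - lra. }
  unfold D in *; lra.
Qed.

Lemma Sq_path_derive u0 t i :
  is_derive (fun s => Sq_path q fq u0 s i) t (mv q (Sq_path q fq u0 t) i + fq i).
Proof.
  replace (mv q (Sq_path q fq u0 t) i + fq i) with
    (mv q (mv (mexp q t) u0) i + mv (mexp q t) fq i).
  - apply (@is_derive_plus R_AbsRing R_NormedModule); [apply is_derive_mexp_vec|apply is_derive_RInt_mexp].
  - rewrite mexp_RInt. unfold Sq_path.
    pose proof (mv_lin q 1 1 (mv (mexp q t) u0) (fun j => RInt (fun s => mv (mexp q s) fq j) 0 t) i) as H.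
    rewrite <- Rplus_assoc; f_equal. rewrite !Rmult_1_l in H; rewrite <- H.
    f_equal; apply functional_extensionality; intros; now rewrite !Rmult_1_l.
Qed.

Lemma Sq_path_regular u0 t i : 0 <= t -> cont_within_nonneg (fun s => Sq_path q fq u0 s i) t /\
  right_growth_le (fun s => Sq_path q fq u0 s i) t (mv q (Sq_path q fq u0 t) i + fq i) /\
  right_growth_ge (fun s => Sq_path q fq u0 s i) t (mv q (Sq_path q fq u0 t) i + fq i).
Proof.
  intros Ht; pose proof (is_derive_deriv_within (Sq_path_derive u0 t i)) as H.
  split; [eapply deriv_within_continuous; eauto|now apply deriv_within_growth].
Qed.

(** Constants are in the kernel of [q], so comparison tolerates a constant shift. In the minimality
    proof this controls how an accumulated error passes through [S_q]. *)
Lemma Sq_path_translate_le u v c : (forall i, u i - c <= v i) ->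
  forall t i, 0 <= t -> Sq_path q fq u t i - c <= Sq_path q fq v t i.
Proof.
  intros Huv.
  apply (@comparison_general d (fun t i => Sq_path q fq u t i - c) (Sq_path q fq v)
    (fun t i => mv q (Sq_path q fq u t) i + fq i) (fun t i => mv q (Sq_path q fq v t) i + fq i)).
  - intros t i Ht Hj; apply (Qmatrix_affine_dispersive fq Hq). intros j; specialize (Hj j); lra.
  - intros t i Ht eps Heps. destruct (proj1 (Sq_path_regular u i Ht) eps Heps) as [x [Hx K]].
    exists x; split; [auto|]. intros s Hs Hst; specialize (K s Hs Hst).
    replace (Sq_path q fq u s i - c - (Sq_path q fq u t i - c)) with
      (Sq_path q fq u s i - Sq_path q fq u t i) by ring; auto.
  - intros t i Ht; now apply Sq_path_regular.
  - intros t i Ht eps Heps. destruct (proj1 (proj2 (Sq_path_regular u i Ht)) eps Heps) as [x [Hx K]].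
    exists x; split; [auto|]. intros h Hh; specialize (K h Hh). lra.
  - intros t i Ht; now apply Sq_path_regular.
  - intros i; rewrite !Sq_path_0; auto.
Qed.

End AffineFlow.

(** * Domination and minimality of the flow *)

Section Envelope.
Variables (d : nat) (Q : Vec d -> Vec d) (P : Mat d -> Prop) (f : Mat d -> Vec d).
Hypothesis HR : sup_representation Q P f.

Let HQ : cond_ii Q := sup_representation_cond_ii HR.

(** Since [Q] lies above each [q u + f_q], the flow is a supersolution of every affine equation. *)
Lemma flow_dominates : dominates P f (flow Q).
Proof.
  intros t u0 q v Ht Pq Hv i.
  assert (Hq : Qmatrix q) by (apply (proj1 HR); auto).
  rewrite (Sq_value_path Hv). clear Hv; revert t i Ht.
  apply (@comparison_general d (Sq_path q (f q) u0) (fun t => flow Q t u0)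
    (fun t i => mv q (Sq_path q (f q) u0 t) i + f q i) (fun t => Q (flow Q t u0))).
  - intros t i Ht Hj; apply Rle_trans with (mv q (flow Q t u0) i + f q i).
    + apply (Qmatrix_affine_dispersive (f q) Hq); auto.
    + apply (proj2 (proj2 HR)); exists q; auto.
  - intros; now apply Sq_path_regular.
  - intros; now apply (classical_solution_regular (flow_solution HQ u0)).
  - intros; now apply Sq_path_regular.
  - intros; now apply (classical_solution_regular (flow_solution HQ u0)).
  - intros i; rewrite Sq_path_0, (proj1 (flow_semigroup HQ)); lra.
Qed.

(** A [q] within [eps / 2] of the supremum at [w] gives right derivatives at time 0 that differ by
    less than [eps / 2]; the two growth bounds cost [eps / 4] each. The matrix depends on [i], the
    time step does not. *)
Lemma local_near_optimality (w : Vec d) eps : 0 < eps -> exists delta, 0 < delta /\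
  forall i, exists q, P q /\ forall h, 0 < h < delta ->
    flow Q h w i - eps * h <= Sq_path q (f q) w h i.
Proof.
  intros Heps.
  apply (@idx_common_delta d (fun x i => exists q, P q /\ forall h, 0 < h < x ->
    flow Q h w i - eps * h <= Sq_path q (f q) w h i)).
  - intros i x y Hxy [q [Pq H]]; exists q; split; [auto|]. intros h Hh; apply H; lra.
  - intros i.
    assert (Hq : exists q, P q /\ Q w i - eps / 2 < mv q w i + f q i).
    { apply NNPP; intros Hn. assert (Q w i <= Q w i - eps / 2); [|lra].
      apply (proj2 (proj2 HR)); intros y [q [Pq ->]].
      apply Rnot_lt_le; intros Hlt; apply Hn; exists q; auto. }
    destruct Hq as [q [Pq Hlt]].
    destruct (classical_solution_regular (flow_solution HQ w) i (Rle_refl 0)) as [_ [H1 _]].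
    destruct (Sq_path_regular q (f q) w i (Rle_refl 0)) as [_ [_ H2]].
    destruct (H1 (eps / 4) ltac:(lra)) as [x [Hx Kx]], (H2 (eps / 4) ltac:(lra)) as [y [Hy Ky]].
    replace (Sq_path q (f q) w 0) with w in Ky
      by (apply functional_extensionality; intros; now rewrite Sq_path_0).
    replace (flow Q 0 w) with w in Kx
      by (apply functional_extensionality; intros; now rewrite (proj1 (flow_semigroup HQ))).
    exists (Rmin x y); split; [now apply Rmin_pos|]. exists q; split; [auto|].
    intros h Hh. pose proof (Rmin_l x y); pose proof (Rmin_r x y).
    specialize (Kx h ltac:(lra)); specialize (Ky h ltac:(lra)).
    rewrite !Rplus_0_l in *. nra.
Qed.

(** [T] carries no monotonicity or continuity, so only the dominated maps [S_q] are propagated: on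
    each short step a single nearly optimal [q] per component suffices. *)
Lemma flow_minimal T : is_semigroup T -> dominates P f T ->
  forall t (u0 : Vec d) i, 0 <= t -> flow Q t u0 i <= T t u0 i.
Proof.
  intros HT Hdom t u0 i Ht.
  assert (Hdom' : forall q u v c, P q -> (forall j, u j - c <= v j) ->
    forall h j, 0 <= h -> Sq_path q (f q) u h j - c <= T h v j).
  { intros q u v c Pq Huv h j Hh.
    assert (Hq : Qmatrix q) by (apply (proj1 HR); auto).
    eapply Rle_trans; [apply (Sq_path_translate_le (f q) Hq u v Huv); auto|].
    apply (Hdom h v q); auto. apply Sq_path_value. }
  assert (K : forall eps, 0 < eps -> forall s, 0 <= s -> forall j, flow Q s u0 j - eps * s <= T s u0 j).
  { intros eps Heps.
    apply (@real_induction (fun s => forall j, flow Q s u0 j - eps * s <= T s u0 j)).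
    - intros j; rewrite (proj1 HT), (proj1 (flow_semigroup HQ)); lra.
    - intros s Hs H. destruct (local_near_optimality (flow Q s u0) Heps) as [x [Hx Hx']].
      exists x; split; [auto|]. intros h Hh j.
      destruct (Hx' j) as [q [Pq Hqj]]. specialize (Hqj h Hh).
      rewrite (Rplus_comm s h), (proj2 HT), (proj2 (flow_semigroup HQ)) by lra.
      pose proof (Hdom' q _ _ _ Pq H h j ltac:(lra)). lra.
    (* [T] may be discontinuous, so the bound at [s] is reached from [s - h] by one step of [S_q0];
       that path and the flow each move by less than [eta / 2]. *)
    - intros s Hs H j. apply Rle_plus_epsilon; intros eta Heta.
      destruct (proj1 (proj2 HR)) as [q0 [Pq0 _]].
      destruct (proj1 (Sq_path_regular q0 (f q0) (flow Q s u0) j (Rle_refl 0)) (eta / 2) ltac:(lra))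
        as [x [Hx Kx]].
      destruct (@idx_common_delta d (fun y k => forall r, 0 <= r -> Rabs (r - s) < y ->
        Rabs (flow Q r u0 k - flow Q s u0 k) < eta / 2)) as [y [Hy Ky]].
      { intros k y z Hyz Hz r Hr1 Hr2; apply Hz; lra. }
      { intros k; apply (classical_solution_regular (flow_solution HQ u0)); lra. }
      pose (h := Rmin s (Rmin x y) / 2).
      assert (0 < Rmin s (Rmin x y)) by (repeat apply Rmin_pos; auto).
      pose proof (Rmin_l s (Rmin x y)); pose proof (Rmin_r s (Rmin x y)).
      pose proof (Rmin_l x y); pose proof (Rmin_r x y).
      assert (Hh : 0 < h < s /\ h < x /\ h < y) by (unfold h; lra).
      assert (Hle : forall k, flow Q s u0 k - (eps * (s - h) + eta / 2) <= T (s - h) u0 k).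
      { intros k. pose proof (H (s - h) ltac:(lra) k) as H'.
        assert (Rabs (flow Q (s - h) u0 k - flow Q s u0 k) < eta / 2) as E.
        { apply Ky; [lra|]. replace (s - h - s) with (- h) by ring.
          rewrite Rabs_Ropp, Rabs_right; lra. }
        apply Rabs_def2 in E; lra. }
      pose proof (Hdom' q0 _ _ _ Pq0 Hle h j ltac:(lra)) as H'.
      rewrite <- (proj2 HT) in H' by lra. replace (h + (s - h)) with s in H' by ring.
      specialize (Kx h ltac:(lra)). rewrite Rminus_0_r, Rabs_right in Kx by lra.
      specialize (Kx ltac:(lra)). rewrite Sq_path_0 in Kx. apply Rabs_def2 in Kx.
      nra. }
  apply Rle_plus_epsilon; intros eps Heps.
  specialize (K (eps / (t + 1))).
  assert (0 < eps / (t + 1)) as Hp by (apply Rmult_lt_0_compat; [lra|apply Rinv_0_lt_compat; lra]).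
  specialize (K Hp t Ht i).
  assert (eps / (t + 1) * t <= eps); [|lra].
  apply Rle_trans with (eps / (t + 1) * (t + 1)); [nra|right; field; lra].
Qed.

Lemma flow_envelope : semigroup_envelope P f (flow Q).
Proof.
  split; [now apply flow_semigroup|split; [apply flow_dominates|apply flow_minimal]].
Qed.

End Envelope.

End DifferentialEquation.

(** * Extension of contents to probability measures *)

Definition generated_sigma {Om : Type} (A : (Om -> Prop) -> Prop) (B : Om -> Prop) : Prop :=
  forall F, sigma_algebra F -> (forall C, A C -> F C) -> F B.

Lemma generated_sigma_algebra Om (A : (Om -> Prop) -> Prop) : sigma_algebra (generated_sigma A).
Proof.
  split; [|split].
  - intros F HF _; apply HF.
  - intros B HB F HF HA; apply HF, HB; auto.
  - intros B HB F HF HA; apply HF; intros n; apply HB; auto.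
Qed.

Lemma set_ext Om (A B : Om -> Prop) : (forall w, A w <-> B w) -> A = B.
Proof. intros H; apply functional_extensionality; intros w; now apply propositional_extensionality. Qed.

(** A normalised finitely additive content on an algebra whose decreasing nonempty sequences have a
    common point. [cc_point] supplies the base point of the pointed carrier type. *)
Record compact_content (Om : Type) := {
  cc_point : Om;
  cc_dom : (Om -> Prop) -> Prop;
  cc_mu : (Om -> Prop) -> R;
  cc_full : cc_dom (fun _ => True);
  cc_compl : forall B, cc_dom B -> cc_dom (fun w => ~ B w);
  cc_union : forall B C, cc_dom B -> cc_dom C -> cc_dom (fun w => B w \/ C w);
  cc_pos : forall B, cc_dom B -> 0 <= cc_mu B;
  cc_one : cc_mu (fun _ => True) = 1;
  cc_add : forall B C, cc_dom B -> cc_dom C -> (forall w, B w -> C w -> False) ->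
    cc_mu (fun w => B w \/ C w) = cc_mu B + cc_mu C;
  cc_compact : forall B : nat -> Om -> Prop, (forall n, cc_dom (B n)) ->
    (forall n w, B (S n) w -> B n w) -> (forall n, exists w, B n w) -> exists w, forall n, B n w
}.

Section CompactContent.
Variables (Om : Type) (c : compact_content Om).

Lemma cc_empty : cc_dom c (fun _ => False).
Proof.
  replace (fun _ : Om => False) with (fun w : Om => ~ True); [apply cc_compl, cc_full|].
  apply set_ext; tauto.
Qed.

Lemma cc_mu_empty : cc_mu c (fun _ => False) = 0.
Proof.
  pose proof (cc_add c _ _ cc_empty cc_empty (fun _ H _ => H)) as H; cbv beta in H.
  rewrite (@set_ext Om (fun _ => False \/ False) (fun _ => False)) in H by tauto. lra.
Qed.

Lemma cc_finite_union (F : nat -> Om -> Prop) n : (forall k, cc_dom c (F k)) ->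
  (forall j k, j <> k -> forall w, F j w -> F k w -> False) ->
  cc_dom c (fun w => exists k, (k < n)%nat /\ F k w) /\
  cc_mu c (fun w => exists k, (k < n)%nat /\ F k w) = nsum n (fun k => cc_mu c (F k)).
Proof.
  intros HF Hd; induction n as [|n [IH1 IH2]]; simpl.
  - replace (fun w => exists k, (k < 0)%nat /\ F k w) with (fun _ : Om => False).
    + split; [apply cc_empty|apply cc_mu_empty].
    + apply set_ext; intros w; split; [tauto|intros [k [Hk _]]; lia].
  - replace (fun w => exists k, (k < S n)%nat /\ F k w) with
      (fun w => (exists k, (k < n)%nat /\ F k w) \/ F n w).
    + split; [now apply cc_union|]. rewrite cc_add; auto; [now rewrite IH2|].
      intros w [k [Hk Hkw]] Hnw; apply (Hd k n ltac:(lia) w); auto.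
    + apply set_ext; intros w; split.
      * intros [[k [Hk H]]|H]; [exists k; split; [lia|auto]|exists n; split; [lia|auto]].
      * intros [k [Hk H]]; destruct (PeanoNat.Nat.eq_dec k n) as [->|]; [auto|].
        left; exists k; split; [lia|auto].
Qed.

(** By compactness a disjoint countable union lying in the algebra has only finitely many nonempty terms. *)
Lemma cc_countable_union (F : nat -> Om -> Prop) : (forall k, cc_dom c (F k)) ->
  (forall j k, j <> k -> forall w, F j w -> F k w -> False) ->
  cc_dom c (fun w => exists k, F k w) ->
  exists N, forall n, (N <= n)%nat ->
    nsum n (fun k => cc_mu c (F k)) = cc_mu c (fun w => exists k, F k w).
Proof.
  intros HF Hd HU.
  pose (V := fun n w => exists k, (k < n)%nat /\ F k w).
  destruct (classic (forall n, exists w, (exists k, F k w) /\ ~ V n w)) as [Hne|Hne].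
  - exfalso.
    (* These sets are the union minus its first [n] terms, written with the complements and unions
       available in the algebra. *)
    destruct (cc_compact c (fun n w => ~ ((~ exists k, F k w) \/ V n w))) as [w Hw].
    + intros n; apply cc_compl, cc_union; [now apply cc_compl|]. now apply cc_finite_union.
    + intros n w H H'; apply H; destruct H' as [|[k [Hk Hkw]]]; [auto|right].
      exists k; split; [lia|auto].
    + intros n; destruct (Hne n) as [w [Hw1 Hw2]]; exists w; tauto.
    + apply (Hw O). left; intros [k Hk]. apply (Hw (S k)). right; exists k; split; [lia|auto].
  - apply not_all_ex_not in Hne; destruct Hne as [N HN]; exists N; intros n Hn.
    rewrite <- (proj2 (cc_finite_union F n HF Hd)); f_equal; apply set_ext; intros w; split.
    + intros [k [_ H]]; exists k; auto.
    + intros H; apply NNPP; intros Hnw; apply HN; exists w; split; [auto|].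
      intros [k [Hk Hkw]]; apply Hnw; exists k; split; [lia|auto].
Qed.

End CompactContent.

(** * Countable additivity and the Caratheodory extension *)

Module Extension.
Import all_boot all_order all_algebra all_classical Rstruct.
Import topology normedtype sequences ereal measure.
Import Order.TTheory GRing.Theory Num.Theory numFieldNormedType.Exports.
Local Open Scope classical_set_scope.
Local Open Scope ring_scope.

(** A copy of [Om] indexed by [c], so that the canonical algebra of sets can depend on the
    content. *)
Definition carrier (Om : Type) (c : compact_content Om) : Type := Om.

HB.instance Definition _ Om (c : compact_content Om) := gen_eqMixin (carrier c).
HB.instance Definition _ Om (c : compact_content Om) := gen_choiceMixin (carrier c).
HB.instance Definition _ Om (c : compact_content Om) := isPointed.Build (carrier c) (cc_point c).

Section Carrier.
Variables (Om : Type) (c : compact_content Om).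

Let dom0 : cc_dom c (set0 : set (carrier c)).
Proof. exact: cc_empty. Qed.

Let domU : setU_closed (cc_dom c : set (set (carrier c))).
Proof. by move=> A B; exact: (cc_union c). Qed.

Let domC : setC_closed (cc_dom c : set (set (carrier c))).
Proof. by move=> A; exact: (cc_compl c). Qed.

HB.instance Definition _ := isAlgebraOfSets.Build default_measure_display (carrier c) dom0 domU domC.

(** Off the algebra the value 0 is a default that keeps the function nonnegative. *)
Definition premeasure (A : set (carrier c)) : \bar R :=
  if `[< cc_dom c A >] then (cc_mu c A)%:E else 0%E.

Let premeasureE (A : set (carrier c)) : cc_dom c A -> premeasure A = (cc_mu c A)%:E.
Proof. by move=> mA; rewrite /premeasure asboolT. Qed.

Let premeasure0 : premeasure set0 = 0%E.
Proof. by rewrite premeasureE; [rewrite (cc_mu_empty c)|exact: dom0]. Qed.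

Let premeasure_ge0 A : (0 <= premeasure A)%E.
Proof.
rewrite /premeasure; case: asboolP => // mA.
by rewrite lee_fin; apply/RleP; exact: (cc_pos c).
Qed.

Let premeasure_sum (F : nat -> set (carrier c)) n : (forall i, cc_dom c (F i)) ->
  (\sum_(0 <= i < n) premeasure (F i) = (nsum n (fun k => cc_mu c (F k)))%:E)%E.
Proof.
move=> mF; elim: n => [|n IH]; first by rewrite big_geq.
by rewrite big_nat_recr //= IH premeasureE.
Qed.

Let premeasure_sigma_additive : semi_sigma_additive premeasure.
Proof.
move=> F mF tF mU.
have dF : forall j k : nat, j <> k -> forall w, F j w -> F k w -> False.
  move=> j k jk w Fj Fk; apply: jk.
  by apply: tF => //; exists w.
have UE : \bigcup_n F n = (fun w => exists k, F k w).
  by apply/seteqP; split => w; [move=> [k _ Fk]; exists k|move=> [k Fk]; exists k].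
rewrite UE in mU *.
have [N HN] := cc_countable_union c F mF dF mU.
apply: cvg_near_cst; exists N => // n /= /ssrnat.leP Nn.
by rewrite premeasure_sum // premeasureE // HN.
Qed.

HB.instance Definition _ := isMeasure.Build _ _ _ premeasure
  premeasure0 premeasure_ge0 premeasure_sigma_additive.

Definition premeasure_measure : {measure set (carrier c) -> \bar R} := premeasure.

Lemma premeasure_measureE (A : set (carrier c)) : cc_dom c A ->
  premeasure_measure A = (cc_mu c A)%:E.
Proof. exact: premeasureE. Qed.

End Carrier.

Lemma sum_f_R0_big (u : nat -> R) n : sum_f_R0 u n = \sum_(0 <= i < n.+1) u i.
Proof.
elim: n => [|n IH]; first by rewrite big_nat1.
by rewrite big_nat_recr //= -IH.
Qed.

Lemma prob_measure_of_measure d (T : measurableType d) (m : {measure set T -> \bar R}) :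
  m setT = 1%E -> prob_measure (fun B : T -> Prop => measurable (B : set T)) (fun B => fine (m B)).
Proof.
move=> mT.
have mfin (B : set T) : measurable B -> m B \is a fin_num.
  move=> mB; rewrite ge0_fin_numE //; apply: (@le_lt_trans _ _ (m setT)).
    by apply: le_measure; rewrite ?inE.
  by rewrite mT ltry.
split; last split.
- by move=> A mA; apply/RleP; rewrite fine_ge0.
- by have -> : (fun _ : T => True) = setT by []; rewrite mT.
- move=> A mA dA.
  have UE : (fun w => exists n, A n w) = \bigcup_n A n.
    by apply/seteqP; split => w; [move=> [k Fk]; exists k|move=> [k _ Fk]; exists k].
  have mU : measurable (\bigcup_n A n : set T) by exact: bigcup_measurable.
  have tA : trivIset setT A.
    move=> j k _ _ [w [Aj Ak]]; apply: contrapT => jk; exact: (dA j k jk w).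
  have := @measure_semi_sigma_additive _ _ _ m A mA tA mU.
  rewrite -(fineK (mfin _ mU)) => /fine_cvg /cvgrPdist_lt H.
  rewrite UE => eps /RltP eps0.
  have [N _ HN] := H _ eps0.
  exists N => n Nn.
  rewrite RdistE distrC sum_f_R0_big.
  (* [sum_f_R0] includes the index [n], hence the shift. *)
  have := HN n.+1; rewrite /= => /(_ _)/RltP.
  rewrite sum_fine; last by move=> i _; exact: mfin.
  by apply; apply: leqW; apply/ssrnat.leP.
Qed.

Lemma compact_content_extension Om (c : compact_content Om) :
  exists P, prob_measure (generated_sigma (cc_dom c)) P /\
    forall B, cc_dom c B -> P B = cc_mu c B.
Proof.
pose m := measure_extension (premeasure_measure c).
have mE (B : set (carrier c)) : cc_dom c B -> m B = (cc_mu c B)%:E.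
  by move=> mB; rewrite /m /measure_extension /= measurable_mu_extE // premeasure_measureE.
have mT : m setT = 1%E by rewrite mE ?(cc_one c) //; exact: (cc_full c).
have [P0 [P1 P2]] := @prob_measure_of_measure _ _ m mT.
have gen (B : Om -> Prop) : generated_sigma (cc_dom c) B -> <<s (cc_dom c : set (set (carrier c))) >> B.
  apply; last by move=> C mC; exact: sub_gen_smallest.
  split; last split.
  - by rewrite (_ : (fun _ => True) = setT) //; exact: (@measurableT _ (g_sigma_algebraType (cc_dom c : set (set (carrier c))))).
  - by move=> A; exact: sigma_algebraC.
  - move=> A mA.
    rewrite (_ : (fun w => exists n, A n w) = \bigcup_n (A n : set (carrier c))).
      exact: sigma_algebra_bigcup.
    by apply/seteqP; split => w; [move=> [k Fk]; exists k|move=> [k _ Fk]; exists k].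
exists (fun B => fine (m B)); split; last by move=> B mB; rewrite mE.
split; last split.
- by move=> A /gen; exact: P0.
- exact: P1.
- by move=> A mA; apply: P2 => n; apply: gen.
Qed.

End Extension.

(** * The semigroup of a convex Markov chain *)

Lemma indic_true Om (A : Om -> Prop) w : A w -> indic A w = 1.
Proof. unfold indic; destruct excluded_middle_informative; tauto. Qed.

Lemma indic_false Om (A : Om -> Prop) w : ~ A w -> indic A w = 0.
Proof. unfold indic; destruct excluded_middle_informative; tauto. Qed.

(** * Integration of simple functions *)

Section SigmaAlgebra.
Variables (Om : Type) (F : (Om -> Prop) -> Prop).
Hypothesis HF : sigma_algebra F.

Lemma sigma_compl A : F A -> F (fun w => ~ A w).
Proof. apply HF. Qed.

Lemma sigma_full : F (fun _ => True).
Proof. apply HF. Qed.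

Lemma sigma_empty : F (fun _ => False).
Proof.
  replace (fun _ : Om => False) with (fun w : Om => ~ True); [apply sigma_compl, sigma_full|].
  apply set_ext; tauto.
Qed.

Lemma sigma_union A B : F A -> F B -> F (fun w => A w \/ B w).
Proof.
  intros HA HB.
  replace (fun w => A w \/ B w) with
    (fun w => exists n : nat, match n with O => A w | _ => B w end).
  - apply (proj2 (proj2 HF) (fun n w => match n with O => A w | _ => B w end)).
    intros [|n]; auto.
  - apply set_ext; intros w; split.
    + intros [[|n] H]; auto.
    + intros [H|H]; [exists O|exists 1%nat]; auto.
Qed.

Lemma sigma_inter A B : F A -> F B -> F (fun w => A w /\ B w).
Proof.
  intros HA HB.
  replace (fun w => A w /\ B w) with (fun w => ~ (~ A w \/ ~ B w)).
  - apply sigma_compl, sigma_union; now apply sigma_compl.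
  - apply set_ext; intros w; tauto.
Qed.

Lemma sigma_finite_valued d (X : Om -> Idx d) (S : Idx d -> Prop) :
  (forall j, F (fun w => X w = j)) -> F (fun w => S (X w)).
Proof.
  intros HX; destruct (idx_list d) as [l Hl].
  replace (fun w => S (X w)) with (fun w => exists j, In j l /\ S j /\ X w = j).
  - clear Hl; induction l as [|j l IH].
    + replace (fun w => exists j, In j nil /\ S j /\ X w = j) with (fun _ : Om => False);
        [apply sigma_empty|]. apply set_ext; intros w; split; [tauto|intros [j [[] _]]].
    + replace (fun w => exists k, In k (j :: l) /\ S k /\ X w = k) with
        (fun w => (S j /\ X w = j) \/ exists k, In k l /\ S k /\ X w = k).
      * apply sigma_union; [|auto].
        destruct (classic (S j)) as [Sj|Sj].
        -- replace (fun w => S j /\ X w = j) with (fun w => X w = j); [auto|].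
           apply set_ext; intros w; tauto.
        -- replace (fun w => S j /\ X w = j) with (fun _ : Om => False); [apply sigma_empty|].
           apply set_ext; intros w; tauto.
      * apply set_ext; intros w; split.
        -- intros [[H1 H2]|[k [Hk H]]]; [exists j|exists k]; simpl; auto.
        -- intros [k [[->|Hk] H]]; [now left|right; exists k; auto].
  - apply set_ext; intros w; split.
    + intros [j [_ [H <-]]]; auto.
    + intros H; exists (X w); auto.
Qed.

Variable P : (Om -> Prop) -> R.
Hypothesis HP : prob_measure F P.

(** Additivity on the constant empty sequence makes [p] the sum of infinitely many copies of
    itself. *)
Lemma prob_empty : P (fun _ => False) = 0.
Proof.
  pose proof (proj2 (proj2 HP) (fun _ _ => False) (fun _ => sigma_empty) (fun _ _ _ _ H _ => H)) as H.
  cbv beta in H.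
  rewrite (@set_ext Om (fun _ => exists n : nat, False) (fun _ => False)) in H
    by (intros; split; [intros [_ []]|tauto]).
  set (p := P (fun _ => False)) in *.
  assert (Hp : 0 <= p) by (apply HP, sigma_empty).
  destruct (Req_dec p 0) as [E|E]; [auto|exfalso].
  destruct (H (p / 2) ltac:(lra)) as [N HN].
  specialize (HN (S (S N)) ltac:(lia)). rewrite sum_cte in HN.
  unfold R_dist in HN. apply Rabs_def2 in HN.
  rewrite !S_INR in HN. pose proof (pos_INR N). nra.
Qed.

Lemma prob_additive A B : F A -> F B -> (forall w, A w -> B w -> False) ->
  P (fun w => A w \/ B w) = P A + P B.
Proof.
  intros HA HB Hd.
  pose (C := fun (n : nat) w => match n with O => A w | S O => B w | _ => False end).
  assert (HC : forall n, F (C n)).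
  { intros [|[|n]]; simpl; auto. apply sigma_empty. }
  assert (H := proj2 (proj2 HP) C HC).
  assert (HCd : forall n m, n <> m -> forall w, C n w -> C m w -> False).
  { intros [|[|n]] [|[|m]] Hnm w; simpl; try tauto; intros; eapply Hd; eauto. }
  specialize (H HCd).
  replace (fun w => exists n, C n w) with (fun w => A w \/ B w) in H.
  2:{ apply set_ext; intros w; split.
      - intros [Hw|Hw]; [exists O|exists 1%nat]; auto.
      - intros [[|[|n]] Hw]; simpl in Hw; tauto. }
  eapply uniqueness_sum; [exact H|].
  intros eps Heps; exists 1%nat; intros n Hn.
  assert (E : sum_f_R0 (fun n => P (C n)) n = P A + P B).
  { induction n as [|n IH]; [lia|].
    destruct n as [|n]; [reflexivity|]. rewrite tech5, IH by lia.
    change (C (S (S n))) with (fun _ : Om => False). rewrite prob_empty; ring. }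
  rewrite E. unfold R_dist, Rminus; now rewrite Rplus_opp_r, Rabs_R0.
Qed.

Lemma prob_split A B : F A -> F B ->
  P B = P (fun w => B w /\ A w) + P (fun w => B w /\ ~ A w).
Proof.
  intros HA HB. rewrite <- prob_additive.
  - f_equal; apply set_ext; intros w; tauto.
  - now apply sigma_inter.
  - apply sigma_inter; [auto|now apply sigma_compl].
  - tauto.
Qed.

Definition simple_int_on (B : Om -> Prop) (s : list (R * (Om -> Prop))) : R :=
  fold_right (fun p acc => fst p * P (fun w => B w /\ snd p w) + acc) 0 s.

Lemma simple_int_on_split A B s : F A -> F B -> (forall p, In p s -> F (snd p)) ->
  simple_int_on B s =
  simple_int_on (fun w => B w /\ A w) s + simple_int_on (fun w => B w /\ ~ A w) s.
Proof.
  intros HA HB; induction s as [|p s IH]; simpl; intros Hs; [ring|].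
  rewrite IH by auto. rewrite (@prob_split A (fun w => B w /\ snd p w)).
  - rewrite (@set_ext Om (fun w => (B w /\ snd p w) /\ A w) (fun w => (B w /\ A w) /\ snd p w)) by tauto.
    rewrite (@set_ext Om (fun w => (B w /\ snd p w) /\ ~ A w) (fun w => (B w /\ ~ A w) /\ snd p w)) by tauto.
    ring.
  - auto.
  - apply sigma_inter; auto.
Qed.

(** Splitting [B] along the first set makes its term constant on either part, where it is absorbed
    into [c]. No disjoint normal form of the simple function is formed. *)
Lemma simple_int_on_pos s : (forall p, In p s -> F (snd p)) -> forall c B, F B ->
  (forall w, B w -> 0 <= c + simple_val s w) -> 0 <= c * P B + simple_int_on B s.
Proof.
  induction s as [|[a A] s IH]; simpl; intros Hs c B HB Hpos.
  - rewrite Rplus_0_r. destruct (classic (exists w, B w)) as [[w Hw]|HN].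
    + specialize (Hpos w Hw); rewrite Rplus_0_r in Hpos.
      apply Rmult_le_pos; [auto|now apply HP].
    + replace B with (fun _ : Om => False); [rewrite prob_empty; lra|].
      apply set_ext; intros w; split; [tauto|]. intros Hw; apply HN; exists w; auto.
  - assert (HA : F A) by (apply (Hs (a, A)); auto).
    rewrite (@simple_int_on_split A B s) by auto.
    rewrite (prob_split HA HB).
    assert (H1 : 0 <= (c + a) * P (fun w => B w /\ A w) + simple_int_on (fun w => B w /\ A w) s).
    { apply IH; auto using sigma_inter. intros w [Bw Aw]. specialize (Hpos w Bw).
      rewrite indic_true in Hpos by auto. lra. }
    assert (H2 : 0 <= c * P (fun w => B w /\ ~ A w) + simple_int_on (fun w => B w /\ ~ A w) s).
    { apply IH; auto using sigma_inter, sigma_compl. intros w [Bw Aw]. specialize (Hpos w Bw).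
      rewrite indic_false in Hpos by auto. lra. }
    lra.
Qed.

Lemma simple_val_app (s s' : list (R * (Om -> Prop))) w :
  simple_val (s ++ s') w = simple_val s w + simple_val s' w.
Proof. induction s as [|p s IH]; simpl; [ring|]. rewrite IH; ring. Qed.

(** Positivity of the difference, represented by appending the negated list. *)
Lemma simple_int_le s s' : (forall p, In p s -> F (snd p)) -> (forall p, In p s' -> F (snd p)) ->
  (forall w, simple_val s w <= simple_val s' w) -> simple_int P s <= simple_int P s'.
Proof.
  intros Hs Hs' H.
  pose (neg := map (fun p : R * (Om -> Prop) => (- fst p, snd p)) s).
  assert (Hneg : forall w, simple_val neg w = - simple_val s w).
  { intros w; unfold neg; clear; induction s as [|p s IH]; simpl; [ring|]. rewrite IH; ring. }
  assert (Hon : forall s0, simple_int_on (fun _ => True) s0 = simple_int P s0).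
  { induction s0 as [|p s0 IH]; simpl; [reflexivity|]. rewrite IH.
    rewrite (@set_ext Om (fun w => True /\ snd p w) (snd p)) by tauto. reflexivity. }
  assert (Happ : forall s1 s2, simple_int P (s1 ++ s2) = simple_int P s1 + simple_int P s2).
  { induction s1 as [|p s1 IH]; simpl; intros s2; [ring|]. rewrite IH; ring. }
  assert (Hnegi : simple_int P neg = - simple_int P s).
  { unfold neg; clear; induction s as [|p s IH]; simpl; [ring|]. rewrite IH; ring. }
  assert (K : 0 <= 0 * P (fun _ => True) + simple_int_on (fun _ => True) (s' ++ neg)).
  { apply simple_int_on_pos.
    - intros p Hp; apply in_app_or in Hp; destruct Hp as [Hp|Hp]; [auto|].
      unfold neg in Hp; apply in_map_iff in Hp; destruct Hp as [p0 [<- Hp0]]; simpl; auto.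
    - apply sigma_full.
    - intros w _. rewrite simple_val_app, Hneg. specialize (H w); lra. }
  rewrite Hon, Happ, Hnegi in K. lra.
Qed.

Lemma is_expectation_simple s X : (forall p, In p s -> F (snd p)) ->
  (forall w, simple_val s w = X w) -> is_expectation F P X (simple_int P s).
Proof.
  intros Hs HX; split.
  - intros y [s' [Hs' [Hle ->]]]. apply simple_int_le; auto. intros w; rewrite HX; auto.
  - intros b Hb; apply Hb. exists s; split; [auto|split; [|auto]]. intros w; rewrite HX; lra.
Qed.

Lemma is_expectation_unique X r r' : is_expectation F P X r -> is_expectation F P X r' -> r = r'.
Proof. apply is_lub_u. Qed.

Lemma is_expectation_exists X M : (forall w, Rabs (X w) <= M) ->
  exists r, is_expectation F P X r /\ - M <= r <= M.
Proof.
  intros HX.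
  pose (const := fun a : R => (a, fun _ : Om => True) :: nil).
  assert (Hc : forall a p, In p (const a) -> F (snd p)).
  { intros a p [<-|[]]; apply sigma_full. }
  assert (Hv : forall a w, simple_val (const a) w = a).
  { intros a w; simpl; rewrite indic_true by auto; ring. }
  assert (Hi : forall a, simple_int P (const a) = a).
  { intros a; simpl; rewrite (proj1 (proj2 HP)); ring. }
  assert (Hub : is_upper_bound (fun y => exists s : list (R * (Om -> Prop)),
     (forall p, In p s -> F (snd p)) /\ (forall w, simple_val s w <= X w) /\ y = simple_int P s) M).
  { intros y [s [Hs [Hle ->]]]. rewrite <- (Hi M).
    apply (@simple_int_le s (const M)); [auto|apply Hc|].
    intros w; rewrite (Hv M w). eapply Rle_trans; [apply Hle|].
    specialize (HX w); apply Rabs_le_inv in HX; lra. }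
  assert (Hne : exists s : list (R * (Om -> Prop)),
    (forall p, In p s -> F (snd p)) /\ (forall w, simple_val s w <= X w) /\ - M = simple_int P s).
  { exists (const (- M)); split; [apply Hc|split; [|now rewrite Hi]].
    intros w; rewrite (Hv (- M) w); specialize (HX w); apply Rabs_le_inv in HX; lra. }
  destruct (completeness _ (ex_intro _ M Hub) (ex_intro _ _ Hne)) as [r Hr].
  exists r; split; [exact Hr|]. split; [now apply Hr|]. apply Hr; exact Hub.
Qed.

End SigmaAlgebra.

(** Unlike in [idx_list], the enumeration is free of repetitions, as required for representing a
    finite-valued function by a simple one. *)
Lemma idx_enum (d : nat) : exists l : list (Idx d), NoDup l /\ (forall i, In i l) /\
  forall g, vsum g = fold_right (fun j acc => g j + acc) 0 l.
Proof.
  assert (K : forall n, (n <= d)%nat -> exists l : list (Idx d), NoDup l /\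
    (forall i, In i l <-> (proj1_sig i < n)%nat) /\
    forall g, nsum n (ext_nat g) = fold_right (fun j acc => g j + acc) 0 l).
  { induction n as [|n IH]; intros Hn.
    - exists nil; split; [constructor|split; [|reflexivity]]. intros i; simpl; lia.
    - destruct (IH ltac:(lia)) as [l [Hl1 [Hl2 Hl3]]].
      pose (i0 := exist _ n (ltb_of_lt Hn) : Idx d).
      exists (i0 :: l); split; [|split].
      + constructor; [|auto]. rewrite Hl2; simpl; lia.
      + intros i; simpl; rewrite Hl2; split.
        * intros [<-|H]; simpl; lia.
        * intros H; destruct (PeanoNat.Nat.eq_dec (proj1_sig i) n) as [E|E]; [|right; lia].
          left; now apply idx_eq.
      + intros g; simpl. rewrite Hl3, (ext_nat_idx g n (ltb_of_lt Hn)). unfold i0; ring. }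
  destruct (K d (Nat.le_refl d)) as [l [H1 [H2 H3]]].
  exists l; split; [auto|split; [|auto]]. intros i; apply H2.
  destruct i as [i H']; simpl; now apply PeanoNat.Nat.ltb_lt.
Qed.

Lemma simple_val_finite_valued Om d (X : Om -> Idx d) (u : Vec d) (l : list (Idx d)) w : NoDup l ->
  In (X w) l -> simple_val (map (fun j => (u j, fun w => X w = j)) l) w = u (X w).
Proof.
  assert (Z : forall l, ~ In (X w) l -> simple_val (map (fun j => (u j, fun w => X w = j)) l) w = 0).
  { clear l; induction l as [|j l IH]; simpl; intros H; [auto|].
    rewrite IH by tauto. rewrite indic_false by (intros E; apply H; auto). ring. }
  induction l as [|j l IH]; simpl; intros Hn Hin; [tauto|].
  inversion Hn as [|? ? Hj Hl]; subst. destruct Hin as [->|Hin].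
  - rewrite Z, indic_true by auto. ring.
  - rewrite IH by auto. rewrite indic_false by (intros <-; contradiction). ring.
Qed.

Lemma is_expectation_finite_valued Om (F : (Om -> Prop) -> Prop) P d (X : Om -> Idx d) (u : Vec d) :
  sigma_algebra F -> prob_measure F P -> (forall j, F (fun w => X w = j)) ->
  is_expectation F P (fun w => u (X w)) (vsum (fun j => u j * P (fun w => X w = j))).
Proof.
  intros HF HP HX; destruct (idx_enum d) as [l [Hl1 [Hl2 Hl3]]].
  rewrite Hl3.
  replace (fold_right _ 0 l) with (simple_int P (map (fun j => (u j, fun w => X w = j)) l)).
  - apply (is_expectation_simple HF HP).
    + intros p Hp; apply in_map_iff in Hp; destruct Hp as [j [<- _]]; simpl; auto.
    + intros w; now apply simple_val_finite_valued.
  - clear; induction l as [|j l IH]; simpl; [auto|]. now rewrite IH.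
Qed.

Lemma prob_finite_valued_total Om (F : (Om -> Prop) -> Prop) P d (X : Om -> Idx d) :
  sigma_algebra F -> prob_measure F P -> (forall j, F (fun w => X w = j)) ->
  vsum (fun j => P (fun w => X w = j)) = 1.
Proof.
  intros HF HP HX.
  rewrite (@vsum_ext d _ (fun j => 1 * P (fun w => X w = j))) by (intros; ring).
  pose proof (is_expectation_finite_valued X (fun _ => 1) HF HP HX) as H.
  assert (H1 : is_expectation F P (fun _ => 1) (simple_int P ((1, fun _ : Om => True) :: nil))).
  { apply (is_expectation_simple HF HP).
    - intros p [<-|[]]; apply HF.
    - intros w; simpl; rewrite indic_true by auto; ring. }
  simpl in H1; rewrite (proj1 (proj2 HP)) in H1.
  pose proof (is_expectation_unique H H1) as E. cbv beta in E. rewrite E; ring.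
Qed.

(** * Expectations of a chain at single times *)

Section ChainSemigroup.
Variables (d : nat) (M : ConvexMarkovChain d).

Definition chain_sg (t : R) (u : Vec d) : Vec d := fun i => cmc_E M i (fun w => u (cmc_X M t w)).

(** Reduces the expectation to the laws of the chain at time [t], that is, to penalised probability
    vectors on the index set. *)
Lemma chain_sg_lub t i : 0 <= t -> exists (I : Type) (Z : I -> Vec d) (al : I -> R),
  (forall k j, 0 <= Z k j) /\ (forall k, vsum (Z k) = 1) /\ (forall k, 0 <= al k) /\
  (forall eps, 0 < eps -> exists k, al k < eps) /\
  forall u, is_lub (fun y => exists k, y = vsum (fun j => u j * Z k j) - al k) (chain_sg t u i).
Proof.
  intros Ht; destruct (cmc_cexp M i) as [HF [I [P [al [HP [Hal [Hinf Hlub]]]]]]].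
  pose proof (fun j => cmc_Xmeas M j Ht) as HX.
  exists I, (fun k j => P k (fun w => cmc_X M t w = j)), al.
  split; [|split; [|split; [auto|split; [auto|]]]].
  - intros k j; apply (HP k), HX.
  - intros k; eapply prob_finite_valued_total; eauto.
  - intros u.
    assert (Hm : measurable (@cmc_F d M) (fun w => u (cmc_X M t w))).
    { intros c; apply (sigma_finite_valued HF (cmc_X M t) (fun j => u j <= c)); auto. }
    assert (Hb : bounded_fun (fun w => u (cmc_X M t w))).
    { destruct (idx_bounded u) as [r [_ Hr]]; exists r; auto. }
    destruct (Hlub _ Hm Hb) as [H1 H2]. split.
    + intros y [k ->]; apply H1. exists k, (vsum (fun j => u j * P k (fun w => cmc_X M t w = j))).
      split; [|auto]. apply is_expectation_finite_valued; auto.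
    + intros b Hb'; apply H2; intros y [k [r [Hr ->]]]. apply Hb'. exists k. f_equal.
      eapply is_expectation_unique; [exact Hr|]. apply is_expectation_finite_valued; auto.
Qed.

Lemma chain_sg_semigroup : is_semigroup chain_sg.
Proof.
  split.
  - intros u i; apply cmc_init.
  - intros s t Hs Ht u i. unfold chain_sg.
    (* The Markov property asks for a nonempty list of past times; [s] itself serves, and the test
       function ignores its value. *)
    apply (cmc_markov M Hs Ht (ts := s :: nil) ltac:(discriminate)
      (Sorted_cons (Sorted_nil _) (HdRel_nil _ _))
      (Forall_cons _ (conj Hs (Rle_refl s)) (Forall_nil _)) (fun _ x => u x) i).
Qed.

Lemma chain_sg_markovian : markovian_sg chain_sg.
Proof.
  intros t Ht; split.
  - intros u v Huv i; destruct (chain_sg_lub i Ht) as [I [Z [al [HZ [_ [_ [_ Hlub]]]]]]].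
    apply (Hlub u); intros y [k ->].
    apply Rle_trans with (vsum (fun j => v j * Z k j) - al k).
    + apply Rplus_le_compat_r, vsum_le; intros j. apply Rmult_le_compat_r; auto.
    + apply (Hlub v); exists k; auto.
  - intros a i; destruct (chain_sg_lub i Ht) as [I [Z [al [_ [HZ1 [Hal [Hinf Hlub]]]]]]].
    assert (E : forall k, vsum (fun j => cst a j * Z k j) = a).
    { intros k; unfold cst; rewrite vsum_scal, HZ1; ring. }
    apply Rle_antisym.
    + apply (Hlub (cst a)); intros y [k ->]. rewrite E. specialize (Hal k); lra.
    + apply Rle_plus_epsilon; intros eps Heps; destruct (Hinf eps Heps) as [k Hk].
      assert (a - al k <= chain_sg t (cst a) i); [|lra].
      apply (Hlub (cst a)); exists k; now rewrite E.
Qed.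

Lemma chain_sg_convex : convex_sg chain_sg.
Proof.
  intros t Ht u v l Hl i; destruct (chain_sg_lub i Ht) as [I [Z [al [_ [_ [_ [_ Hlub]]]]]]].
  apply (Hlub (fun j => l * u j + (1 - l) * v j)); intros y [k ->].
  rewrite (@vsum_ext d _ (fun j => l * (u j * Z k j) + (1 - l) * (v j * Z k j))) by (intros; ring).
  rewrite vsum_lin.
  assert (vsum (fun j => u j * Z k j) - al k <= chain_sg t u i) by (apply (Hlub u); exists k; auto).
  assert (vsum (fun j => v j * Z k j) - al k <= chain_sg t v i) by (apply (Hlub v); exists k; auto).
  nra.
Qed.

End ChainSemigroup.

(** * Construction of convex Markov chains *)

(** An uncountable product of finite sets need not be sequentially compact; path sequences are
    therefore given limits along an ultrafilter instead of a subsequence. *)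
Lemma free_ultrafilter : exists U : (nat -> Prop) -> Prop,
  (forall N, U (fun n => (N <= n)%nat)) /\
  (forall A B : nat -> Prop, (forall n, A n -> B n) -> U A -> U B) /\
  (forall A B : nat -> Prop, U A -> U B -> U (fun n => A n /\ B n)) /\
  (forall A, U A -> exists n, A n) /\
  (forall A, U A \/ U (fun n => ~ A n)).
Proof.
  pose (F0 := fun A : nat -> Prop => exists N, forall n, (N <= n)%nat -> A n).
  assert (H0 : filter.Filter F0).
  { constructor.
    - exists O; intros; exact Logic.I.
    - intros A B [N HN] [N' HN']; exists (max N N'); intros n Hn; split; [apply HN|apply HN']; lia.
    - intros A B HAB [N HN]; exists N; intros n Hn; apply HAB, HN, Hn. }
  assert (HP : filter.ProperFilter F0).
  { constructor; [|exact H0]. intros [N HN]; exact (HN N (Nat.le_refl N)). }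
  destruct (filter.ultraFilterLemma HP) as [U [HU Hsub]].
  assert (HUP : filter.ProperFilter U) by apply HU.
  assert (HUF : filter.Filter U) by apply HUP.
  exists U; split; [|split; [|split; [|split]]].
  - intros N; apply Hsub; exists N; auto.
  - intros A B HAB; apply (filter.filterS (F := U)); exact HAB.
  - intros A B; apply (filter.filterI (F := U)).
  - intros A HA; apply NNPP; intros HN. apply (filter.filter_not_empty U).
    apply (filter.filterS (F := U) (P := A)); [|exact HA].
    intros n Hn; apply HN; exists n; exact Hn.
  - intros A; apply (filter.in_ultra_setVsetC A HU).
Qed.

(** * Cylinder functions and compactness of the path space *)

Section Paths.
Variable d : nat.

Notation Path := (R -> Idx d).

Definition upd (w : Path) (t : R) (x : Idx d) : Path := fun s => if Req_dec_T s t then x else w s.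

Lemma upd_same w t x : upd w t x t = x.
Proof. unfold upd; destruct (Req_dec_T t t); congruence. Qed.

Lemma upd_other w t x s : s <> t -> upd w t x s = w s.
Proof. unfold upd; destruct (Req_dec_T s t); congruence. Qed.

Lemma upd_id w t : upd w t (w t) = w.
Proof.
  apply functional_extensionality; intros s; unfold upd; destruct (Req_dec_T s t); congruence.
Qed.

Lemma upd_comm w s t x y : s <> t -> upd (upd w s x) t y = upd (upd w t y) s x.
Proof.
  intros H; apply functional_extensionality; intros r; unfold upd.
  destruct (Req_dec_T r t), (Req_dec_T r s); congruence.
Qed.

Definition agree (ts : list R) (w w' : Path) : Prop := forall t, In t ts -> w t = w' t.

Definition depends_on {T : Type} (ts : list R) (Y : Path -> T) : Prop :=
  forall w w', agree ts w w' -> Y w = Y w'.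

Lemma depends_on_incl T ts ts' (Y : Path -> T) : incl ts ts' -> depends_on ts Y -> depends_on ts' Y.
Proof. intros H HY w w' Hw; apply HY; intros t Ht; apply Hw, H, Ht. Qed.

Lemma depends_on_upd T ts (Y : Path -> T) s w x : depends_on ts Y -> ~ In s ts -> Y (upd w s x) = Y w.
Proof. intros H Hs; apply H; intros t Ht; apply upd_other; intros ->; contradiction. Qed.

(** The value type is arbitrary, so events and real functions share the closure lemmas. Paths are
    indexed by all reals, but only nonnegative times are observed. *)
Definition cylinder {T : Type} (Y : Path -> T) : Prop :=
  exists ts, Forall (Rle 0) ts /\ depends_on ts Y.

Lemma cylinder_combine T1 T2 T (Y1 : Path -> T1) (Y2 : Path -> T2) (op : T1 -> T2 -> T) :
  cylinder Y1 -> cylinder Y2 -> cylinder (fun w => op (Y1 w) (Y2 w)).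
Proof.
  intros [ts1 [P1 D1]] [ts2 [P2 D2]]; exists (ts1 ++ ts2); split; [now apply Forall_app|].
  intros w w' H; f_equal; [apply D1|apply D2]; intros t Ht; apply H, in_or_app; auto.
Qed.

Lemma cylinder_apply T1 T (Y : Path -> T1) (f : T1 -> T) : cylinder Y -> cylinder (fun w => f (Y w)).
Proof.
  intros [ts [P1 D1]]; exists ts; split; [auto|]. intros w w' H; f_equal; now apply D1.
Qed.

Lemma cylinder_const T (a : T) : cylinder (fun _ => a).
Proof. exists nil; split; [constructor|intros w w' _; reflexivity]. Qed.

Lemma cylinder_coordinate t : 0 <= t -> cylinder (fun w => w t).
Proof. intros Ht; exists (t :: nil); split; [auto|]. intros w w' H; apply H; now left. Qed.

Lemma cylinder_coordinates ts : Forall (Rle 0) ts -> cylinder (fun w : Path => map (fun r => w r) ts).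
Proof.
  intros Hts; exists ts; split; [auto|]. intros w w' H; apply map_ext_in; intros t Ht; now apply H.
Qed.

Lemma cylinder_upd T (Y : Path -> T) t ts x : depends_on (t :: ts) Y ->
  depends_on ts (fun w => Y (upd w t x)).
Proof.
  intros H w w' Hw; apply H; intros s [<-|Hs]; [now rewrite !upd_same|].
  destruct (Req_dec s t) as [->|Hst]; [now rewrite !upd_same|].
  rewrite !upd_other by auto; now apply Hw.
Qed.

(** Freezing the coordinate at [t] leaves a function of fewer times; the events [w t = x] glue the
    resulting simple functions. *)
Lemma cylinder_simple (Y : Path -> R) : cylinder Y ->
  exists s, (forall p, In p s -> cylinder (snd p)) /\ forall w, simple_val s w = Y w.
Proof.
  intros [ts [Hts HD]]; revert Y HD; induction Hts as [|t ts Ht Hts IH]; intros Y HD.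
  (* Without observed times [Y] is constant; the distinction covers an empty index set, for which
     there are no paths. *)
  - destruct (classic (exists w : Path, True)) as [[w0 _]|HN].
    + exists ((Y w0, fun _ => True) :: nil); split.
      * intros p [<-|[]]; apply cylinder_const.
      * intros w; simpl; rewrite indic_true by auto. rewrite (HD w0 w); [ring|intros t []].
    + exists nil; split; [intros p []|]. intros w; exfalso; apply HN; exists w; auto.
  - destruct (idx_enum d) as [l [Hl [Hall _]]].
    (* Requiring the value 0 when [w t] is not in [l] allows the piece for a new state to be
       appended. *)
    assert (K : forall l, NoDup l -> exists s, (forall p, In p s -> cylinder (snd p)) /\
      forall w, (In (w t) l -> simple_val s w = Y w) /\ (~ In (w t) l -> simple_val s w = 0)).
    { clear l Hl Hall; induction l as [|x l IHl]; intros Hl.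
      - exists nil; split; [intros p []|]. intros w; split; [intros []|auto].
      - inversion Hl as [|? ? Hx Hl']; subst. destruct (IHl Hl') as [s [Hs Hv]].
        destruct (IH (fun w => Y (upd w t x)) (cylinder_upd x HD)) as [sx [Hsx Hvx]].
        pose (sx' := map (fun p : R * (Path -> Prop) => (fst p, fun w => w t = x /\ snd p w)) sx).
        assert (Hvx' : forall w, simple_val sx' w = indic (fun w : Path => w t = x) w * simple_val sx w).
        { intros w; unfold sx'; clear; induction sx as [|p sx IH]; simpl; [ring|].
          rewrite IH. unfold indic; repeat destruct excluded_middle_informative; try tauto; ring. }
        exists (sx' ++ s); split.
        + intros p Hp; apply in_app_or in Hp; destruct Hp as [Hp|Hp]; [|auto].
          unfold sx' in Hp; apply in_map_iff in Hp; destruct Hp as [p0 [<- Hp0]]; simpl.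
          apply (cylinder_combine (Y1 := fun w => w t = x)); [|auto].
          apply (cylinder_apply (Y := fun w : Path => w t) (fun y => y = x)), cylinder_coordinate, Ht.
        + intros w; rewrite simple_val_app, Hvx', Hvx; simpl; split.
          * intros [E|E].
            -- rewrite indic_true by auto. subst x. rewrite upd_id.
               rewrite (proj2 (Hv w)) by auto. ring.
            -- rewrite indic_false by (intros E'; rewrite E' in E; contradiction).
               rewrite (proj1 (Hv w)) by auto. ring.
          * intros E. rewrite indic_false by auto. rewrite (proj2 (Hv w)) by auto. ring. }
    destruct (K l Hl) as [s [Hs Hv]]; exists s; split; [auto|]. intros w; now apply Hv.
Qed.

Lemma cylinder_bounded (Y : Path -> R) : cylinder Y -> bounded_fun Y.
Proof.
  intros HY; destruct (cylinder_simple HY) as [s [_ Hv]].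
  assert (K : forall s : list (R * (Path -> Prop)), bounded_fun (simple_val s)).
  { clear; induction s as [|p s [M HM]]; [exists 0; intros; simpl; rewrite Rabs_R0; lra|].
    exists (Rabs (fst p) + M); intros w; simpl. eapply Rle_trans; [apply Rabs_triang|].
    apply Rplus_le_compat; [|auto]. rewrite Rabs_mult.
    assert (Rabs (indic (snd p) w) <= 1).
    { unfold indic; destruct excluded_middle_informative; [rewrite Rabs_R1|rewrite Rabs_R0]; lra. }
    pose proof (Rabs_pos (fst p)); nra. }
  destruct (K s) as [M HM]; exists M; intros w; rewrite <- Hv; auto.
Qed.

(** The limit of [w n] along a free ultrafilter lies in every set of the sequence. *)
Lemma cylinder_compact (B : nat -> Path -> Prop) : (forall n, cylinder (B n)) ->
  (forall n w, B (S n) w -> B n w) -> (forall n, exists w, B n w) -> exists w, forall n, B n w.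
Proof.
  intros HB Hdec Hne.
  destruct free_ultrafilter as [U [U1 [U2 [U3 [U4 U5]]]]].
  destruct (choice (fun n w => B n w) Hne) as [w Hw].
  assert (Hlim : forall t, exists x, U (fun n => w n t = x)).
  { intros t; apply NNPP; intros HN. destruct (idx_list d) as [l Hl].
    assert (K : U (fun n => forall x, In x l -> w n t <> x)).
    { clear Hl; induction l as [|x l IH].
      - apply (U2 (fun n => (0 <= n)%nat)); [intros n _ x []|auto].
      - apply (U2 (fun n => (forall y, In y l -> w n t <> y) /\ w n t <> x)).
        + intros n [H1 H2] y [<-|Hy]; auto.
        + apply U3; [auto|]. destruct (U5 (fun n => w n t = x)) as [H|H]; [|auto].
          exfalso; apply HN; exists x; auto. }
    destruct (U4 _ K) as [n Hn]; apply (Hn (w n t)); auto. }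
  destruct (choice (fun t x => U (fun n => w n t = x)) Hlim) as [w0 Hw0].
  exists w0; intros m. destruct (HB m) as [ts [_ HD]].
  assert (K : U (fun n => agree ts (w n) w0)).
  { clear HD; induction ts as [|t ts IH].
    - apply (U2 (fun n => (0 <= n)%nat)); [intros n _ t []|auto].
    - apply (U2 (fun n => agree ts (w n) w0 /\ w n t = w0 t)); [|now apply U3].
      intros n [H1 H2] s [<-|Hs]; auto. }
  destruct (U4 _ (U3 _ _ K (U1 m))) as [n [Hn1 Hn2]].
  rewrite <- (HD _ _ Hn1).
  assert (Hmono : forall k, B (m + k)%nat (w n) -> B m (w n)).
  { induction k as [|k IH]; [now rewrite Nat.add_0_r|].
    rewrite Nat.add_succ_r; auto. }
  apply (Hmono (n - m)%nat). replace (m + (n - m))%nat with n by lia. apply Hw.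
Qed.

End Paths.

(** * Strictly sorted lists of times *)

Fixpoint insert_time (s : R) (ts : list R) : list R :=
  match ts with
  | nil => s :: nil
  | t :: ts' => if Rlt_dec s t then s :: t :: ts'
                else if Req_dec_T s t then t :: ts' else t :: insert_time s ts'
  end.

Lemma insert_time_in s ts r : In r (insert_time s ts) <-> r = s \/ In r ts.
Proof.
  induction ts as [|t ts IH]; simpl; [intuition|].
  destruct (Rlt_dec s t); [simpl; intuition|].
  destruct (Req_dec_T s t) as [->|]; simpl; [intuition congruence|]. rewrite IH; intuition.
Qed.

Lemma insert_time_sorted s ts : StronglySorted Rlt ts -> StronglySorted Rlt (insert_time s ts).
Proof.
  induction 1 as [|t ts Hts IH Ht]; simpl; [repeat constructor|].
  destruct (Rlt_dec s t) as [Hst|Hst].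
  - constructor; [now constructor|]. constructor; [auto|].
    rewrite Forall_forall in *; intros r Hr; specialize (Ht r Hr); lra.
  - destruct (Req_dec_T s t) as [->|Hne]; [now constructor|].
    constructor; [auto|]. rewrite Forall_forall in *; intros r Hr.
    apply insert_time_in in Hr; destruct Hr as [->|Hr]; [lra|auto].
Qed.

Lemma sorted_unique ts ts' : StronglySorted Rlt ts -> StronglySorted Rlt ts' ->
  (forall r, In r ts <-> In r ts') -> ts = ts'.
Proof.
  intros H; revert ts'; induction H as [|t ts Hts IH Ht]; intros ts' H' E.
  - destruct ts' as [|t' ts']; [auto|]. destruct (proj2 (E t') (or_introl eq_refl)).
  - inversion H' as [|t' ts0 Hts' Ht']; subst; [destruct (proj1 (E t) (or_introl eq_refl))|].
    rewrite Forall_forall in *.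
    assert (t = t').
    { destruct (proj1 (E t) (or_introl eq_refl)) as [|H1]; [auto|].
      destruct (proj2 (E t') (or_introl eq_refl)) as [|H2]; [auto|].
      specialize (Ht _ H2); specialize (Ht' _ H1); lra. }
    subst t'; f_equal; apply IH; [auto|]. intros r; split; intros Hr.
    + destruct (proj1 (E r) (or_intror Hr)) as [->|]; [|auto]. specialize (Ht _ Hr); lra.
    + destruct (proj2 (E r) (or_intror Hr)) as [->|]; [|auto]. specialize (Ht' _ Hr); lra.
Qed.

Definition merge_times (ts ts' : list R) : list R := fold_right insert_time ts' ts.

Lemma merge_times_in ts ts' r : In r (merge_times ts ts') <-> In r ts \/ In r ts'.
Proof. induction ts as [|t ts IH]; simpl; [tauto|]. rewrite insert_time_in, IH. intuition. Qed.

Lemma merge_times_sorted ts ts' : StronglySorted Rlt ts' -> StronglySorted Rlt (merge_times ts ts').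
Proof. intros H; induction ts as [|t ts IH]; simpl; [auto|now apply insert_time_sorted]. Qed.

(** * Iterated expectations and the chain of a semigroup *)

Section IteratedSemigroup.
Variables (d : nat) (S : R -> Vec d -> Vec d).
Hypothesis HS : is_semigroup S.
Hypothesis HM : markovian_sg S.
Hypothesis HC : convex_sg S.

Notation Path := (R -> Idx d).

(** [iterate tau ts w Y] is the conditional expectation of [Y] given the path [w] up to time [tau], for [Y]
    depending on the past and on the coordinates at the later times [ts]. *)
Fixpoint iterate (tau : R) (ts : list R) (w : Path) (Y : Path -> R) : R :=
  match ts with
  | nil => Y w
  | t :: ts' => S (t - tau) (fun x => iterate t ts' (upd w t x) Y) (w tau)
  end.

Definition admissible (tau : R) (ts : list R) : Prop := StronglySorted Rlt ts /\ Forall (Rle tau) ts.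

Lemma admissible_cons tau t ts : admissible tau (t :: ts) ->
  0 <= t - tau /\ admissible t ts /\ Forall (Rlt t) ts.
Proof.
  intros [H1 H2]; inversion H1; inversion H2; subst.
  split; [lra|split; [split; [auto|]|auto]].
  match goal with H : Forall (Rlt t) ts |- _ => eapply Forall_impl; [|exact H] end.
  intros r Hr; lra.
Qed.

Lemma iterate_monotone ts tau w Y Y' : admissible tau ts -> (forall w, Y w <= Y' w) ->
  iterate tau ts w Y <= iterate tau ts w Y'.
Proof.
  revert tau w; induction ts as [|t ts IH]; intros tau w Hts H; simpl; [auto|].
  destruct (admissible_cons Hts) as [Ht [Hts' _]].
  apply (HM Ht); intros x; now apply IH.
Qed.

Lemma iterate_convex ts tau w Y Y' l : admissible tau ts -> 0 <= l <= 1 ->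
  iterate tau ts w (fun w => l * Y w + (1 - l) * Y' w) <=
  l * iterate tau ts w Y + (1 - l) * iterate tau ts w Y'.
Proof.
  revert tau w; induction ts as [|t ts IH]; intros tau w Hts Hl; simpl; [lra|].
  destruct (admissible_cons Hts) as [Ht [Hts' _]].
  eapply Rle_trans; [|apply (HC Ht); auto].
  apply (HM Ht); intros x; now apply IH.
Qed.

Lemma iterate_ext ts tau w Y Y' : (forall w, Y w = Y' w) -> iterate tau ts w Y = iterate tau ts w Y'.
Proof. intros H; replace Y' with Y; [auto|]. now apply functional_extensionality. Qed.

Lemma iterate_upd ts tau w Y s x : s <> tau -> ~ In s ts -> (forall w x, Y (upd w s x) = Y w) ->
  iterate tau ts (upd w s x) Y = iterate tau ts w Y.
Proof.
  intros Hs Hin HY; revert tau w Hs Hin; induction ts as [|t ts IH]; intros tau w Hs Hin; simpl; [auto|].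
  rewrite upd_other by auto. f_equal; apply functional_extensionality; intros y.
  simpl in Hin. rewrite upd_comm by (intros ->; tauto). apply IH; [intros ->|]; tauto.
Qed.

(** Chapman-Kolmogorov: a time ignored by [Y] splits one semigroup step into two. After the last
    time the extra step acts on a constant, which kernels fix. *)
Lemma iterate_insert ts tau w Y s : admissible tau ts -> tau <= s ->
  (In s ts \/ forall w x, Y (upd w s x) = Y w) ->
  iterate tau (insert_time s ts) w Y = iterate tau ts w Y.
Proof.
  revert tau w; induction ts as [|t ts IH]; intros tau w Hts Hs HY; simpl.
  - destruct HY as [[]|HY].
    replace (fun x => Y (upd w s x)) with (@cst d (Y w)).
    + apply (HM (t := s - tau)); lra.
    + apply functional_extensionality; intros x; now rewrite HY.
  - destruct (admissible_cons Hts) as [Ht [Hts' Hlt]].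
    destruct (Rlt_dec s t) as [Hst|Hst].
    + simpl. assert (Hin : ~ In s ts).
      { intros Hin; rewrite Forall_forall in Hlt; specialize (Hlt s Hin); lra. }
      destruct HY as [[E|Hin']|HY]; [lra|contradiction|].
      replace (t - tau) with ((s - tau) + (t - s)) by ring.
      rewrite (proj2 HS) by lra. f_equal; apply functional_extensionality; intros x.
      rewrite upd_same. f_equal; apply functional_extensionality; intros y.
      rewrite upd_comm by lra. apply iterate_upd; auto; lra.
    + destruct (Req_dec_T s t) as [->|Hne]; simpl; [auto|].
      f_equal; apply functional_extensionality; intros x. apply IH; [auto|lra|].
      destruct HY as [[E|Hin]|HY]; [congruence|auto|auto].
Qed.

Lemma admissible_insert tau s ts : tau <= s -> admissible tau ts -> admissible tau (insert_time s ts).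
Proof.
  intros Hs [H1 H2]; split; [now apply insert_time_sorted|].
  rewrite Forall_forall in *; intros r Hr; apply insert_time_in in Hr; destruct Hr as [->|Hr]; auto.
Qed.

Lemma admissible_merge ts ts' tau : Forall (Rle tau) ts -> admissible tau ts' ->
  admissible tau (merge_times ts ts').
Proof. induction 1; simpl; intros; [auto|]. apply admissible_insert; auto. Qed.

Lemma iterate_merge ts ts' tau w Y : Forall (Rle tau) ts -> admissible tau ts' -> depends_on ts' Y ->
  iterate tau (merge_times ts ts') w Y = iterate tau ts' w Y.
Proof.
  intros Hts Hts' HY; induction Hts as [|t ts Ht Hts IH]; simpl; [auto|].
  rewrite iterate_insert; [auto|now apply admissible_merge|auto|].
  destruct (classic (In t (merge_times ts ts'))) as [|Hin]; [auto|right].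
  intros w' x; apply (depends_on_upd (ts := ts')); [auto|].
  intros H; apply Hin, merge_times_in; auto.
Qed.

(** Kolmogorov consistency: both supports are enlarged to their merger, and strictly sorted lists
    with the same elements coincide. *)
Lemma iterate_support_independent ts ts' tau w Y : admissible tau ts -> admissible tau ts' ->
  depends_on ts Y -> depends_on ts' Y -> iterate tau ts w Y = iterate tau ts' w Y.
Proof.
  intros H H' HY HY'.
  rewrite <- (iterate_merge (ts := ts') (ts' := ts)) by (auto; apply H').
  rewrite <- (iterate_merge (ts := ts) (ts' := ts')) by (auto; apply H).
  f_equal; apply sorted_unique; [now apply merge_times_sorted, H|now apply merge_times_sorted, H'|].
  intros r; rewrite !merge_times_in; tauto.
Qed.

(** Exposes the innermost step, the conditional expectation given the path up to [s]; this is the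
    source of the Markov property. *)
Lemma iterate_snoc ts s r tau w Y :
  iterate tau (ts ++ s :: r :: nil) w Y =
  iterate tau (ts ++ s :: nil) w (fun w' => S (r - s) (fun x => Y (upd w' r x)) (w' s)).
Proof.
  revert tau w; induction ts as [|t ts IH]; intros tau w; simpl; [reflexivity|].
  f_equal; apply functional_extensionality; intros x; apply IH.
Qed.

(** The iteration starts at time 0 in state [i]; which support [epsilon] picks is immaterial by
    consistency. *)
Definition cyl_exp (i : Idx d) (Y : Path -> R) : R :=
  iterate 0 (epsilon (inhabits nil) (fun ts => admissible 0 ts /\ depends_on ts Y)) (fun _ => i) Y.

Lemma cyl_exp_eq i ts Y : admissible 0 ts -> depends_on ts Y ->
  cyl_exp i Y = iterate 0 ts (fun _ => i) Y.
Proof.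
  intros H HY; unfold cyl_exp.
  destruct (epsilon_spec (inhabits nil) (fun ts => admissible 0 ts /\ depends_on ts Y)) as [K1 K2].
  { exists ts; auto. }
  now apply iterate_support_independent.
Qed.

Lemma cylinder_admissible2 (Y Y' : Path -> R) : cylinder Y -> cylinder Y' ->
  exists ts, admissible 0 ts /\ depends_on ts Y /\ depends_on ts Y'.
Proof.
  intros HY HY'.
  destruct HY as [ts [Hts HY]], HY' as [ts' [Hts' HY']].
  exists (merge_times ts (merge_times ts' nil)); split; [|split].
  - apply admissible_merge; [auto|]. apply admissible_merge; [auto|split; constructor].
  - eapply depends_on_incl; [|exact HY]. intros r Hr; apply merge_times_in; auto.
  - eapply depends_on_incl; [|exact HY']. intros r Hr; rewrite !merge_times_in; auto.
Qed.

Lemma cyl_exp_monotone i Y Y' : cylinder Y -> cylinder Y' -> (forall w, Y w <= Y' w) ->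
  cyl_exp i Y <= cyl_exp i Y'.
Proof.
  intros HY HY' H; destruct (cylinder_admissible2 HY HY') as [ts [Hts [D D']]].
  rewrite !(cyl_exp_eq i Hts) by auto. now apply iterate_monotone.
Qed.

Lemma cyl_exp_const i a : cyl_exp i (fun _ => a) = a.
Proof.
  assert (Hnil : admissible 0 nil) by (split; constructor).
  rewrite (cyl_exp_eq i Hnil); [reflexivity|]. intros w w' _; auto.
Qed.

Lemma cyl_exp_convex i : convex_on (@cylinder d R) (cyl_exp i).
Proof.
  intros Y Y' l HY HY' Hl; destruct (cylinder_admissible2 HY HY') as [ts [Hts [D D']]].
  rewrite !(cyl_exp_eq i Hts); auto.
  - unfold fcomb; now apply iterate_convex.
  - intros w w' H; unfold fcomb; now rewrite (D w w' H), (D' w w' H).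
Qed.

Lemma cyl_exp_coordinate i t (u : Vec d) : 0 <= t -> cyl_exp i (fun w => u (w t)) = S t u i.
Proof.
  intros Ht. rewrite (@cyl_exp_eq i (t :: nil)).
  - simpl. rewrite Rminus_0_r. f_equal; apply functional_extensionality; intros x; now rewrite upd_same.
  - split; [repeat constructor|]. constructor; [auto|constructor].
  - intros w w' H; now rewrite (H t (or_introl eq_refl)).
Qed.

Lemma cyl_exp_markov s t ts (v0 : list (Idx d) -> Idx d -> R) i :
  0 <= s -> 0 <= t -> StronglySorted Rlt ts -> Forall (fun r => 0 <= r <= s) ts ->
  cyl_exp i (fun w => v0 (map (fun r => w r) ts) (w (s + t))) =
  cyl_exp i (fun w => S t (fun x => v0 (map (fun r => w r) ts) x) (w s)).
Proof.
  intros Hs [Ht|<-] Hsort Hts.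
  (* For [t = 0] the times [s] and [s + t] coincide and could not both stand in a strictly sorted
     list. *)
  2:{ f_equal; apply functional_extensionality; intros w. rewrite Rplus_0_r, (proj1 HS); auto. }
  rewrite Forall_forall in Hts.
  (* [s] may or may not be among the observed times; removing it and appending it again puts it last
     in every case. *)
  pose (ts0 := filter (fun r => if Req_dec_T r s then false else true) ts).
  assert (Hin0 : forall r, In r ts0 <-> In r ts /\ r <> s).
  { intros r; unfold ts0; rewrite filter_In. destruct (Req_dec_T r s); intuition congruence. }
  assert (Hsort0 : StronglySorted Rlt ts0).
  { unfold ts0; clear - Hsort; induction Hsort as [|r ts Hts IH Hr]; simpl; [constructor|].
    destruct (Req_dec_T r s); [auto|]. constructor; [auto|].
    rewrite Forall_forall in *; intros r' Hr'; apply filter_In in Hr'; apply Hr, Hr'. }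
  assert (Hlt0 : forall r, In r ts0 -> 0 <= r < s).
  { intros r Hr; apply Hin0 in Hr; destruct Hr as [Hr Hne]; specialize (Hts r Hr); lra. }
  assert (Hsnoc : forall l, StronglySorted Rlt l -> forall r, (forall r', In r' l -> r' < r) ->
    StronglySorted Rlt (l ++ r :: nil)).
  { clear; induction 1 as [|r' l Hl IH Hr']; intros r Hr; simpl; [repeat constructor|].
    constructor; [apply IH; intros; apply Hr; now right|].
    apply Forall_app; split; [auto|]. constructor; [apply Hr; now left|constructor]. }
  assert (A1 : admissible 0 (ts0 ++ s :: nil)).
  { split.
    - apply Hsnoc; [auto|]. intros r Hr; apply Hlt0, Hr.
    - apply Forall_app; split; [|auto]. rewrite Forall_forall; intros r Hr; apply Hlt0, Hr. }
  assert (A2 : admissible 0 (ts0 ++ s :: (s + t) :: nil)).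
  { replace (ts0 ++ s :: (s + t) :: nil) with ((ts0 ++ s :: nil) ++ (s + t) :: nil)
      by now rewrite <- app_assoc.
    split.
    - apply Hsnoc; [apply A1|]. intros r Hr; apply in_app_or in Hr; destruct Hr as [Hr|[<-|[]]]; [|lra].
      specialize (Hlt0 r Hr); lra.
    - apply Forall_app; split; [apply A1|]. constructor; [lra|constructor]. }
  assert (Hmem : forall r, In r ts -> In r ts0 \/ r = s).
  { intros r Hr; destruct (Req_dec r s) as [|Hne]; [auto|left; apply Hin0; auto]. }
  assert (Hmap : forall us w w', (forall r, In r ts0 -> In r us) -> In s us -> agree us w w' ->
    map (fun r : R => w r : Idx d) ts = map (fun r => w' r) ts).
  { intros us w w' H1 H2 H3; apply map_ext_in; intros r Hr; apply H3.
    destruct (Hmem r Hr) as [| ->]; auto. }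
  rewrite (cyl_exp_eq i A2), (cyl_exp_eq i A1).
  - rewrite iterate_snoc. apply iterate_ext; intros w.
    replace (s + t - s) with t by ring. f_equal; apply functional_extensionality; intros x.
    rewrite upd_same. f_equal. apply map_ext_in; intros r Hr; apply upd_other.
    specialize (Hts r Hr); lra.
  - intros w w' H. rewrite (H s) by (apply in_or_app; right; now left).
    f_equal; apply functional_extensionality; intros x.
    f_equal; eapply Hmap; [| |exact H]; [intros; apply in_or_app; auto|].
    apply in_or_app; right; now left.
  - intros w w' H. rewrite (H (s + t)) by (apply in_or_app; right; right; now left).
    f_equal; eapply Hmap; [| |exact H]; [intros; apply in_or_app; auto|].
    apply in_or_app; right; now left.
Qed.

Lemma cylinder_subspace : subspace (@cylinder d R).
Proof.
  split; [exists (fun _ => 0); apply cylinder_const|].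
  intros a b x y Hx Hy; apply (cylinder_combine (fun x y => a * x + b * y) Hx Hy).
Qed.

Definition cyl_sigma : (Path -> Prop) -> Prop := generated_sigma (@cylinder d Prop).

Lemma cylinder_indic (A : Path -> Prop) : cylinder A -> cylinder (indic A).
Proof.
  intros [ts [Hts H]]; exists ts; split; [auto|]. intros w w' Hw; unfold indic.
  now rewrite (H w w' Hw).
Qed.

(** A Hahn-Banach subgradient of [cyl_exp i] at [Y0] is a positive normalised functional on cylinder
    functions; by compactness of the path space it is automatically a measure. *)
Lemma cyl_exp_attained i Y0 : cylinder Y0 -> exists P a,
  prob_measure cyl_sigma P /\ 0 <= a /\
  (forall Y r, cylinder Y -> is_expectation cyl_sigma P Y r -> r - a <= cyl_exp i Y) /\
  (exists r, is_expectation cyl_sigma P Y0 r /\ r - a = cyl_exp i Y0) /\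
  (Y0 = (fun _ => 0) -> a = 0).
Proof.
  intros HY0.
  destruct (convex_subgradient cylinder_subspace Y0 (cyl_exp_convex i) HY0) as [l [Hl Hle]].
  assert (Hscal : forall a Y, cylinder Y -> l (fun w => a * Y w) = a * l Y).
  { intros a Y HY; transitivity (a * l Y + 0 * l Y); [|ring].
    rewrite <- Hl by auto; f_equal; fcomb_eq. }
  assert (Hadd : forall Y Y', cylinder Y -> cylinder Y' -> l (fun w => Y w + Y' w) = l Y + l Y').
  { intros Y Y' HY HY'; transitivity (1 * l Y + 1 * l Y'); [|ring].
    rewrite <- Hl by auto; f_equal; fcomb_eq. }
  assert (Hpos : forall Y, cylinder Y -> (forall w, 0 <= Y w) -> 0 <= l Y).
  { intros Y HY Hp; apply Rnot_lt_le; intros Hlt.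
    pose (c := l Y0 - cyl_exp i Y0).
    (* On the ray of nonpositive functions [- a Y] the expectation is at most 0, so [l] stays
       bounded there; a negative [l Y] would make it grow. *)
    assert (K : forall a, 0 <= a -> - a * l Y <= c).
    { intros a Ha. assert (HaY : cylinder (fun w => - a * Y w)) by (apply (cylinder_apply (fun y => - a * y)); auto).
      pose proof (Hle _ HaY) as H. rewrite Hscal in H by auto.
      assert (cyl_exp i (fun w => - a * Y w) <= 0).
      { rewrite <- (cyl_exp_const i 0). apply cyl_exp_monotone; auto using cylinder_const.
        intros w; specialize (Hp w); nra. }
      unfold c; lra. }
    specialize (K ((Rabs c + 1) / - l Y)).
    assert (0 <= (Rabs c + 1) / - l Y).
    { apply Rmult_le_pos; [pose proof (Rabs_pos c); lra|]. left; apply Rinv_0_lt_compat; lra. }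
    specialize (K H). replace (- ((Rabs c + 1) / - l Y) * l Y) with (Rabs c + 1) in K by (field; lra).
    pose proof (Rle_abs c); lra. }
  assert (Hone : l (fun _ => 1) = 1).
  { pose (c := l Y0 - cyl_exp i Y0).
    assert (K : forall a, a * (l (fun _ => 1) - 1) <= c).
    { intros a. pose proof (Hle (fun _ => a * 1) (cylinder_const _ _)) as H.
      rewrite (Hscal a (fun _ => 1)) in H by apply cylinder_const.
      rewrite cyl_exp_const in H. unfold c; lra. }
    destruct (Req_dec (l (fun _ => 1)) 1) as [|Hne]; [auto|exfalso].
    specialize (K ((Rabs c + 1) / (l (fun _ => 1) - 1))).
    replace ((Rabs c + 1) / (l (fun _ => 1) - 1) * (l (fun _ => 1) - 1)) with (Rabs c + 1) in K
      by (field; lra).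
    pose proof (Rle_abs c); lra. }
  pose (mu := fun A : Path -> Prop => l (indic A)).
  unshelve epose (C := @Build_compact_content Path (fun _ => i) (@cylinder d Prop) mu _ _ _ _ _ _ _).
  - apply cylinder_const.
  - intros B HB; now apply (cylinder_apply (fun b => ~ b)).
  - intros B B' HB HB'; now apply (cylinder_combine or).
  - intros B HB; apply Hpos; [now apply cylinder_indic|].
    intros w; unfold indic; destruct excluded_middle_informative; lra.
  - unfold mu; rewrite <- Hone; f_equal; apply functional_extensionality; intros w; now apply indic_true.
  - intros B B' HB HB' Hd; unfold mu; rewrite <- Hadd by now apply cylinder_indic.
    f_equal; apply functional_extensionality; intros w; unfold indic.
    specialize (Hd w). repeat destruct excluded_middle_informative; try tauto; ring.
  - apply cylinder_compact.
  - destruct (Extension.compact_content_extension C) as [P [HP HPmu]].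
    change (cc_dom C) with (@cylinder d Prop) in HP, HPmu. change (cc_mu C) with mu in HPmu.
    assert (HF : sigma_algebra cyl_sigma) by apply generated_sigma_algebra.
    assert (Hexp : forall Y, cylinder Y -> is_expectation cyl_sigma P Y (l Y)).
    { intros Y HY; destruct (cylinder_simple HY) as [s [Hs Hv]].
      replace (l Y) with (simple_int P s).
      - apply (is_expectation_simple HF HP); [|auto].
        intros p Hp F _ HFc; apply HFc, Hs, Hp.
      - replace Y with (simple_val s) by (apply functional_extensionality; auto).
        clear - Hs HPmu Hl Hscal Hadd Hone; induction s as [|p s IH]; simpl.
        + rewrite <- (Rmult_0_l (l (fun _ => 1))), <- Hscal by apply cylinder_const.
          f_equal; apply functional_extensionality; intros; unfold simple_val; simpl; ring.
        + rewrite IH by (intros; apply Hs; now right).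
          rewrite HPmu by (apply Hs; now left). unfold mu.
          assert (Hp : cylinder (indic (snd p))) by (apply cylinder_indic, Hs; now left).
          rewrite <- Hscal, <- Hadd; auto.
          * now apply (cylinder_apply (fun y => fst p * y)).
          * assert (Hs' : forall p, In p s -> cylinder (snd p)) by (intros; apply Hs; now right).
            clear - Hs'; induction s as [|p s IH]; [apply (cylinder_const _ 0)|].
            apply (cylinder_combine (Y1 := indic (snd p)) (fun x y => fst p * x + y)).
            -- apply cylinder_indic, Hs'; now left.
            -- apply IH; intros; apply Hs'; now right. }
    (* The penalty is the conjugate of [cyl_exp i] at [l], attained at [Y0]; comparison with the
       zero function shows it nonnegative. *)
    exists P, (l Y0 - cyl_exp i Y0); split; [auto|split; [|split; [|split]]].
    + pose proof (Hle (fun _ => 0 * 1) (cylinder_const _ _)) as H.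
      rewrite (Hscal 0 (fun _ => 1)) in H by apply cylinder_const.
      rewrite cyl_exp_const in H; lra.
    + intros Y r HY Hr. rewrite (is_expectation_unique Hr (Hexp Y HY)).
      specialize (Hle Y HY); lra.
    + exists (l Y0); split; [auto|ring].
    + intros ->. rewrite cyl_exp_const.
      pose proof (Hscal 0 (fun _ => 0) (cylinder_const d 0)) as E; cbv beta in E.
      replace (fun _ : Path => 0 * 0) with (fun _ : Path => 0) in E
        by (apply functional_extensionality; intros; ring).
      lra.
Qed.

(** The maximal dual representation: all penalised measures below [cyl_exp i]. Domination gives one
    inequality on cylinder functions, attainment the other. *)
Definition chain_index (i : Idx d) : Type :=
  {k : ((Path -> Prop) -> R) * R | prob_measure cyl_sigma (fst k) /\ 0 <= snd k /\
    forall Y r, cylinder Y -> is_expectation cyl_sigma (fst k) Y r -> r - snd k <= cyl_exp i Y}.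

Definition chain_values (i : Idx d) (X : Path -> R) (y : R) : Prop :=
  exists (k : chain_index i) r, is_expectation cyl_sigma (fst (proj1_sig k)) X r /\ y = r - snd (proj1_sig k).

Definition chain_exp (i : Idx d) (X : Path -> R) : R := epsilon (inhabits 0) (is_lub (chain_values i X)).

(** A subgradient at the zero function has penalty 0, which also makes the infimum of the penalties
    zero. *)
Lemma chain_index_nonempty i eps : 0 < eps -> exists k : chain_index i, snd (proj1_sig k) < eps.
Proof.
  intros Heps; destruct (@cyl_exp_attained i (fun _ => 0) (cylinder_const _ _)) as [P [a [H1 [H2 [H3 [_ H4]]]]]].
  exists (exist _ (P, a) (conj H1 (conj H2 H3))); simpl. rewrite H4; auto.
Qed.

Lemma chain_exp_lub i X : bounded_fun X -> is_lub (chain_values i X) (chain_exp i X).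
Proof.
  intros [B HB]. unfold chain_exp. apply epsilon_spec.
  assert (HF : sigma_algebra cyl_sigma) by apply generated_sigma_algebra.
  destruct (completeness (chain_values i X)) as [m Hm]; [| |exists m; exact Hm].
  - exists B; intros y [[[P a] [H1 [H2 H3]]] [r [Hr ->]]]; simpl in *.
    destruct (is_expectation_exists HF H1 X HB) as [r' [Hr' Hb]].
    rewrite (is_expectation_unique Hr Hr'); lra.
  - destruct (chain_index_nonempty i Rlt_0_1) as [k _].
    destruct (is_expectation_exists HF (proj1 (proj2_sig k)) X HB) as [r [Hr _]].
    exists (r - snd (proj1_sig k)), k, r; auto.
Qed.

Lemma chain_exp_cylinder i Y : cylinder Y -> chain_exp i Y = cyl_exp i Y.
Proof.
  intros HY; eapply is_lub_u; [apply chain_exp_lub, cylinder_bounded, HY|split].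
  - intros y [[[P a] [H1 [H2 H3]]] [r [Hr ->]]]; simpl in *; auto.
  - intros b Hb; destruct (cyl_exp_attained i HY) as [P [a [H1 [H2 [H3 [[r [Hr E]] _]]]]]].
    rewrite <- E; apply Hb. exists (exist _ (P, a) (conj H1 (conj H2 H3))), r; auto.
Qed.

Lemma chain_exp_convex_expectation i : convex_expectation cyl_sigma (chain_exp i).
Proof.
  split; [apply generated_sigma_algebra|].
  exists (chain_index i), (fun k => fst (proj1_sig k)), (fun k => snd (proj1_sig k)).
  split; [|split; [|split]].
  - intros k; apply (proj2_sig k).
  - intros k; apply (proj2_sig k).
  - intros eps Heps; now apply chain_index_nonempty.
  - intros X _ HX; exact (chain_exp_lub i HX).
Qed.

Lemma semigroup_chain : exists M : ConvexMarkovChain d,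
  forall t u i, 0 <= t -> cmc_E M i (fun w => u (cmc_X M t w)) = S t u i.
Proof.
  assert (Hcoord : forall t i (u : Vec d), 0 <= t -> chain_exp i (fun w => u (w t)) = S t u i).
  { intros t i u Ht. rewrite chain_exp_cylinder; [now apply cyl_exp_coordinate|].
    now apply (cylinder_apply (Y := fun w : Path => w t) u), cylinder_coordinate. }
  unshelve eexists (@Build_ConvexMarkovChain d Path cyl_sigma chain_exp (fun t w => w t) _ _ _ _).
  - intros t i Ht F _ HF; cbv beta; apply HF.
    now apply (cylinder_apply (Y := fun w : Path => w t) (fun x => x = i)), cylinder_coordinate.
  - exact chain_exp_convex_expectation.
  - intros u0 i; cbv beta; rewrite (Hcoord 0 i u0 (Rle_refl 0)). apply (proj1 HS).
  - intros s t Hs Ht ts _ Hsort Hts v0 i; cbv beta.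
    assert (Hpos : Forall (Rle 0) ts).
    { eapply Forall_impl; [|exact Hts]; intros r [H _]; exact H. }
    assert (HsortS : StronglySorted Rlt ts).
    { apply Sorted_StronglySorted; [|auto]. intros x y z; apply Rlt_trans. }
    (* With the past frozen, the inner expectation concerns a single coordinate and is a value of
       the semigroup; both sides then contain only cylinder functions. *)
    replace (fun w : Path => chain_exp (w s) (fun w' => v0 (map (fun r => w r) ts) (w' t))) with
      (fun w : Path => S t (fun x => v0 (map (fun r => w r) ts) x) (w s)).
    2:{ apply functional_extensionality; intros w.
        now rewrite (Hcoord t (w s) (fun x => v0 (map (fun r => w r) ts) x)). }
    assert (Hst : 0 <= s + t) by lra.
    rewrite !chain_exp_cylinder.
    + now apply cyl_exp_markov.
    + apply (cylinder_combine (fun xs x => S t (fun y => v0 xs y) x)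
        (cylinder_coordinates d Hpos) (cylinder_coordinate d Hs)).
    + apply (cylinder_combine v0 (cylinder_coordinates d Hpos) (cylinder_coordinate d Hst)).
  - intros t u i Ht; now apply Hcoord.
Qed.

End IteratedSemigroup.

(** * Closing the equivalences *)

Lemma cond_iv_ii d (Q : Vec d -> Vec d) : cond_iv Q -> cond_ii Q.
Proof. intros [S [_ [_ [HC [HM HG]]]]]; exact (generator_cond_ii HC HM HG). Qed.

Lemma cond_v_ii d (Q : Vec d -> Vec d) : cond_v Q -> cond_ii Q.
Proof.
  intros [M HG]; exact (generator_cond_ii (@chain_sg_convex d M) (@chain_sg_markovian d M) HG).
Qed.

Lemma cond_ii_v d (Q : Vec d -> Vec d) : cond_ii Q -> cond_v Q.
Proof.
  intros HQ.
  destruct (semigroup_chain (flow_semigroup HQ) (flow_markovian HQ) (flow_convex HQ)) as [M HMQ].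
  exists M; intros u0 i eps Heps.
  destruct (flow_generator HQ u0 i Heps) as [delta [Hd K]].
  exists delta; split; [auto|]. intros h Hh; rewrite HMQ by lra; auto.
Qed.

Lemma semigroup_envelope_ext d (P : Mat d -> Prop) f (S S' : R -> Vec d -> Vec d) :
  (forall t u i, 0 <= t -> S' t u i = S t u i) -> is_semigroup S' ->
  semigroup_envelope P f S -> semigroup_envelope P f S'.
Proof.
  intros E HS' [_ [Hdom Hmin]]; split; [auto|split].
  - intros t u0 q v Ht Pq Hv i; rewrite E by auto; eapply Hdom; eauto.
  - intros T HT HTd t u0 i Ht; rewrite E by auto; auto.
Qed.

Unset Implicit Arguments.

Theorem mainTheorem1 (d : nat) (Hd : (1 <= d)%nat) (Q : Vec d -> Vec d) :
  (cond_i Q <-> cond_ii Q) /\ (cond_ii Q <-> cond_iii Q) /\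
  (cond_iii Q <-> cond_iv Q) /\ (cond_iv Q <-> cond_v Q) /\
  (cond_i Q ->
   forall (M : ConvexMarkovChain d), chain_generator M Q ->
   forall (S : R -> Vec d -> Vec d),
     is_semigroup S -> unif_continuous_sg S -> convex_sg S -> markovian_sg S ->
     sg_generator S Q ->
   forall (P : Mat d -> Prop) (f : Mat d -> Vec d), sup_representation Q P f ->
   forall u0 : Vec d,
     let u := fun (t : R) (i : Idx d) => cmc_E M i (fun w => u0 (cmc_X M t w)) in
     classical_solution Q u0 u /\
     (forall v, classical_solution Q u0 v -> forall t i, 0 <= t -> v t i = u t i) /\
     (forall t i, 0 <= t -> u t i = S t u0 i) /\
     semigroup_envelope P f S).
Proof.
  assert (H32 : cond_iii Q -> cond_ii Q).
  { intros [P [f Hr]]; exact (sup_representation_cond_ii Hr). }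
  pose proof (@cond_i_iff_ii d Q) as H12.
  pose proof (@cond_ii_iii d Q) as H23.
  pose proof (@cond_ii_iv d Q) as H24.
  pose proof (@cond_iv_ii d Q) as H42.
  pose proof (@cond_v_ii d Q) as H52.
  pose proof (@cond_ii_v d Q) as H25.
  split; [exact H12|split; [tauto|split; [tauto|split; [tauto|]]]].
  intros HQ1 M HMG S HS _ HC HM HG P f Hr u0 u.
  assert (HQ : cond_ii Q) by tauto.
  assert (Eu : forall t i, 0 <= t -> u t i = flow Q t u0 i).
  { intros t i Ht.
    (* [chain_generator M Q] unfolds to [sg_generator (chain_sg M) Q], so the uniqueness result for
       semigroups covers the chain. *)
    exact (semigroup_eq_flow (@chain_sg_semigroup d M) (@chain_sg_convex d M) (@chain_sg_markovian d M)
      HMG u0 i Ht). }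
  assert (ES : forall t v i, 0 <= t -> S t v i = flow Q t v i).
  { intros t v i Ht; exact (semigroup_eq_flow HS HC HM HG v i Ht). }
  split; [|split; [|split]].
  - exact (@classical_solution_ext d Q u0 _ u (flow_solution HQ u0) Eu).
  - intros v Hv t i Ht; rewrite Eu by auto. now apply flow_unique.
  - intros t i Ht; rewrite Eu, ES by auto; auto.
  - exact (@semigroup_envelope_ext d P f _ S ES HS (flow_envelope Hr)).
Qed.
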